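(* The function $d:\mathcal{X}_{\mathbb{F}}\times\mathcal{X}_{\mathbb{F}}\to\Lambda$, $d(x,y)=(-v)\big(N_{\mathbb{F}}(\delta_{\mathbb{F}}(x,y))\big)$, is a ($\Lambda$-valued) pseudo-distance: for all $x,y,z\in\mathcal{X}_{\mathbb{F}}$ one has $d(x,x)=0$, $d(x,y)\ge0$, $d(x,y)=d(y,x)$ and $d(x,y)\le d(x,z)+d(z,y)$.
   Context: Let $\mathbb{K},\mathbb{F}$ be real closed fields with $\mathbb{K}\subseteq\mathbb{R}\cap\mathbb{F}$. Let $O\subsetneq\mathbb{F}$ be an order convex subring ($a,b\in O$ and $a\le c\le b$ imply $c\in O$); it is a valuation ring. Let $\Lambda=\mathbb{F}^\times/O^\times$, written additively, and let $v:\mathbb{F}\to\Lambda\cup\{\infty\}$ be the associated valuation, with $\Lambda$ ordered so that $(-v)(a)\ge(-v)(b)$ whenever $a\ge b>0$; thus $O=\{a:(-v)(a)\le 0\}$. For a semialgebraic set $V$ defined over $\mathbb{K}$, $V_{\mathbb{F}}$ denotes its $\mathbb{F}$-extension. $G<\operatorname{SL}_n$ is a connected semisimple algebraic group over $\mathbb{K}$, self-adjoint ($g\in G$ implies $g^{\mathsf T}\in G$). $S<G$ is a maximal $\mathbb{K}$-split torus with $s=s^{\mathsf T}$ for all $s\in S$; $A_{\mathbb{F}}$ is the $\mathbb{F}$-extension of the semialgebraic connected component of $S_{\mathbb{K}}$ containing $\operatorname{Id}$; $K_{\mathbb{F}}=G_{\mathbb{F}}\cap\operatorname{SO}_n(\mathbb{F})$.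 Let $\mathfrak{a}=\operatorname{Lie}(A_{\mathbb{R}})$; $\Sigma\subseteq\mathfrak{a}^\star$ is the root system of $\operatorname{Lie}(G_{\mathbb{R}})$ with respect to $\mathfrak{a}$. For $\alpha\in\Sigma$, $\chi_\alpha:A_{\mathbb{F}}\to\mathbb{F}_{>0}$ is the restriction of the algebraic character of $S$ over $\mathbb{K}$ which over $\mathbb{R}$ satisfies $\chi_\alpha(\exp H)=e^{\alpha(H)}$, $H\in\mathfrak{a}$. Fix a basis $\Delta$ of $\Sigma$ and let $A^+_{\mathbb{F}}=\{a\in A_{\mathbb{F}}:\chi_\alpha(a)\ge1\ \forall\alpha\in\Delta\}$. $G_{\mathbb{F}}$ acts on symmetric positive definite matrices of determinant $1$ over $\mathbb{F}$ by $g.x=gxg^{\mathsf T}$, and $\mathcal{X}_{\mathbb{F}}=G_{\mathbb{F}}.\operatorname{Id}$. For $x=g.\operatorname{Id}$, $y=h.\operatorname{Id}$, $\delta_{\mathbb{F}}(x,y)$ is the unique $a\in A^+_{\mathbb{F}}$ with $g^{-1}h\in K_{\mathbb{F}}aK_{\mathbb{F}}$ (Cartan decomposition). For $a\in A_{\mathbb{F}}$, $N_{\mathbb{F}}(a)=\prod_{\alpha\in\Sigma}\max\{\chi_\alpha(a),\chi_\alpha(a)^{-1}\}\in\mathbb{F}_{\ge1}$. *)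

(* Defs.v *)
From HB Require Import structures.
From mathcomp Require Import all_boot all_order all_algebra.
From mathcomp Require Import generic_quotient complex.
From mathcomp Require mpoly.
From mathcomp Require Import all_classical all_reals all_analysis.

Set Implicit Arguments.
Unset Strict Implicit.
Unset Printing Implicit Defensive.

Import Order.TTheory GRing.Theory Num.Theory numFieldNormedType.Exports.

Local Open Scope classical_set_scope.
Local Open Scope ring_scope.
Local Open Scope quotient_scope.

Record convexSubring (F : rcfType) := ConvexSubring {
  convexSubring_pred :> {pred F};
  convexSubringP : subring_closed convexSubring_pred;
  convexSubring_convex : forall a b c : F,
    a \in convexSubring_pred -> b \in convexSubring_pred ->
    a <= c <= b -> c \in convexSubring_pred }.

Section ValueGroup.
Variables (F : rcfType) (O : convexSubring F).

Let O1 : 1 \in O. Proof. by have [] := convexSubringP O. Qed.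
Let OB : {in O &, forall x y, x - y \in O}.
Proof. by have [] := convexSubringP O. Qed.
Let OM : {in O &, forall x y, x * y \in O}.
Proof. by have [] := convexSubringP O. Qed.
Let ON x : x \in O -> - x \in O.
Proof.
move=> Ox; have O0 : 0 \in O by rewrite -(subrr 1) OB.
by rewrite -sub0r OB.
Qed.

Lemma convexSubring_total (x : F) : (x \in O) || (x^-1 \in O).
Proof.
have small y : `|y| <= 1 -> y \in O.
  by rewrite ler_norml => /(convexSubring_convex (ON O1) O1).
have [x1|x1] := leP `|x| 1; first by rewrite small.
by rewrite orbC small// normfV invf_le1 ?(ltW x1)// (lt_trans _ x1).
Qed.

Definition nonzero := {x : F | x != 0}.

(* a ~ b iff a / b is a unit of O *)
Definition val_equiv (a b : nonzero) : bool :=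
  (val a / val b \in O) && (val b / val a \in O).

Let chain (x y z : F) : y != 0 -> x / y \in O -> y / z \in O -> x / z \in O.
Proof. by move=> y0 xy yz; have := OM xy yz; rewrite mulrA divfK. Qed.

Lemma val_equiv_refl : reflexive val_equiv.
Proof. by move=> [a a0]; rewrite /val_equiv/= divff// O1. Qed.
Lemma val_equiv_sym : symmetric val_equiv.
Proof. by move=> a b; rewrite /val_equiv andbC. Qed.
Lemma val_equiv_trans : transitive val_equiv.
Proof.
move=> [b b0] [a a0] [c c0] /andP[/= ab ba] /andP[/= bc cb].
by rewrite /val_equiv/= (chain b0 ab bc) (chain b0 cb ba).
Qed.

Canonical val_equiv_equiv :=
  EquivRel val_equiv val_equiv_refl val_equiv_sym val_equiv_trans.

Definition valueGroup := {eq_quot val_equiv}.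
HB.instance Definition _ := Choice.on valueGroup.
HB.instance Definition _ := EqQuotient.on valueGroup.

Definition nz1 : nonzero := Sub 1 (oner_neq0 F).
Definition nzM (a b : nonzero) : nonzero :=
  Sub (val a * val b) (mulf_neq0 (valP a) (valP b)).
Definition nzV (a : nonzero) : nonzero :=
  Sub (val a)^-1 (etrans (congr1 negb (invr_eq0 _)) (valP a)).

(* the additive group law of the value group is multiplication in F *)
Definition vzero : valueGroup := \pi_valueGroup nz1.
Definition vadd (x y : valueGroup) : valueGroup := \pi_valueGroup (nzM (repr x) (repr y)).
Definition vopp (x : valueGroup) : valueGroup := \pi_valueGroup (nzV (repr x)).
(* v(a) <= v(b) iff b / a lies in O *)
Definition vle (x y : valueGroup) : bool := val (repr y) / val (repr x) \in O.
Definition vlt (x y : valueGroup) : bool := (y != x) && vle x y.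

Let vpiE (a b : nonzero) : (\pi_valueGroup a == \pi_valueGroup b) = val_equiv a b.
Proof. by rewrite eqmodE. Qed.

Let reprE (a : nonzero) : val_equiv (repr (\pi_valueGroup a)) a.
Proof. by rewrite -vpiE reprK. Qed.

Let vaddE a b : vadd (\pi_valueGroup a) (\pi_valueGroup b) = \pi_valueGroup (nzM a b).
Proof.
apply/eqP; rewrite vpiE /val_equiv/= !invfM.
have /andP[aa' a'a] := reprE a; have /andP[bb' b'b] := reprE b.
by apply/andP; split; rewrite mulrACA; apply: OM.
Qed.

Let voppE a : vopp (\pi_valueGroup a) = \pi_valueGroup (nzV a).
Proof.
apply/eqP; rewrite vpiE /val_equiv/= !invrK ![_^-1 * _]mulrC.
by have /andP[-> ->] := reprE a.
Qed.

Let vleE a b : vle (\pi_valueGroup a) (\pi_valueGroup b) = (val b / val a \in O).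
Proof.
have /andP[aa' a'a] := reprE a; have /andP[bb' b'b] := reprE b.
apply/idP/idP => ba.
  by apply: (chain (valP (repr (\pi_valueGroup a)))) aa';
     apply: (chain (valP (repr (\pi_valueGroup b)))) ba.
by apply: (chain (valP a)) a'a; apply: (chain (valP b)) ba.
Qed.

Fact vaddA : associative vadd.
Proof.
elim/quotW=> a; elim/quotW=> b; elim/quotW=> c.
rewrite (vaddE b c) (vaddE a b) !vaddE.
by apply: (congr1 \pi_valueGroup); apply: val_inj; rewrite /= mulrA.
Qed.
Fact vaddC : commutative vadd.
Proof.
elim/quotW=> a; elim/quotW=> b; rewrite !vaddE.
by apply: (congr1 \pi_valueGroup); apply: val_inj; rewrite /= mulrC.
Qed.
Fact vadd0 : left_id vzero vadd.
Proof.
elim/quotW=> a; rewrite vaddE.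
by apply: (congr1 \pi_valueGroup); apply: val_inj; rewrite /= mul1r.
Qed.
Fact vaddN : left_inverse vzero vopp vadd.
Proof.
elim/quotW=> a; rewrite voppE vaddE.
by apply: (congr1 \pi_valueGroup); apply: val_inj; rewrite /= mulVf// (valP a).
Qed.
HB.instance Definition _ :=
  GRing.isZmodule.Build valueGroup vaddA vaddC vadd0 vaddN.

Fact vle_refl : reflexive vle.
Proof. by elim/quotW=> a; rewrite vleE divff ?O1// (valP a). Qed.
Fact vle_anti : antisymmetric vle.
Proof.
elim/quotW=> a; elim/quotW=> b; rewrite !vleE => /andP[ba ab].
by apply/eqP; rewrite vpiE /val_equiv ab ba.
Qed.
Fact vle_trans : transitive vle.
Proof.
elim/quotW=> b; elim/quotW=> a; elim/quotW=> c; rewrite !vleE => ba cb.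
exact: chain (valP b) cb ba.
Qed.
Fact vle_total : total vle.
Proof.
elim/quotW=> a; elim/quotW=> b; rewrite !vleE.
by rewrite -[val a / _]invrK invf_div convexSubring_total.
Qed.
HB.instance Definition _ := Order.isPOrder.Build ring_display valueGroup
  (fun _ _ => erefl : vlt _ _ = _) vle_refl vle_anti vle_trans.
HB.instance Definition _ :=
  Order.POrder_isTotal.Build ring_display valueGroup vle_total.

Lemma vle_add (x y z : valueGroup) : (x + y <= x + z) = (y <= z).
Proof.
elim/quotW: x => a; elim/quotW: y => b; elim/quotW: z => c.
rewrite /Order.le/= /GRing.add/= !vaddE !vleE/= invfM mulrACA divff ?mul1r//.
exact: valP a.
Qed.

(* [None] stands for the value oo of 0. *)
Definition valuation (a : F) : option valueGroup :=
  omap (fun u : nonzero => \pi_valueGroup u) (insub a).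

(* -v on nonzero elements; the value at 0 is a dummy *)
Definition oppv (a : F) : valueGroup := - odflt 0 (valuation a).

Let oppv_pi (a : nonzero) : oppv (val a) = - \pi_valueGroup a.
Proof. by rewrite /oppv /valuation valK. Qed.

Let oppv_leE (a b : nonzero) :
  (oppv (val b) <= oppv (val a)) = (val b / val a \in O).
Proof.
rewrite !oppv_pi -[in RHS]vleE -/(\pi_valueGroup a <= \pi_valueGroup b).
rewrite -(vle_add (\pi_valueGroup a + \pi_valueGroup b)) addrK addrAC subrr.
by rewrite add0r.
Qed.

Lemma oppv_le (a b : F) : 0 < b -> b <= a -> oppv b <= oppv a.
Proof.
move=> b0 ba; have a0 := lt_le_trans b0 ba.
rewrite (oppv_leE (Sub a (lt0r_neq0 a0)) (Sub b (lt0r_neq0 b0)))/=.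
have O0 : 0 \in O by rewrite -(subrr 1) OB.
apply: (convexSubring_convex O0 O1).
by rewrite divr_ge0 ?(ltW a0) ?(ltW b0)//= ler_pdivrMr// mul1r.
Qed.

Lemma oppv_le0 (a : F) : a != 0 -> (oppv a <= 0) = (a \in O).
Proof.
move=> a0; have -> : 0 = oppv (val nz1).
  by rewrite oppv_pi -[\pi_valueGroup nz1]/(0 : valueGroup) oppr0.
by rewrite (oppv_leE nz1 (Sub a a0))/= divr1.
Qed.

End ValueGroup.

(* Polynomials in the n * n matrix entries with coefficients in K, evaluated at
   a matrix over an extension f : K -> L. *)
Definition evalmx (K L : comNzRingType) (f : K -> L) n
    (p : mpoly.mpoly (n * n) K) (g : 'M[L]_n) : L :=
  mpoly.mmap f (fun k => mxvec g 0 k) p.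

(* L-points of the algebraic set defined over K by P *)
Definition points (K L : comNzRingType) (f : K -> L) n
    (P : seq (mpoly.mpoly (n * n) K)) : set 'M[L]_n :=
  [set g | all (fun p => evalmx f p g == 0) P].

Section MatrixGroups.
Variables (L : fieldType) (n : nat).
Implicit Types (E H G : set 'M[L]_n).

Definition matrix_group G : Prop :=
  [/\ G 1%:M,
      forall g h, G g -> G h -> G (g *m h) &
      forall g, G g -> g \in unitmx /\ G (invmx g)].

Definition normal_in H G : Prop :=
  forall g h, G g -> H h -> H (g *m h *m invmx g).

Definition derived_group H : set 'M[L]_n :=
  smallest matrix_group
    [set x | exists g h, [/\ H g, H h & x = g *m h *m invmx g *m invmx h]].

Definition solvable_group H : Prop :=
  exists k, iter k derived_group H = [set 1%:M].

Definition zariski_closed E : Prop :=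
  exists P : seq (mpoly.mpoly (n * n) L), E = points idfun P.

Definition zariski_connected E : Prop :=
  forall U V, zariski_closed U -> zariski_closed V ->
    E `<=` U `|` V -> E `&` U `&` V = set0 -> E `<=` U \/ E `<=` V.

(* The radical, i.e. the largest connected solvable normal closed subgroup, is
   trivial. *)
Definition semisimple G : Prop :=
  forall H, zariski_closed H -> matrix_group H -> H `<=` G ->
    normal_in H G -> zariski_connected H -> solvable_group H ->
    H = [set 1%:M].

End MatrixGroups.

(* Geometric properties are those of the points over the algebraic closure
   K[i]; as K is perfect, being defined over K amounts to being the zero set of
   polynomials over K. *)

Section AlgebraicGroups.
Variables (K : rcfType) (n : nat).
Notation poly := (mpoly.mpoly (n * n) K).
Implicit Types (G S T : seq poly) (p : poly).

Definition geom_points G : set 'M[K[i]]_n := points (real_complex K) G.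

Definition algebraic_group G : Prop :=
  matrix_group (geom_points G) /\ geom_points G `<=` [set g | \det g = 1].

Definition self_adjoint G : Prop :=
  forall g, geom_points G g -> geom_points G g^T.

(* [Gm r] is the set of points of the r-th power of the multiplicative group;
   its regular functions are the polynomials in the coordinates t_k and
   their inverses. *)
Definition Gm r : set 'rV[K[i]]_r := [set t | forall k, t 0 k != 0].

Definition Gm_mul r (t u : 'rV[K[i]]_r) : 'rV[K[i]]_r :=
  \row_k (t 0 k * u 0 k).

Definition Gm_eval r (q : mpoly.mpoly (r + r) K) (t : 'rV[K[i]]_r) : K[i] :=
  mpoly.mmap (real_complex K)
    (fun k => row_mx t (map_mx (fun c => c^-1) t) 0 k) q.

(* T is isomorphic over K to a power of the multiplicative group: [phi] and
   [psi] are mutually inverse K-morphisms of varieties and [phi] is a group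
   homomorphism. *)
Definition split_torus T : Prop :=
  algebraic_group T /\
  exists r (f : 'I_n -> 'I_n -> mpoly.mpoly (r + r) K) (h : 'I_r -> poly),
    let phi t : 'M[K[i]]_n := \matrix_(i, j) Gm_eval (f i j) t in
    let psi s : 'rV[K[i]]_r := \row_k evalmx (real_complex K) (h k) s in
    [/\ forall t, Gm t -> geom_points T (phi t),
        forall s, geom_points T s -> Gm (psi s),
        forall t, Gm t -> psi (phi t) = t,
        forall s, geom_points T s -> phi (psi s) = s &
        forall t u, Gm t -> Gm u -> phi (Gm_mul t u) = phi t *m phi u].

Definition maximal_split_torus G S : Prop :=
  [/\ split_torus S, geom_points S `<=` geom_points G &
      forall T, split_torus T -> geom_points S `<=` geom_points T ->
        geom_points T `<=` geom_points G -> geom_points T = geom_points S].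

Definition symmetric_points S : Prop :=
  forall s, geom_points S s -> s^T = s.

(* p restricts to an algebraic character of S defined over K. *)
Definition algebraic_character S p : Prop :=
  let ev := evalmx (real_complex K) p in
  (forall s, geom_points S s -> ev s != 0) /\
  (forall s t, geom_points S s -> geom_points S t ->
     ev (s *m t) = ev s * ev t).

End AlgebraicGroups.

Section Semialgebraic.
Variables (K : rcfType) (n : nat).
Notation poly := (mpoly.mpoly (n * n) K).
Implicit Types C V U : set 'M[K]_n.

(* A finite union of sets {p = 0 for p in b.1, q > 0 for q in b.2}, over an
   extension f : K -> L. *)
Definition sa_points (L : rcfType) (f : K -> L) (D : seq (seq poly * seq poly)) :
    set 'M[L]_n :=
  [set g | has (fun b => all (fun p => evalmx f p g == 0) b.1 &&
                         all (fun q => 0 < evalmx f q g) b.2) D].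

Definition semialgebraic V : Prop := exists D, V = sa_points idfun D.

(* By Tarski-Seidenberg the points over L do not depend on the chosen
   description of V. *)
Definition sa_extension (L : rcfType) (f : K -> L) V : set 'M[L]_n :=
  [set g | exists2 D, V = sa_points idfun D & sa_points f D g].

Definition open_in C U : Prop := exists2 W, open W & U = C `&` W.

Definition sa_connected C : Prop :=
  forall U V, semialgebraic U -> semialgebraic V -> open_in C U ->
    open_in C V -> U `|` V = C -> U `&` V = set0 -> U = set0 \/ V = set0.

Definition sa_component V (x : 'M[K]_n) : set 'M[K]_n :=
  \bigcup_(C in [set C | [/\ semialgebraic C, sa_connected C, C `<=` V & C x]])
    C.

End Semialgebraic.

Section Lie.
Variables (R : realType) (n : nat).

Definition mxexp (X : 'M[R]_n) : 'M[R]_n :=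
  \matrix_(i, j)
    limn (fun m => (\sum_(k < m) (k`!%:R)^-1 *: X ^+ k) i j).

Definition Lie (H : set 'M[R]_n) : set 'M[R]_n :=
  [set X | forall t : R, H (mxexp (t *: X))].

(* [Lie H] as a linear subspace, which it is when H is a closed subgroup *)
Definition Lie_space (H : set 'M[R]_n) : {vspace 'M[R]_n} :=
  xget 0%VS [set U : {vspace 'M[R]_n} | forall X, X \in U <-> Lie H X].

Definition roots (g : set 'M[R]_n) (a : {vspace 'M[R]_n}) :
    set 'Hom(subvs_of a, R^o) :=
  [set alpha | alpha != 0 /\
    exists X, [/\ g X, X != 0 &
      forall H : subvs_of a,
        vsval H *m X - X *m vsval H = (alpha H : R) *: X]].

Definition root_basis (a : {vspace 'M[R]_n})
    (Sigma : set 'Hom(subvs_of a, R^o)) (Delta : seq 'Hom(subvs_of a, R^o)) :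
    Prop :=
  [/\ basis_of fullv Delta,
      forall alpha, alpha \in Delta -> Sigma alpha &
      forall alpha, Sigma alpha -> exists c : nat -> nat,
        let comb := \sum_(i < size Delta) Delta`_i *+ c i in
        alpha = comb \/ alpha = - comb].

End Lie.

Section SymmetricSpace.
Variables (K : rcfType) (R : realType) (F : rcfType).
Variables (iR : {rmorphism K -> R}) (iF : {rmorphism K -> F}) (n : nat).
Variables (G S : seq (mpoly.mpoly (n * n) K)).

Definition G_F : set 'M[F]_n := points iF G.
Definition G_R : set 'M[R]_n := points iR G.

Definition K_F : set 'M[F]_n :=
  G_F `&` [set k | k *m k^T = 1%:M /\ \det k = 1].

Definition A_K : set 'M[K]_n := sa_component (points idfun S) 1%:M.
Definition A_F : set 'M[F]_n := sa_extension iF A_K.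
Definition A_R : set 'M[R]_n := sa_extension iR A_K.

Definition Lie_A : {vspace 'M[R]_n} := Lie_space A_R.

Definition Sigma : set 'Hom(subvs_of Lie_A, R^o) := @roots R n (Lie G_R) Lie_A.

(* p represents the algebraic character of S over K with differential alpha;
   its values on the points of A over any extension depend on alpha only. *)
Definition represents_char (alpha : 'Hom(subvs_of Lie_A, R^o))
    (p : mpoly.mpoly (n * n) K) : Prop :=
  algebraic_character S p /\
  forall H : subvs_of Lie_A, evalmx iR p (mxexp (vsval H)) = expR (alpha H).

Definition chi (alpha : 'Hom(subvs_of Lie_A, R^o)) (a : 'M[F]_n) : F :=
  xget 0 [set c | exists2 p, represents_char alpha p & c = evalmx iF p a].

Definition A_F_plus (Delta : seq 'Hom(subvs_of Lie_A, R^o)) : set 'M[F]_n :=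
  A_F `&` [set a | forall alpha, alpha \in Delta -> 1 <= chi alpha a].

Definition act (g x : 'M[F]_n) : 'M[F]_n := g *m x *m g^T.

Definition X_F : set 'M[F]_n := [set act g 1%:M | g in G_F].

(* The Cartan projection: by the Cartan decomposition there is exactly one such
   a, and it does not depend on g and h. *)
Definition delta (Delta : seq 'Hom(subvs_of Lie_A, R^o)) (x y : 'M[F]_n) :
    'M[F]_n :=
  xget 1%:M [set a | A_F_plus Delta a /\
    exists g h, [/\ G_F g, G_F h, x = act g 1%:M, y = act h 1%:M &
      exists k k', [/\ K_F k, K_F k' & invmx g *m h = k *m a *m k']]].

Definition N_F (a : 'M[F]_n) : F :=
  \big[*%R/1]_(alpha \in Sigma) Num.max (chi alpha a) (chi alpha a)^-1.

Definition dist (O : convexSubring F)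
    (Delta : seq 'Hom(subvs_of Lie_A, R^o)) (x y : 'M[F]_n) : valueGroup O :=
  oppv O (N_F (delta Delta x y)).

End SymmetricSpace.

Arguments Sigma {K R} iR {n} G S.
Arguments chi {K R F} iR iF {n} S alpha a.
Arguments A_F_plus {K R F} iR iF {n} S Delta.
Arguments delta {K R F} iR iF {n} G S Delta x y.
Arguments dist {K R F} iR iF {n} G S O Delta x y.

(* Main.v *)
(** Write a k b = k' c k'' with a, b, c in A and k, k', k'' in K.  The triangle inequality is the
    statement N(c) <= N(a) N(b); together with G = K A^+ K it is first order over K, so both can be
    proved over R and then transferred to K and to F by quantifier elimination.

    Over R put f(H) = log N(exp H), which is the sum of the |alpha(H)|, alpha in Sigma; it is a
    seminorm on Lie(A) invariant under the normalizer of Lie(A) in K.  For L in Lie(A) bounded by f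
    (for the trace form), maximizing tr(k L k^T H) over k in K gives the linear form of Kostant's
    inequality, tr(k L k^T H) <= f(H).  Pairing L with the logarithm of the diagonal part in an
    Iwasawa decomposition turns it, one small step exp(sH) at a time, into f(c) <= f(a) + f(b).  The
    Cartan decomposition comes from the polar decomposition and from maximizing tr(k X k^T P) over K
    for a regular P in the chamber of Delta: the second variation gives alpha(H) alpha(P) >= 0.

    Both arguments need Lie(A) to be maximal abelian among the symmetric elements of Lie(G), whereas S
    is only maximal among the tori split over K.  If q in G(K) is symmetric and commutes with A, then
    A and q^2 are simultaneously diagonal; the multiplicative relations between the eigenvalues of all
    the positive diagonal elements of G(K) form a saturated lattice, which by the Smith normal form
    defines a split torus T containing S and q^2.  Independence of characters (Dedekind) shows that T
    lies in G, so T = S.  The same lemma interpolates powers: exp(mX) in G for all natural m implies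
    exp(tX) in G for all real t, for symmetric X. *)

From HB Require Import structures.
Require Import Defs.
From mathcomp Require Import all_boot all_order all_algebra perm.
From mathcomp Require Import generic_quotient complex polyrcf qe_rcf_th.
From mathcomp Require qe_rcf mpoly.
From mathcomp Require Import ring lra.
From mathcomp Require Import all_classical all_reals all_analysis.
Set Implicit Arguments.
Unset Strict Implicit.
Unset Printing Implicit Defensive.
Import (canonicals) mpoly.
Import Order.TTheory GRing.Theory Num.Theory numFieldNormedType.Exports.
Local Open Scope classical_set_scope.
Local Open Scope ring_scope.

(** * Transfer between real closed fields *)

(** A transfer needs one quantifier-free formula that is valid over every real closed extension of K
    at once. The elimination procedure is therefore shown to commute with maps of the coefficients;
    a definable statement then has the same truth value over K, R and F, so what analysis proves
    over R descends to K and ascends to F. Everything transferred has to be first order: maxima in N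
    become finite choices of factors, inverses become existential statements, open sets become boxes
    of entries, and A becomes the set of points of S at which the split coordinates are positive.
    Maximality travels the other way: it is a property of S over K, phrased for squares of symmetric
    elements commuting with A, and it is carried from K to R before the analysis starts. The
    triangle inequality is stated for every c with a k b = k' c k''; with trivial factors it also
    yields d(x,x) = 0 and the symmetry of d. *)

Section Map.
Variables (K L : rcfType) (f : {rmorphism K -> L}).
Import qe_rcf.

Fixpoint term_map (t : term K) : term L :=
  match t with
  | Var i => Var _ i
  | Const c => Const (f c)
  | NatConst n => NatConst _ n
  | Add a b => Add (term_map a) (term_map b)
  | Opp a => Opp (term_map a)
  | NatMul a n => NatMul (term_map a) n
  | Mul a b => Mul (term_map a) (term_map b)
  | Exp a n => Exp (term_map a) n
  end.

Fixpoint formula_map (t : formula K) : formula L :=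
  match t with
  | Bool b => Bool b
  | Equal a b => Equal (term_map a) (term_map b)
  | Lt a b => Lt (term_map a) (term_map b)
  | Le a b => Le (term_map a) (term_map b)
  | And a b => And (formula_map a) (formula_map b)
  | Or a b => Or (formula_map a) (formula_map b)
  | Implies a b => Implies (formula_map a) (formula_map b)
  | Not a => Not (formula_map a)
  end.

Notation pmap := (map term_map).

(** The elimination procedure is written in continuation-passing style, so the lemmas on its stages
    assume that the continuations correspond under the coefficient map and conclude that the
    resulting formulas do. *)
Lemma term_map_Size p k k' : (forall n, formula_map (k n) = k' n) ->
  formula_map (Size p k) = Size (pmap p) k'.
Proof.
elim: p k k' => [|c q IH] k k' kk'; first exact: kk'.
by rewrite /= /bind_def; apply: IH => -[|n] //=; rewrite /If /= !kk'.
Qed.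

Lemma term_map_Isnull p k k' : (forall n, formula_map (k n) = k' n) ->
  formula_map (Isnull p k) = Isnull (pmap p) k'.
Proof. by move=> kk'; apply: term_map_Size => n; apply: kk'. Qed.

Lemma term_map_LtSize p q k k' : (forall n, formula_map (k n) = k' n) ->
  formula_map (LtSize p q k) = LtSize (pmap p) (pmap q) k'.
Proof. by move=> kk'; apply: term_map_Size => n; apply: term_map_Size => m. Qed.

Lemma term_map_LeadCoef p k k' : (forall n, formula_map (k n) = k' (term_map n)) ->
  formula_map (LeadCoef p k) = LeadCoef (pmap p) k'.
Proof.
elim: p k k' => [|c q IH] k k' kk' /=; first by rewrite kk' /= rmorph0.
by apply: IH => l; rewrite /If /= !kk'.
Qed.

Lemma term_map_AmulXn a n : pmap (AmulXn a n) = AmulXn (term_map a) n.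
Proof. by elim: n => //= n ->; rewrite rmorph0. Qed.

Lemma term_map_AddPoly p q : pmap (AddPoly p q) = AddPoly (pmap p) (pmap q).
Proof. by elim: p q => [|a p IH] [|b q] //=; rewrite IH. Qed.

Lemma term_map_ScalPoly c p : pmap (ScalPoly c p) = ScalPoly (term_map c) (pmap p).
Proof. by rewrite /ScalPoly -!map_comp; apply: eq_map. Qed.

Lemma term_map_MulPoly p q : pmap (MulPoly p q) = MulPoly (pmap p) (pmap q).
Proof. by elim: p => //= a p IH; rewrite term_map_AddPoly term_map_ScalPoly /= IH. Qed.

Lemma term_map_ExpPoly p n : pmap (ExpPoly p n) = ExpPoly (pmap p) n.
Proof.
rewrite /ExpPoly /iterop; case: n => //= n.
by elim: n => //= n IH; rewrite term_map_MulPoly IH.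
Qed.

Lemma term_map_OppPoly p : pmap (OppPoly p) = OppPoly (pmap p).
Proof. by rewrite /OppPoly term_map_ScalPoly /= rmorphN1. Qed.

Lemma term_map_NatMulPoly n p : pmap (NatMulPoly n p) = NatMulPoly n (pmap p).
Proof. by rewrite /NatMulPoly term_map_ScalPoly. Qed.

Lemma term_map_Deriv p : pmap (Deriv p) = Deriv (pmap p).
Proof. by elim: p => //= a q IH; rewrite term_map_AddPoly /= IH. Qed.

Lemma term_map_Rediv_rec_loop q sq cq c qq r n k k' :
  (forall c qq r, formula_map (k (c, qq, r)) = k' (c, pmap qq, pmap r)) ->
  formula_map (Rediv_rec_loop q sq cq c qq r n k) =
  Rediv_rec_loop (pmap q) sq (term_map cq) c (pmap qq) (pmap r) n k'.
Proof.
move=> kk'; elim: n c qq r => [|n IH] c qq r /=; apply: term_map_Size => sr;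
  case: ifP => // _; apply: term_map_LeadCoef => lr.
  by rewrite kk' !term_map_AddPoly !term_map_OppPoly !term_map_MulPoly term_map_AmulXn.
by rewrite IH !term_map_AddPoly !term_map_OppPoly !term_map_MulPoly term_map_AmulXn.
Qed.

Lemma term_map_Rediv p q k k' :
  (forall c qq r, formula_map (k (c, qq, r)) = k' (c, pmap qq, pmap r)) ->
  formula_map (Rediv p q k) = Rediv (pmap p) (pmap q) k'.
Proof.
move=> kk'; apply: term_map_Isnull => -[]; first by rewrite kk' /= rmorph0.
apply: term_map_Size => sq; apply: term_map_Size => sp; apply: term_map_LeadCoef => lq.
by rewrite (term_map_Rediv_rec_loop _ _ _ _ _ _ _ kk') /= rmorph0.
Qed.

Lemma term_map_Rgcd_loop n p q k k' : (forall p, formula_map (k p) = k' (pmap p)) ->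
  formula_map (Rgcd_loop n p q k) = Rgcd_loop n (pmap p) (pmap q) k'.
Proof.
move=> kk'; elim: n p q => [|n IH] p q /=; apply: term_map_Rediv => c qq r;
  by apply: term_map_Isnull => -[].
Qed.

Lemma term_map_Rgcd p q k k' : (forall p, formula_map (k p) = k' (pmap p)) ->
  formula_map (Rgcd p q k) = Rgcd (pmap p) (pmap q) k'.
Proof.
move=> kk'; apply: term_map_LtSize => -[]; apply: term_map_Isnull => -[] //;
  by apply: term_map_Size => n; apply: term_map_Rgcd_loop.
Qed.

Lemma term_map_BigRgcd ps k k' : (forall p, formula_map (k p) = k' (pmap p)) ->
  formula_map (BigRgcd ps k) = BigRgcd (map pmap ps) k'.
Proof.
elim: ps k k' => [|p ps IH] k k' kk' /=; first by rewrite kk' /= rmorph0.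
by apply: IH => r; apply: term_map_Rgcd.
Qed.

Lemma term_map_Changes s k k' : (forall n, formula_map (k n) = k' n) ->
  formula_map (Changes s k) = Changes (pmap s) k'.
Proof.
elim: s k k' => [|a q IH] k k' kk' /=; first exact: kk'.
by apply: IH => v; rewrite /If /= !kk'; case: (q).
Qed.

Lemma term_map_SeqPInfty ps k k' : (forall n, formula_map (k n) = k' (pmap n)) ->
  formula_map (SeqPInfty ps k) = SeqPInfty (map pmap ps) k'.
Proof.
elim: ps k k' => [|a q IH] k k' kk' /=; first exact: kk'.
by apply: term_map_LeadCoef => lp; apply: IH => v; rewrite kk'.
Qed.

Lemma term_map_SeqMInfty ps k k' : (forall n, formula_map (k n) = k' (pmap n)) ->
  formula_map (SeqMInfty ps k) = SeqMInfty (map pmap ps) k'.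
Proof.
elim: ps k k' => [|a q IH] k k' kk' /=; first exact: kk'.
apply: term_map_LeadCoef => lp; apply: term_map_Size => sp; apply: IH => v.
by rewrite kk' /= rmorphN1.
Qed.

Lemma term_map_ChangesPoly ps k k' : (forall n, formula_map (k n) = k' n) ->
  formula_map (ChangesPoly ps k) = ChangesPoly (map pmap ps) k'.
Proof.
move=> kk'; apply: term_map_SeqMInfty => mps; apply: term_map_SeqPInfty => pps.
by apply: term_map_Changes => vm; apply: term_map_Changes => vp.
Qed.

Lemma term_map_NextMod p q k k' : (forall p, formula_map (k p) = k' (pmap p)) ->
  formula_map (NextMod p q k) = NextMod (pmap p) (pmap q) k'.
Proof.
move=> kk'; apply: term_map_LeadCoef => lq; apply: term_map_Rediv => spq qq r /=.
by apply: term_map_Rediv => c qq' rpq /=; rewrite kk' term_map_ScalPoly.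
Qed.

Lemma term_map_ModsAux p q n k k' : (forall ps, formula_map (k ps) = k' (map pmap ps)) ->
  formula_map (ModsAux p q n k) = ModsAux (pmap p) (pmap q) n k'.
Proof.
elim: n p q k k' => [|n IH] p q k k' kk' /=; first exact: kk'.
apply: term_map_Isnull => -[]; first exact: kk'.
by apply: term_map_NextMod => npq; apply: IH => ps; rewrite kk'.
Qed.

Lemma term_map_Mods p q k k' : (forall ps, formula_map (k ps) = k' (map pmap ps)) ->
  formula_map (Mods p q k) = Mods (pmap p) (pmap q) k'.
Proof.
by move=> kk'; apply: term_map_Size => sp; apply: term_map_Size => sq; apply: term_map_ModsAux.
Qed.

Lemma term_map_Pcq sq i : pmap (Pcq sq i) = Pcq (map pmap sq) i.
Proof.
rewrite /Pcq size_map.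
have -> : pmap (nth [::] (map (PolyComb sq) (sg_tab (size sq))) i) =
    nth [::] (map (pmap \o PolyComb sq) (sg_tab (size sq))) i.
  by elim: (sg_tab _) i => [|? ? IH] [|i] //=.
congr nth; apply: eq_map => sc /=; rewrite /PolyComb size_map.
elim: (iota _ _) => //= j s IH; rewrite term_map_MulPoly IH; congr MulPoly.
rewrite term_map_ExpPoly; congr ExpPoly.
by elim: sq j {i IH sc} => [|? ? IH] [|j] //=.
Qed.

Lemma term_map_TaqR p q k k' : (forall n, formula_map (k n) = k' n) ->
  formula_map (TaqR p q k) = TaqR (pmap p) (pmap q) k'.
Proof.
move=> kk'; rewrite /TaqR /bind_def -term_map_Deriv -term_map_MulPoly.
by apply: term_map_Mods => r; apply: term_map_ChangesPoly.
Qed.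

Lemma term_map_TaqsR p sq i k k' : (forall n, formula_map (k n) = k' (term_map n)) ->
  formula_map (TaqsR p sq i k) = TaqsR (pmap p) (map pmap sq) i k'.
Proof.
move=> kk'; rewrite /TaqsR /bind_def -term_map_Pcq.
by apply: term_map_TaqR => n; rewrite kk' /= rmorph_int.
Qed.

(** The constants that the procedure introduces by itself come from the inverse of an integer
    matrix; they are rational, hence fixed by every field morphism. *)
Lemma term_map_Coefs n i : term_map (Coefs K n i) = Coefs L n i.
Proof.
case: n => [|[|n]] /=; rewrite ?rmorph_nat//.
  congr Const; case: i => [|[|[|i]]] /=; rewrite ?rmorph0 ?fmorphV ?rmorph_nat//.
  by rewrite !nth_nil rmorph0.
congr Const; rewrite /coefs; move: (enum _) => s.
have -> (g : 'I_(3 ^ n.+2) -> K) : f [seq g j | j <- s]`_i = [seq f (g j) | j <- s]`_i.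
  by elim: s i => [|j s IH] [|i] //=; rewrite rmorph0.
congr nth; apply: eq_map => j; rewrite !castmxE.
have <- : map_mx f (invmx (map_mx intr (ctmat n.+2))) =
    invmx (map_mx intr (ctmat n.+2)) :> 'M[L]__.
  rewrite map_invmx -map_mx_comp; congr invmx; apply: eq_map_mx => z /=.
  exact: rmorph_int.
by rewrite mxE.
Qed.

Lemma term_map_CcountWeak p sq k k' : (forall n, formula_map (k n) = k' (term_map n)) ->
  formula_map (CcountWeak p sq k) = CcountWeak (pmap p) (map pmap sq) k'.
Proof.
move=> kk'; rewrite /CcountWeak size_map.
have : term_map (NatConst K 0) = NatConst L 0 by [].
elim: (3 ^ size sq)%N (NatConst K 0) (NatConst L 0) => [|i IH] t t' tt' /=.
  by rewrite kk' tt'.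
by apply: term_map_TaqsR => x; apply: IH; rewrite -tt' -term_map_Coefs.
Qed.

Lemma term_map_BoundingPoly sq : pmap (BoundingPoly sq) = BoundingPoly (map pmap sq).
Proof.
rewrite /BoundingPoly term_map_Deriv; congr Deriv.
by elim: sq => //= p sq IH; rewrite term_map_MulPoly IH.
Qed.

Lemma formula_map_CcountGt0 sp sq :
  formula_map (CcountGt0 sp sq) = CcountGt0 (map pmap sp) (map pmap sq).
Proof.
apply: term_map_BigRgcd => p; apply: term_map_Isnull => -[] /=; last first.
  exact: term_map_CcountWeak.
rewrite /bind_def -term_map_BoundingPoly; apply: term_map_CcountWeak => cw /=.
congr Or; last congr Or.
  elim: sq => //= q sq ->; congr And; exact: term_map_LeadCoef.
elim: sq => //= q sq ->; congr And; apply: term_map_Size => m.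
exact: term_map_LeadCoef.
Qed.

Lemma term_map_abstrX i t : pmap (abstrX i t) = abstrX i (term_map t).
Proof.
elim: t => //= [n|a IHa b IHb|a IH|a IH n|a IHa b IHb|a IH n].
- by case: ifP.
- by rewrite term_map_AddPoly IHa IHb.
- by rewrite term_map_OppPoly IH.
- by rewrite term_map_NatMulPoly IH.
- by rewrite term_map_MulPoly IHa IHb.
- by rewrite term_map_ExpPoly IH.
Qed.

End Map.

(** In a real closed field a positive element is a nonzero square, so the ring structure determines
    the order. *)
Lemma rcf_morph_lt (K L : rcfType) (f : {rmorphism K -> L}) x y :
  (f x < f y) = (x < y).
Proof.
have mono : {homo f : x y / x < y}.
  move=> a b ab; rewrite -subr_gt0 -rmorphB.
  rewrite -(sqr_sqrtr (ltW (_ : 0 < b - a))) ?subr_gt0// rmorphXn/=.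
  rewrite exprn_even_gt0//= fmorph_eq0 sqrtr_eq0 -ltNge.
  by rewrite subr_gt0.
by apply/idP/idP => [|/mono//]; rewrite !ltNge; apply/contra; rewrite le_eqVlt
  => /orP[/eqP->//|/mono/ltW].
Qed.

Lemma rcf_morph_le (K L : rcfType) (f : {rmorphism K -> L}) x y :
  (f x <= f y) = (x <= y).
Proof. by rewrite !leNgt rcf_morph_lt. Qed.

(** * Elimination of quantifiers, uniformly in the extension *)

Section Definable.
Variable K : rcfType.

Notation term := (qe_rcf.term K).
Notation formula := (qe_rcf.formula K).

Definition ev (L : rcfType) (f : {rmorphism K -> L}) (e : seq L) (t : term) : L :=
  qe_rcf.eval e (term_map f t).
Definition qev (L : rcfType) (f : {rmorphism K -> L}) (e : seq L) (p : formula) : bool :=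
  qe_rcf.qf_eval e (formula_map f p).

Definition clause := (seq term * seq term)%type.
Definition cev (L : rcfType) (f : {rmorphism K -> L}) (e : seq L) (c : clause) : bool :=
  all (fun t => ev f e t == 0) c.1 && all (fun t => 0 < ev f e t) c.2.

Definition tsub (a b : term) := qe_rcf.Add a (qe_rcf.Opp b).

Lemma ev_sub (L : rcfType) (f : {rmorphism K -> L}) e a b :
  ev f e (tsub a b) = ev f e a - ev f e b.
Proof. by []. Qed.

Lemma dnf_and (cs ds : seq clause) : exists es : seq clause,
  forall (L : rcfType) (f : {rmorphism K -> L}) e,
  has (cev f e) es = has (cev f e) cs && has (cev f e) ds.
Proof.
exists [seq (c.1 ++ d.1, c.2 ++ d.2) | c <- cs, d <- ds] => L f e.
elim: cs => //= c cs IH; rewrite has_cat IH andb_orl; congr (_ || _).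
rewrite has_map; elim: ds {IH} => [|d ds IH] /=; first by rewrite andbF.
by rewrite IH andb_orr; congr (_ || _); rewrite /cev/= !all_cat andbACA.
Qed.

Lemma dnf_or (cs ds : seq clause) : exists es : seq clause,
  forall (L : rcfType) (f : {rmorphism K -> L}) e,
  has (cev f e) es = has (cev f e) cs || has (cev f e) ds.
Proof. by exists (cs ++ ds) => L f e; rewrite has_cat. Qed.

(** The flag [b] carries negation through the induction, so a negated formula needs no case of its
    own; a negated atom becomes a sign condition because the order is total. *)
Lemma dnf_exists (p : formula) (b : bool) : exists cs : seq clause,
  forall (L : rcfType) (f : {rmorphism K -> L}) e,
  has (cev f e) cs = (qev f e p == b).
Proof.
elim: p b => [c|a a'|a a'|a a'|p IHp q IHq|p IHp q IHq|p IHp q IHq|p IHp] b.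
- exists (if c == b then [:: ([::], [::])] else [::]) => L f e.
  by rewrite /qev/=; case: ifP.
- case: b.
    exists [:: ([:: tsub a a'], [::])] => L f e.
    by rewrite /qev/cev/= ev_sub/= subr_eq0 !andbT orbF eqb_id.
  exists [:: ([::], [:: tsub a a']); ([::], [:: tsub a' a])] => L f e.
  rewrite /qev/cev/= !ev_sub/= !subr_gt0 !andbT orbF eqbF_neg neq_lt.
  by rewrite orbC.
- case: b.
    exists [:: ([::], [:: tsub a' a])] => L f e.
    by rewrite /qev/cev/= ev_sub/= subr_gt0 !andbT orbF eqb_id.
  exists [:: ([:: tsub a a'], [::]); ([::], [:: tsub a a'])] => L f e.
  by rewrite /qev/cev/= !ev_sub/= subr_eq0 subr_gt0 !andbT orbF eqbF_neg -leNgt le_eqVlt eq_sym.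
- case: b.
    exists [:: ([:: tsub a a'], [::]); ([::], [:: tsub a' a])] => L f e.
    by rewrite /qev/cev/= !ev_sub/= subr_eq0 subr_gt0 !andbT orbF eqb_id le_eqVlt.
  exists [:: ([::], [:: tsub a a'])] => L f e.
  by rewrite /qev/cev/= ev_sub/= subr_gt0 !andbT orbF eqbF_neg -ltNge.
- case: b.
    have [cs csE] := IHp true; have [ds dsE] := IHq true.
    have [es esE] := dnf_and cs ds.
    by exists es => L f e; rewrite esE csE dsE !eqb_id.
  have [cs csE] := IHp false; have [ds dsE] := IHq false.
  have [es esE] := dnf_or cs ds.
  by exists es => L f e; rewrite esE csE dsE !eqbF_neg -negb_and.
- case: b.
    have [cs csE] := IHp true; have [ds dsE] := IHq true.
    have [es esE] := dnf_or cs ds.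
    by exists es => L f e; rewrite esE csE dsE !eqb_id.
  have [cs csE] := IHp false; have [ds dsE] := IHq false.
  have [es esE] := dnf_and cs ds.
  by exists es => L f e; rewrite esE csE dsE !eqbF_neg -negb_or.
- case: b.
    have [cs csE] := IHp false; have [ds dsE] := IHq true.
    have [es esE] := dnf_or cs ds.
    by exists es => L f e; rewrite esE csE dsE eqb_id eqbF_neg -implybE.
  have [cs csE] := IHp true; have [ds dsE] := IHq false.
  have [es esE] := dnf_and cs ds.
  by exists es => L f e; rewrite esE csE dsE eqb_id !eqbF_neg -negb_imply.
- have [cs csE] := IHp (~~ b); exists cs => L f e.
  by rewrite csE /qev/=; case: (qe_rcf.qf_eval _ _); case: b {csE}.
Qed.

Definition pred_family := forall L : rcfType, {rmorphism K -> L} -> seq L -> Prop.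

(** The formula is chosen before the extension: this uniformity is what makes truth over [K] and
    truth over [L] comparable. *)
Definition definable (D : pred_family) := exists p : formula,
  forall (L : rcfType) (f : {rmorphism K -> L}) e, D L f e <-> qev f e p.

Lemma definable_ext (D D' : pred_family) : definable D ->
  (forall (L : rcfType) (f : {rmorphism K -> L}) e, D L f e <-> D' L f e) ->
  definable D'.
Proof. by move=> [p pP] DD'; exists p => L f e; rewrite -DD'. Qed.

(** In each clause of the disjunctive normal form, [abstrX] turns the terms into polynomials in the
    variable [i], and [CcountGt0] decides whether they have a common solution. *)
Lemma definable_exists1 (D : pred_family) i : definable D ->
  definable (fun L f e => exists x : L, D L f (set_nth 0 e i x)).
Proof.
move=> [p pP]; have [cs csE] := dnf_exists p true.
pose elim1 (c : clause) := qe_rcf.CcountGt0 (map (qe_rcf.abstrX i) c.1)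
  (map (qe_rcf.abstrX i) c.2).
exists (foldr (fun c q => qe_rcf.Or (elim1 c) q) (qe_rcf.Bool false) cs) => L f e.
have elim1P c : reflect (exists x, cev f (set_nth 0 e i x) c) (qev f e (elim1 c)).
  rewrite /qev formula_map_CcountGt0 qe_rcf.eval_CcountGt0.
  apply: (iffP (ccount_gt0P _ _)) => -[x cx]; exists x; move: cx;
    rewrite /cev !big_map !big_all; congr (_ && _); apply: eq_all => t /=;
    by rewrite term_map_abstrX qe_rcf.abstrXP.
have orE : qev f e (foldr (fun c q => qe_rcf.Or (elim1 c) q) (qe_rcf.Bool false) cs) =
    has (fun c => qev f e (elim1 c)) cs.
  by elim: (cs) => //= c s <-.
rewrite orE; have -> : has (fun c => qev f e (elim1 c)) cs <->
    exists x, has (cev f (set_nth 0 e i x)) cs.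
  elim: cs {csE orE} => [|c cs IH] /=; first by split=> [|[]].
  split=> [/orP[/elim1P[x cx]|/IH[x cx]]|[x /orP[cx|cx]]].
  - by exists x; rewrite cx.
  - by exists x; rewrite cx orbT.
  - by apply/orP; left; apply/elim1P; exists x.
  - by apply/orP; right; apply/IH; exists x.
by split=> -[x Dx]; exists x; move: Dx; rewrite pP csE eqb_id.
Qed.

Lemma definable_and (D D' : pred_family) : definable D -> definable D' ->
  definable (fun L f e => D L f e /\ D' L f e).
Proof.
move=> [p pP] [q qP]; exists (qe_rcf.And p q) => L f e.
by rewrite pP qP; split => /andP.
Qed.

Lemma definable_not (D : pred_family) : definable D ->
  definable (fun L f e => ~ D L f e).
Proof.
by move=> [p pP]; exists (qe_rcf.Not p) => L f e; rewrite pP; split => /negP.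
Qed.

Definition set_vars (L : rcfType) (e : seq L) (vs : seq nat) (h : nat -> L) :=
  foldr (fun v e => set_nth 0 e v (h v)) e vs.

Lemma nth_set_vars (L : rcfType) (e : seq L) vs h i :
  (set_vars e vs h)`_i = if i \in vs then h i else e`_i.
Proof.
elim: vs => //= v vs IH; rewrite nth_set_nth/= inE IH.
by case: eqVneq => //= ->.
Qed.

Lemma definable_exists (D : pred_family) vs : uniq vs -> definable D ->
  definable (fun L f e => exists h, D L f (set_vars e vs h)).
Proof.
elim: vs D => [|v vs IH] D /=.
  move=> _ dD; apply: (definable_ext dD) => L f e.
  by split=> [|[]//]; exists (fun=> 0).
move=> /andP[vvs uvs] dD.
apply: definable_ext (IH _ uvs (definable_exists1 v dD)) _ => L f e.
split=> [[h [x Dx]]|[h Dh]]; last by exists h, (h v).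
exists (fun i => if i == v then x else h i); rewrite eqxx.
suff -> : set_vars e vs (fun i => if i == v then x else h i) = set_vars e vs h by [].
elim: vs vvs {IH uvs Dx} => //= w ws IH.
by rewrite inE negb_or eq_sym => /andP[/negbTE-> /IH->].
Qed.

(** A morphism of real closed fields preserves and reflects equalities and inequalities, hence the
    truth of quantifier-free formulas. *)
Lemma qev_morph (L : rcfType) (f : {rmorphism K -> L}) (e : seq K) p :
  qev f (map f e) p = qev idfun e p.
Proof.
have evE t : ev f (map f e) t = f (ev idfun e t).
  elim: t => /= [i|c|n|a IHa b IHb|a IH|a IH n|a IHa b IHb|a IH n];
    rewrite /ev/= -?/(ev _ _ _) ?rmorph_nat//.
  - by elim: e i => [|x e IH] [|i] //=; rewrite rmorph0.
  - by rewrite rmorphD/= -IHa -IHb.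
  - by rewrite rmorphN/= -IH.
  - by rewrite rmorphMn/= -IH.
  - by rewrite rmorphM/= -IHa -IHb.
  - by rewrite rmorphXn/= -IH.
elim: p => //= [a b|a b|a b|p IHp q IHq|p IHp q IHq|p IHp q IHq|p IHp];
  rewrite /qev/=.
- by rewrite -!/(ev _ _ _) !evE (inj_eq (fmorph_inj f)).
- by rewrite -!/(ev _ _ _) !evE rcf_morph_lt.
- by rewrite -!/(ev _ _ _) !evE rcf_morph_le.
- by congr (_ && _).
- by congr (_ || _).
- by congr (_ ==> _).
- by congr (~~ _).
Qed.

End Definable.

(** * First-order statements about sequences of matrices *)

Section MatrixDefinable.
Variables (K : rcfType) (n : nat).

(** One environment of scalars stores a whole sequence of matrices; the injectivity of [pickle]
    keeps the entries of different matrices apart. *)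
Definition mxvar (k : nat) (i j : 'I_n) : nat := pickle (k, val i, val j).
Definition mxblock_vars (k : nat) : seq nat :=
  undup [seq mxvar k i j | i <- enum 'I_n, j <- enum 'I_n].
Definition mxval (L : rcfType) (e : seq L) (k : nat) : 'M[L]_n :=
  \matrix_(i, j) e`_(mxvar k i j).

Definition upd T (rho : nat -> T) k g := fun l => if l == k then g else rho l.

Definition mx_family := forall L : rcfType,
  {rmorphism K -> L} -> (nat -> 'M[L]_n) -> Prop.

Definition mdef (D : mx_family) := definable (fun L f e => D L f (mxval e)).

Lemma mdef_ext (D D' : mx_family) : mdef D ->
  (forall (L : rcfType) (f : {rmorphism K -> L}) r, D L f r <-> D' L f r) ->
  mdef D'.
Proof. by move=> dD DD'; apply: (definable_ext dD) => L f e; exact: DD'. Qed.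

(** The slot [k] serves as the bound variable. The second hypothesis says that it is fresh: [D] sees
    it only through its last argument. *)
Lemma mdef_exists k (D : forall L : rcfType,
    {rmorphism K -> L} -> (nat -> 'M[L]_n) -> 'M[L]_n -> Prop) :
  mdef (fun L f r => D L f r (r k)) ->
  (forall (L : rcfType) (f : {rmorphism K -> L}) r g g',
     D L f (upd r k g') g <-> D L f r g) ->
  mdef (fun L f r => exists g, D L f r g).
Proof.
move=> dD Dk.
apply: (definable_ext (definable_exists (vs := mxblock_vars k) (undup_uniq _) dD)).
move=> L f e; have setE h : mxval (set_vars e (mxblock_vars k) h) =
    upd (mxval e) k (\matrix_(i, j) h (mxvar k i j)).
  apply/funext => l; apply/matrixP => i j; rewrite /upd mxE nth_set_vars.
  rewrite mem_undup; case: eqVneq => [->|lk].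
    rewrite mxE; case: ifP => // /negP[]; apply/allpairsP; exists (i, j).
    by rewrite !mem_enum.
  rewrite mxE; case: ifP => // /allpairsP[[i' j'] [_ _ /(pcan_inj pickleK)]].
  by move=> [lk']; rewrite lk' eqxx in lk.
split=> [[h]|[g Dg]].
  by rewrite setE {2}/upd eqxx Dk => Dh; eexists; exact: Dh.
(* The values to store are read off by decoding variable numbers; numbers that code no entry get the
   dummy 0. *)
pose h v : L := if (unpickle v : option (nat * nat * nat)) is Some (_, i, j) then
  if (insub i, insub j) is (Some i, Some j) then g i j else 0 else 0.
exists h; rewrite setE {2}/upd eqxx Dk.
suff <- : g = \matrix_(i, j) h (mxvar k i j) by [].
by apply/matrixP => i j; rewrite mxE /h /mxvar pickleK/= !valK.
Qed.

Lemma mdef_and (D D' : mx_family) : mdef D -> mdef D' ->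
  mdef (fun L f r => D L f r /\ D' L f r).
Proof. exact: definable_and. Qed.

Lemma mdef_not (D : mx_family) : mdef D -> mdef (fun L f r => ~ D L f r).
Proof. exact: definable_not. Qed.

Lemma mdef_or (D D' : mx_family) : mdef D -> mdef D' ->
  mdef (fun L f r => D L f r \/ D' L f r).
Proof.
move=> dD dD'; apply: mdef_ext (mdef_not (mdef_and (mdef_not dD) (mdef_not dD'))) _.
by move=> L f r; rewrite not_andP !notK.
Qed.

Lemma mdef_impl (D D' : mx_family) : mdef D -> mdef D' ->
  mdef (fun L f r => D L f r -> D' L f r).
Proof.
move=> dD dD'; apply: mdef_ext (mdef_or (mdef_not dD) dD') _.
by move=> L f r; rewrite -implyE.
Qed.

Lemma mdef_forall k (D : forall L : rcfType,
    {rmorphism K -> L} -> (nat -> 'M[L]_n) -> 'M[L]_n -> Prop) :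
  mdef (fun L f r => D L f r (r k)) ->
  (forall (L : rcfType) (f : {rmorphism K -> L}) r g g',
     D L f (upd r k g') g <-> D L f r g) ->
  mdef (fun L f r => forall g, D L f r g).
Proof.
move=> dD Dk.
have := mdef_not (mdef_exists (D := fun L f r g => ~ D L f r g) (mdef_not dD) _).
move=> /(_ _)[|p pP]; first by move=> L f r g g'; rewrite Dk.
by exists p => L f e; rewrite -pP -forallNE; split=> H g; [rewrite notK|
  rewrite -[D _ _ _ _]notK].
Qed.

Lemma mdef_const (P : Prop) : mdef (fun _ _ _ => P).
Proof.
by exists (qe_rcf.Bool `[<P>]) => L f e; rewrite /qev/=; split=> /asboolP.
Qed.

Lemma mdef_all (I : Type) (s : seq I) (D : I -> mx_family) :
  (forall i, mdef (D i)) ->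
  mdef (fun L f r => foldr and True (map (fun i => D i L f r) s)).
Proof.
by move=> dD; elim: s => [|i s IH] /=; [exact: mdef_const|exact: mdef_and].
Qed.

Lemma mdef_has (I : Type) (s : seq I) (D : I -> mx_family) :
  (forall i, mdef (D i)) ->
  mdef (fun L f r => foldr or False (map (fun i => D i L f r) s)).
Proof.
by move=> dD; elim: s => [|i s IH] /=; [exact: mdef_const|exact: mdef_or].
Qed.

Lemma mdef_forall_fin (I : finType) (D : I -> mx_family) :
  (forall i, mdef (D i)) -> mdef (fun L f r => forall i, D i L f r).
Proof.
move=> /(mdef_all (enum I)) dD; apply: mdef_ext dD _ => L f r.
suff H s : foldr and True [seq D i L f r | i <- s] <-> {in s, forall i, D i L f r}.
  by rewrite H; split=> [Di i|Di i _]; [apply: (Di i); rewrite mem_enum|exact: Di].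
elim: s => //= i s ->; split=> [[Di Ds] j|Ds].
  by rewrite inE => /orP[/eqP->//|/Ds].
by split=> [|j js]; apply: Ds; rewrite inE ?eqxx// js orbT.
Qed.

Lemma mdef_exists_fin (I : finType) (D : I -> mx_family) :
  (forall i, mdef (D i)) -> mdef (fun L f r => exists i, D i L f r).
Proof.
move=> dD; have := mdef_not (mdef_forall_fin (fun i => mdef_not (dD i))).
by move=> /mdef_ext; apply=> L f r; rewrite -existsNE; split=> -[i Di]; exists i;
  [rewrite -[D _ _ _ _]notK|rewrite notK].
Qed.

Definition sterm (T : forall L : rcfType, {rmorphism K -> L} -> (nat -> 'M[L]_n) -> L) :=
  exists t, forall (L : rcfType) (f : {rmorphism K -> L}) e, T L f (mxval e) = ev f e t.

Definition mterm (T : forall L : rcfType, {rmorphism K -> L} -> (nat -> 'M[L]_n) -> 'M[L]_n) :=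
  forall i j, sterm (fun L f r => T L f r i j).

Notation sfam := (forall L : rcfType, {rmorphism K -> L} -> (nat -> 'M[L]_n) -> L).

Lemma sterm_ext (T T' : sfam) : sterm T ->
  (forall (L : rcfType) (f : {rmorphism K -> L}) r, T L f r = T' L f r) -> sterm T'.
Proof. by move=> [t tP] TT'; exists t => L f e; rewrite -tP TT'. Qed.

Lemma sterm_const c : sterm (fun L f r => f c).
Proof. by exists (qe_rcf.Const c). Qed.

Lemma sterm_nat m : sterm (fun L f r => m%:R).
Proof. by apply: sterm_ext (sterm_const m%:R) _ => L f r; rewrite rmorph_nat. Qed.

Lemma sterm_add (T T' : sfam) : sterm T -> sterm T' ->
  sterm (fun L f r => T L f r + T' L f r).
Proof. by move=> [t tP] [s sP]; exists (qe_rcf.Add t s) => L f e; rewrite tP sP. Qed.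

Lemma sterm_mul (T T' : sfam) : sterm T -> sterm T' ->
  sterm (fun L f r => T L f r * T' L f r).
Proof. by move=> [t tP] [s sP]; exists (qe_rcf.Mul t s) => L f e; rewrite tP sP. Qed.

Lemma sterm_exp (T : sfam) m : sterm T -> sterm (fun L f r => T L f r ^+ m).
Proof. by move=> [t tP]; exists (qe_rcf.Exp t m) => L f e; rewrite tP. Qed.

Lemma sterm_sum (I : Type) (s : seq I) (T : I -> sfam) : (forall i, sterm (T i)) ->
  sterm (fun L f r => \sum_(i <- s) T i L f r).
Proof.
move=> dT; elim: s => [|i s IH].
  by apply: sterm_ext (sterm_nat 0) _ => L f r; rewrite big_nil.
by apply: sterm_ext (sterm_add (dT i) IH) _ => L f r; rewrite big_cons.
Qed.

Lemma sterm_prod (I : Type) (s : seq I) (T : I -> sfam) : (forall i, sterm (T i)) ->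
  sterm (fun L f r => \prod_(i <- s) T i L f r).
Proof.
move=> dT; elim: s => [|i s IH].
  by apply: sterm_ext (sterm_nat 1) _ => L f r; rewrite big_nil.
by apply: sterm_ext (sterm_mul (dT i) IH) _ => L f r; rewrite big_cons.
Qed.

Lemma mterm_var k : mterm (fun L f r => r k).
Proof. by move=> i j; exists (qe_rcf.Var _ (mxvar k i j)) => L f e; rewrite mxE. Qed.

Lemma mterm_mul T T' : mterm T -> mterm T' ->
  mterm (fun L f r => T L f r *m T' L f r).
Proof.
move=> dT dT' i j; have dS k := sterm_mul (dT i k) (dT' k j).
by apply: sterm_ext (sterm_sum (index_enum _) dS) _ => L f r; rewrite mxE.
Qed.

Lemma mterm_tr T : mterm T -> mterm (fun L f r => (T L f r)^T).
Proof. by move=> dT i j; apply: sterm_ext (dT j i) _ => L f r; rewrite mxE. Qed.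

Lemma mterm_1 : mterm (fun L f r => 1%:M).
Proof.
by move=> i j; apply: sterm_ext (sterm_nat (i == j)) _ => L f r; rewrite mxE.
Qed.

Lemma sterm_evalmx T (p : mpoly.mpoly (n * n) K) : mterm T ->
  sterm (fun L f r => evalmx f p (T L f r)).
Proof.
move=> dT; rewrite /evalmx /mpoly.mmap.
apply: sterm_sum => m; apply: sterm_mul; first exact: sterm_const.
apply: sterm_prod => k; apply: sterm_exp.
case/mxvec_indexP: k => i j; apply: sterm_ext (dT i j) _ => L f r.
by rewrite mxvecE.
Qed.

Lemma mdef_eq0 (T : sfam) : sterm T -> mdef (fun L f r => T L f r = 0).
Proof.
move=> [t tP]; exists (qe_rcf.Equal t (qe_rcf.NatConst _ 0)) => L f e.
by rewrite tP; split=> /eqP.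
Qed.

Lemma mdef_gt0 (T : sfam) : sterm T -> mdef (fun L f r => 0 < T L f r).
Proof.
by move=> [t tP]; exists (qe_rcf.Lt (qe_rcf.NatConst _ 0) t) => L f e; rewrite tP.
Qed.

Lemma mdef_eq (T T' : sfam) : sterm T -> sterm T' ->
  mdef (fun L f r => T L f r = T' L f r).
Proof.
move=> [t tP] [s sP]; exists (qe_rcf.Equal t s) => L f e.
by rewrite tP sP; split=> /eqP.
Qed.

Lemma mdef_le (T T' : sfam) : sterm T -> sterm T' ->
  mdef (fun L f r => T L f r <= T' L f r).
Proof. by move=> [t tP] [s sP]; exists (qe_rcf.Le t s) => L f e; rewrite tP sP. Qed.

Lemma mdef_lt (T T' : sfam) : sterm T -> sterm T' ->
  mdef (fun L f r => T L f r < T' L f r).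
Proof. by move=> [t tP] [s sP]; exists (qe_rcf.Lt t s) => L f e; rewrite tP sP. Qed.

Lemma mdef_mxeq T T' : mterm T -> mterm T' ->
  mdef (fun L f r => T L f r = T' L f r).
Proof.
move=> dT dT'; have dE i j := mdef_eq (dT i j) (dT' i j).
apply: mdef_ext (mdef_forall_fin (fun i => mdef_forall_fin (dE i))) _ => L f r.
by split=> [/matrixP//|-> //].
Qed.

Lemma mdef_points T P : mterm T -> mdef (fun L f r => points f P (T L f r)).
Proof.
move=> dT; have dE p := mdef_eq0 (sterm_evalmx p dT).
apply: mdef_ext (mdef_all P dE) _ => L f r; rewrite /points/=.
by elim: P => //= p P ->; split=> [[/eqP-> ->]|/andP[/eqP]].
Qed.

Lemma mdef_sa_points T D : mterm T -> mdef (fun L f r => sa_points f D (T L f r)).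
Proof.
move=> dT; have dP q := mdef_gt0 (sterm_evalmx q dT).
have dE (b : seq _ * seq _) := mdef_and (mdef_points b.1 dT) (mdef_all b.2 dP).
apply: mdef_ext (mdef_has D dE) _ => L f r; rewrite /sa_points/=.
have allE (q : seq (mpoly.mpoly (n * n) K)) g :
    foldr and True (map (fun i => is_true (0 < evalmx f i g)) q) <->
    all (fun q => 0 < evalmx f q g) q.
  by elim: q => //= a q ->; split=> [[-> ->]|/andP[]].
elim: D => [|b D IH] //=; split=> [[[b1 /allE b2]|/IH->]|/orP[/andP[b1 /allE b2]|/IH]].
- by apply/orP; left; apply/andP.
- by rewrite orbT.
- by left.
- by right.
Qed.

(** A closed statement may be evaluated at the empty environment, which comes from [K]. *)
Lemma transfer (D : forall L : rcfType, {rmorphism K -> L} -> Prop)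
    (L : rcfType) (f : {rmorphism K -> L}) :
  mdef (fun L f _ => D L f) -> D K idfun <-> D L f.
Proof.
by move=> [p pP]; rewrite (pP K idfun [::]) (pP L f [::]) (qev_morph f [::]).
Qed.

End MatrixDefinable.

(** * The matrix exponential and Lie algebras *)

Section MatrixNorm.
Variables (R : realType) (n : nat).
Implicit Types X Y Z : 'M[R]_n.

(** This norm is submultiplicative, but the identity has norm n; hence the factors [nrm 1%:M] in the
    constants below. *)
Definition nrm X : R := \sum_i \sum_j `|X i j|.

Lemma nrm_ge0 X : 0 <= nrm X.
Proof. by apply: sumr_ge0 => i _; apply: sumr_ge0. Qed.

Lemma nrm0 : nrm 0 = 0.
Proof. by rewrite /nrm big1// => i _; rewrite big1// => j _; rewrite mxE normr0. Qed.

Lemma nrmD X Y : nrm (X + Y) <= nrm X + nrm Y.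
Proof.
rewrite /nrm -big_split/=; apply: ler_sum => i _.
by rewrite -big_split/=; apply: ler_sum => j _; rewrite mxE ler_normD.
Qed.

Lemma nrmN X : nrm (- X) = nrm X.
Proof. by apply: eq_bigr => i _; apply: eq_bigr => j _; rewrite mxE normrN. Qed.

Lemma nrmB X Y : nrm (X - Y) = nrm (Y - X).
Proof. by rewrite -nrmN opprB. Qed.

Lemma nrm_triangle X Y Z : nrm (X - Z) <= nrm (X - Y) + nrm (Y - Z).
Proof. by apply: le_trans (nrmD _ _); rewrite addrA subrK. Qed.

Lemma nrmZ c X : nrm (c *: X) = `|c| * nrm X.
Proof.
rewrite /nrm mulr_sumr; apply: eq_bigr => i _; rewrite mulr_sumr.
by apply: eq_bigr => j _; rewrite mxE normrM.
Qed.

Lemma nrm_entry X i j : `|X i j| <= nrm X.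
Proof.
rewrite /nrm (bigD1 i)//= (bigD1 j)//= -addrA lerDl addr_ge0//; first exact: sumr_ge0.
by apply: sumr_ge0 => k _; apply: sumr_ge0.
Qed.

Lemma nrm_eq0 X : nrm X = 0 -> X = 0.
Proof.
move=> X0; apply/matrixP => i j; rewrite mxE; apply/eqP; rewrite -normr_le0 -X0.
exact: nrm_entry.
Qed.

Lemma nrmM X Y : nrm (X *m Y) <= nrm X * nrm Y.
Proof.
rewrite /nrm mulr_suml; apply: ler_sum => i _; rewrite mulr_suml.
have -> : \sum_k `|X i k| * (\sum_i0 \sum_j `|Y i0 j|) =
    \sum_k (\sum_j `|X i k| * `|Y k j| +
            `|X i k| * \sum_(l | l != k) \sum_j `|Y l j|).
  apply: eq_bigr => k _; rewrite (bigD1 k)//= mulrDr; congr (_ + _).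
  by rewrite mulr_sumr.
rewrite big_split/= ler_wpDr//.
  apply: sumr_ge0 => k _; apply: mulr_ge0 => //; apply: sumr_ge0 => l _.
  exact: sumr_ge0.
rewrite exchange_big/=; apply: ler_sum => j _; rewrite mxE.
by apply: le_trans (ler_norm_sum _ _ _) _; apply: ler_sum => k _; rewrite normrM.
Qed.

Lemma nrm_sum (I : Type) (s : seq I) (F : I -> 'M[R]_n) :
  nrm (\sum_(i <- s) F i) <= \sum_(i <- s) nrm (F i).
Proof.
elim: s => [|i s IH]; first by rewrite !big_nil nrm0.
by rewrite !big_cons; apply: le_trans (nrmD _ _) _; rewrite lerD2l.
Qed.

Lemma nrm_trmx X : nrm X^T = nrm X.
Proof.
rewrite /nrm exchange_big/=; apply: eq_bigr => i _; apply: eq_bigr => j _.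
by rewrite mxE.
Qed.

Lemma nrmX_mul X Y k : nrm (X ^+ k *m Y) <= nrm X ^+ k * nrm Y.
Proof.
elim: k => [|k IH]; first by rewrite !expr0 mul1mx mul1r.
rewrite !exprS -mulmxA -mulrA; apply: le_trans (nrmM _ _) _.
by apply: ler_wpM2l => //; exact: nrm_ge0.
Qed.

Lemma nrmXS X k : nrm (X ^+ k.+1) <= nrm X ^+ k.+1.
Proof.
rewrite !exprSr; apply: le_trans (nrmX_mul _ _ _) _; rewrite lexx//.
Qed.

(* Epsilon-N convergence for the submultiplicative norm nrm *)
Definition mcvg (u : nat -> 'M[R]_n) X :=
  forall e, 0 < e -> exists N, forall m, (N <= m)%N -> nrm (u m - X) <= e.

Lemma mcvg_uniq u X Y : mcvg u X -> mcvg u Y -> X = Y.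
Proof.
move=> uX uY; apply/eqP; rewrite -subr_eq0; apply/eqP/nrm_eq0/eqP.
rewrite eq_le nrm_ge0 andbT; apply/ler_addgt0Pr => e e0; rewrite add0r.
have [N NP] := uX _ (divr_gt0 e0 (ltr0n _ 2)).
have [M MP] := uY _ (divr_gt0 e0 (ltr0n _ 2)).
apply: le_trans (nrm_triangle _ (u (maxn N M)) _) _; rewrite [e]splitr.
by apply: lerD; [rewrite nrmB NP ?leq_maxl|rewrite MP ?leq_maxr].
Qed.

Lemma mcvg_bound u X Y b : mcvg u X ->
  (exists N, forall m, (N <= m)%N -> nrm (u m - Y) <= b) -> nrm (X - Y) <= b.
Proof.
move=> uX [M MP]; apply/ler_addgt0Pl => e e0; have [N NP] := uX _ e0.
apply: le_trans (nrm_triangle _ (u (maxn N M)) _) _.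
by apply: lerD; [rewrite nrmB NP ?leq_maxl|rewrite MP ?leq_maxr].
Qed.

Lemma mcvgM u v X Y : mcvg u X -> mcvg v Y -> mcvg (fun m => u m *m v m) (X *m Y).
Proof.
move=> uX vY e e0; set c := nrm X + nrm Y + 1.
have c0 : 0 < c by rewrite ltr_wpDl// addr_ge0// nrm_ge0.
pose d := Num.min 1 (e / c); have d0 : 0 < d by rewrite lt_min ltr01 divr_gt0.
have [N NP] := uX _ d0; have [M MP] := vY _ d0; exists (maxn N M) => m.
rewrite geq_max => /andP[/NP um /MP vm].
have -> : u m *m v m - X *m Y = (u m - X) *m v m + X *m (v m - Y).
  by rewrite mulmxBl mulmxBr addrA subrK.
apply: le_trans (nrmD _ _) _.
have vY1 : nrm (v m) <= nrm Y + 1.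
  rewrite -[v m](subrK Y) addrC; apply: le_trans (nrmD _ _) _.
  by rewrite lerD2l (le_trans vm)// ge_min lexx.
apply: (@le_trans _ _ (d * (nrm Y + 1) + nrm X * d)).
  apply: lerD; apply: le_trans (nrmM _ _) _; last by rewrite ler_wpM2l ?nrm_ge0.
  by apply: ler_pM; rewrite ?nrm_ge0.
rewrite (mulrC d) -mulrDl addrAC [nrm Y + _]addrC -/c.
by rewrite mulrC -ler_pdivlMr// ge_min lexx orbT.
Qed.

Lemma mcvg_close u v X : mcvg u X ->
  (forall e, 0 < e -> exists N, forall m, (N <= m)%N -> nrm (u m - v m) <= e) ->
  mcvg v X.
Proof.
move=> uX uv e e0; have [N NP] := uX _ (divr_gt0 e0 (ltr0n _ 2)).
have [M MP] := uv _ (divr_gt0 e0 (ltr0n _ 2)); exists (maxn N M) => m.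
rewrite geq_max => /andP[/NP um /MP vm]; rewrite [e]splitr.
by apply: le_trans (nrm_triangle _ (u m) _) _; apply: lerD; rewrite // nrmB.
Qed.

Lemma mcvg_entry u X : mcvg u X <-> forall i j, (fun m => u m i j) @ \oo --> X i j.
Proof.
split=> [uX i j|uX e e0].
  apply/cvgrPdist_le => e e0; have [N NP] := uX e e0; exists N => // m /= /NP.
  rewrite nrmB; apply: le_trans; apply: le_trans (nrm_entry _ i j).
  by rewrite !mxE.
pose d := e / (n * n).+1%:R; have d0 : 0 < d by rewrite divr_gt0.
have uXij (ij : 'I_n * 'I_n) : \forall m \near \oo,
    `|X ij.1 ij.2 - u m ij.1 ij.2| <= d.
  by have /cvgrPdist_le/(_ d d0) := uX ij.1 ij.2.
have [N _ NP] := filter_forall _ uXij.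
exists N => m /NP um; rewrite nrmB /nrm.
apply: (@le_trans _ _ (\sum_(i < n) \sum_(j < n) d)).
  apply: ler_sum => i _; apply: ler_sum => j _; rewrite !mxE; exact: (um (i, j)).
rewrite !sumr_const !card_ord -mulrnA /d -[leLHS]mulr_natl mulrCA ger_pMr//.
by rewrite ler_pdivrMr// mul1r ler_nat.
Qed.

End MatrixNorm.

Section Exponential.
Variables (R : realType) (n : nat).
Implicit Types X Y Z : 'M[R]_n.

Definition epsum X m : 'M[R]_n := \sum_(k < m) (k`!%:R)^-1 *: X ^+ k.
Definition spsum (x : R) m : R := \sum_(k < m) (k`!%:R)^-1 * x ^+ k.

Lemma spsum_series x : spsum x = series (exp_coeff x).
Proof.
apply/funext => m; rewrite /series/= big_mkord; apply: eq_bigr => k _.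
by rewrite /exp_coeff/= mulrC.
Qed.

Lemma spsum_cvg x : spsum x @ \oo --> expR x.
Proof. by rewrite spsum_series; exact: is_cvg_series_exp_coeff. Qed.

Lemma spsum_le x m : 0 <= x -> spsum x m <= expR x.
Proof.
move=> x0; rewrite spsum_series; apply: nondecreasing_cvgn_le.
  apply/nondecreasing_seqP => k; rewrite /series/= big_nat_recr//= lerDl.
  exact: exp_coeff_ge0.
exact: is_cvg_series_exp_coeff.
Qed.

Lemma mxexp_cvg X : mcvg (epsum X) (mxexp X).
Proof.
apply/mcvg_entry => i j; rewrite mxE.
have -> : (fun m => (\sum_(k < m) (k`!%:R)^-1 *: X ^+ k) i j) =
    series (fun k => (k`!%:R)^-1 * (X ^+ k) i j).
  apply/funext => m; rewrite summxE /series/= big_mkord.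
  by apply: eq_bigr => k _; rewrite mxE.
apply: normed_cvg.
apply: (@series_le_cvg _ _ (nrm (1%:M : 'M[R]_n) *: exp_coeff (nrm X))) => [k|k|k|].
- exact: normr_ge0.
- by rewrite mulr_ge0 ?nrm_ge0// exp_coeff_ge0// nrm_ge0.
- rewrite /= normrM ger0_norm ?invr_ge0// -[leRHS]/(_ * (_ / _)).
  rewrite mulrA mulrC ler_wpM2r ?invr_ge0//.
  rewrite -[X ^+ k]mulmx1 mulrC; apply: le_trans (nrm_entry _ _ _) _.
  exact: nrmX_mul.
- by apply: is_cvg_seriesZ; exact: is_cvg_series_exp_coeff.
Qed.

Lemma mxexp_bound X Y b N : (forall m, nrm (epsum X (N + m) - Y) <= b) ->
  nrm (mxexp X - Y) <= b.
Proof.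
move=> XY; apply: mcvg_bound (mxexp_cvg X) _; exists N => m Nm.
by rewrite -(subnKC Nm).
Qed.

(** The coefficient 1/(N+1+k)! is bounded by 1/k!, which lets the factor [nrm X ^+ N.+1] be taken
    out of the tail. *)
Lemma mxexp_tail X N :
  nrm (mxexp X - epsum X N.+1) <= nrm X ^+ N.+1 * expR (nrm X).
Proof.
apply: (mxexp_bound (N := N.+1)) => m.
rewrite /epsum big_split_ord/= addrAC subrr add0r.
apply: le_trans (nrm_sum _ _) _.
apply: le_trans (_ : \sum_(k < m) nrm X ^+ N.+1 * ((k`!%:R)^-1 * nrm X ^+ k) <= _).
  apply: ler_sum => k _; rewrite nrmZ ger0_norm ?invr_ge0// mulrCA -exprD.
  apply: ler_pM; rewrite ?invr_ge0 ?nrm_ge0 ?nrmXS//.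
  by rewrite lef_pV2 ?posrE ?ltr0n ?fact_gt0// ler_nat leq_fact// leq_addl.
rewrite -mulr_sumr ler_wpM2l ?exprn_ge0 ?nrm_ge0//.
exact: spsum_le (nrm_ge0 _).
Qed.

Lemma mxexp_rem1 X : nrm (mxexp X - (1%:M + X)) <= nrm X ^+ 2 * expR (nrm X).
Proof.
have := mxexp_tail X 1.
by rewrite /epsum !big_ord_recr big_ord0/= add0r !invr1 !scale1r expr0.
Qed.

Lemma mxexp_rem2 X : nrm (mxexp X - (1%:M + X + 2^-1 *: (X *m X))) <=
  nrm X ^+ 3 * expR (nrm X).
Proof.
have := mxexp_tail X 2.
by rewrite /epsum !big_ord_recr big_ord0/= add0r !invr1 !scale1r expr0.
Qed.

Lemma sum_triangle (V : zmodType) (F : nat -> nat -> V) m :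
  \sum_(k < m) \sum_(i < k.+1) F i (k - i)%N = \sum_(i < m) \sum_(j < m - i) F i j.
Proof.
elim: m => [|m IH]; first by rewrite !big_ord0.
rewrite big_ord_recr/= IH [RHS]big_ord_recr/= big_ord_recr/= subnn subSnn.
rewrite big_ord1 addrA; congr (_ + _); rewrite -big_split/=.
by apply: eq_bigr => i _; rewrite subSn ?(ltnW (ltn_ord i))// big_ord_recr.
Qed.

Lemma epsumD X Y m : X *m Y = Y *m X ->
  epsum (X + Y) m = \sum_(i < m) \sum_(j < m - i)
     ((i`!%:R)^-1 * (j`!%:R)^-1) *: (X ^+ i *m Y ^+ j).
Proof.
move=> XY; rewrite -(sum_triangle (fun i j => ((i`!%:R)^-1 * (j`!%:R)^-1) *:
  (X ^+ i *m Y ^+ j))); apply: eq_bigr => k _.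
rewrite addrC exprDn_comm; last exact/esym.
rewrite scaler_sumr; apply: eq_bigr => i _.
rewrite -[(_ * _) *+ _]scaler_nat scalerA; congr (_ *: _).
  have ik : (i <= k)%N by rewrite -ltnS.
  by rewrite -(bin_fact ik) !natrM; field; rewrite !pnatr_eq0 -!lt0n !fact_gt0 bin_gt0.
rewrite -[_ *m _]/(_ * _); apply: commrX; apply/commr_sym/commrX/commr_sym.
exact: esym.
Qed.

Lemma spsumD (x y : R) m :
  spsum (x + y) m = \sum_(i < m) \sum_(j < m - i)
     ((i`!%:R)^-1 * (j`!%:R)^-1) * (x ^+ i * y ^+ j).
Proof.
rewrite -(sum_triangle (fun i j => ((i`!%:R)^-1 * (j`!%:R)^-1) *
  (x ^+ i * y ^+ j))); apply: eq_bigr => k _.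
rewrite addrC exprDn mulr_sumr; apply: eq_bigr => i _.
have ik : (i <= k)%N by rewrite -ltnS.
rewrite -mulr_natr -(bin_fact ik) !natrM.
by field; rewrite !pnatr_eq0 -!lt0n !fact_gt0 bin_gt0.
Qed.

(** The product of the partial sums minus the partial sum of X + Y consists of the terms outside a
    triangle of indices. Term by term it is dominated by the same scalar difference at [nrm X] and
    [nrm Y], which tends to 0 by the functional equation of the real exponential. *)
Lemma mxexpD X Y : X *m Y = Y *m X -> mxexp (X + Y) = mxexp X *m mxexp Y.
Proof.
move=> XY; apply/esym/(mcvg_uniq _ (mxexp_cvg (X + Y))).
apply: mcvg_close (mcvgM (mxexp_cvg X) (mxexp_cvg Y)) _ => e e0.
set x := nrm X; set y := nrm Y; pose c := nrm (1%:M : 'M[R]_n).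
have lim0 : (fun m => c * (spsum x m * spsum y m - spsum (x + y) m)) @ \oo --> (0 : R).
  rewrite -(mulr0 c) -(subrr (expR (x + y))) {1}expRD.
  apply: cvgMr; apply: cvgB; last exact: spsum_cvg.
  by apply: cvgM; exact: spsum_cvg.
have /cvgrPdist_le/(_ e e0)[N _ NP] := lim0; exists N => m /NP.
rewrite sub0r normrN => /(le_trans (ler_norm _)); apply: le_trans.
have split_ord (V : zmodType) (F : nat -> nat -> V) :
    \sum_(i < m) \sum_(j < m) F i j - \sum_(i < m) \sum_(j < m - i) F i j =
    \sum_(i < m) \sum_(j < i) F i (m - i + j)%N.
  rewrite -sumrB; apply: eq_bigr => i _.
  rewrite -[X in \sum_(j < X) F i j - _](subnK (ltnW (ltn_ord i))).
  by rewrite big_split_ord/= addrAC subrr add0r.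
rewrite epsumD// spsumD.
have -> : epsum X m *m epsum Y m = \sum_(i < m) \sum_(j < m)
    ((i`!%:R)^-1 * (j`!%:R)^-1) *: (X ^+ i *m Y ^+ j).
  rewrite mulmx_suml; apply: eq_bigr => i _; rewrite mulmx_sumr.
  by apply: eq_bigr => j _; rewrite -scalemxAl -scalemxAr scalerA.
have -> : spsum x m * spsum y m = \sum_(i < m) \sum_(j < m)
    ((i`!%:R)^-1 * (j`!%:R)^-1) * (x ^+ i * y ^+ j).
  rewrite mulr_suml; apply: eq_bigr => i _; rewrite mulr_sumr.
  by apply: eq_bigr => j _; rewrite mulrACA.
rewrite (split_ord _ (fun i j => ((i`!%:R)^-1 * (j`!%:R)^-1) *: (X ^+ i *m Y ^+ j))).
rewrite (split_ord _ (fun i j => ((i`!%:R)^-1 * (j`!%:R)^-1) * (x ^+ i * y ^+ j))).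
rewrite mulr_sumr; apply: le_trans (nrm_sum _ _) _; apply: ler_sum => i _.
rewrite mulr_sumr; apply: le_trans (nrm_sum _ _) _; apply: ler_sum => j _.
rewrite nrmZ ger0_norm ?mulr_ge0 ?invr_ge0// mulrCA ler_wpM2l ?mulr_ge0 ?invr_ge0//.
apply: le_trans (nrmX_mul _ _ _) _; rewrite mulrCA ler_wpM2l ?exprn_ge0 ?nrm_ge0//.
by rewrite -[Y ^+ _]mulmx1 mulrC; exact: nrmX_mul.
Qed.

Lemma mxexp_conj (P Q : 'M[R]_n) X : Q *m P = 1%:M ->
  mxexp (P *m X *m Q) = P *m mxexp X *m Q.
Proof.
move=> QP; apply: mcvg_uniq (mxexp_cvg _) _ => e e0.
have PXQ k : (P *m X *m Q) ^+ k = P *m X ^+ k *m Q.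
  elim: k => [|k IH]; first by rewrite !expr0 mulmx1 (mulmx1C QP).
  rewrite exprSr IH [in RHS]exprSr -[_ * _]/(_ *m _) -[X ^+ k * X]/(_ *m _).
  by rewrite !mulmxA -[_ *m Q *m P]mulmxA QP mulmx1.
have pos : 0 < nrm P * nrm Q + 1 by rewrite ltr_wpDl// mulr_ge0 ?nrm_ge0.
have [N NP] := mxexp_cvg X (divr_gt0 e0 pos); exists N => m /NP Xm.
have -> : epsum (P *m X *m Q) m = P *m epsum X m *m Q.
  rewrite mulmx_sumr mulmx_suml; apply: eq_bigr => k _.
  by rewrite PXQ -scalemxAr -scalemxAl.
rewrite -mulmxBl -mulmxBr; apply: le_trans (nrmM _ _) _.
apply: (@le_trans _ _ (nrm P * nrm (epsum X m - mxexp X) * nrm Q)).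
  by rewrite ler_wpM2r ?nrm_ge0// nrmM.
rewrite mulrAC; apply: le_trans (ler_wpM2l _ Xm) _; first by rewrite mulr_ge0 ?nrm_ge0.
by rewrite mulrCA ger_pMr// ler_pdivrMr// mul1r lerDl.
Qed.

Lemma mxexp_tr X : mxexp X^T = (mxexp X)^T.
Proof.
apply: mcvg_uniq (mxexp_cvg _) _ => e e0.
have [N NP] := mxexp_cvg X e0; exists N => m /NP Xm.
have -> : epsum X^T m = (epsum X m)^T.
  rewrite /epsum linear_sum; apply: eq_bigr => k _; rewrite linearZ/=; congr (_ *: _).
  by elim: (val k) => [|l IH]; rewrite ?expr0 ?trmx1// exprSr IH exprS trmx_mul.
by rewrite -linearB nrm_trmx.
Qed.

Lemma mxexp0 : mxexp (0 : 'M[R]_n) = 1%:M.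
Proof.
apply: mcvg_uniq (mxexp_cvg _) _ => e e0; exists 1%N => -[//|m] _.
rewrite /epsum big_ord_recl/= expr0 invr1 scale1r big1 ?addr0 ?subrr ?nrm0 ?ltW//.
by move=> k _; rewrite -[bump 0 k]/(k.+1) exprS mul0r scaler0.
Qed.

Lemma mxexpN X : mxexp X *m mxexp (- X) = 1%:M.
Proof. by rewrite -mxexpD ?subrr ?mxexp0// mulmxN mulNmx. Qed.

Lemma mxexp_comm X Y : X *m Y = Y *m X -> mxexp X *m Y = Y *m mxexp X.
Proof.
move=> XY; have XkY k : X ^+ k *m Y = Y *m X ^+ k.
  elim: k => [|k IH]; first by rewrite !expr0 mul1mx mulmx1.
  by rewrite exprS -mulmxA IH mulmxA XY -mulmxA.
have eXY m : epsum X m *m Y = Y *m epsum X m.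
  rewrite mulmx_suml mulmx_sumr; apply: eq_bigr => k _.
  by rewrite -scalemxAl -scalemxAr XkY.
have cY (u : nat -> 'M[R]_n) : mcvg (fun=> Y) Y.
  by move=> e e0; exists 0%N => m _; rewrite subrr nrm0 ltW.
apply: mcvg_uniq (mcvgM (mxexp_cvg X) (cY (fun=> 0))) _.
apply: mcvg_close (mcvgM (cY (fun=> 0)) (mxexp_cvg X)) _ => e e0.
by exists 0%N => m _; rewrite eXY subrr nrm0 ltW.
Qed.

Lemma mxexp_diag (d : 'rV[R]_n) :
  mxexp (diag_mx d) = diag_mx (map_mx expR d).
Proof.
apply: mcvg_uniq (mxexp_cvg _) _; apply/mcvg_entry => i j.
have dX k : diag_mx d ^+ k = diag_mx (map_mx (fun x => x ^+ k) d).
  elim: k => [|k IH].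
    by apply/matrixP => a b; rewrite expr0 !mxE expr0.
  rewrite exprS IH -[_ * _]/(_ *m _) mulmx_diag; congr diag_mx.
  by apply/rowP => a; rewrite !mxE exprS.
have -> : (fun m => epsum (diag_mx d) m i j) = (fun m => spsum (d 0 i) m *+ (i == j)).
  apply/funext => m; rewrite summxE /spsum -sumrMnl; apply: eq_bigr => k _.
  by rewrite dX !mxE mulrnAr.
rewrite !mxE; case: eqVneq => [->|_]; rewrite ?mulr1n ?mulr0n; first exact: spsum_cvg.
exact: cvg_cst.
Qed.

Lemma mxexp_natmul X m : mxexp (m%:R *: X) = mxexp X ^+ m.
Proof.
elim: m => [|m IH]; first by rewrite scale0r mxexp0 expr0.
rewrite -natr1 scalerDl scale1r mxexpD ?IH ?exprSr//.
by rewrite -scalemxAl -scalemxAr.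
Qed.

Lemma mxexp_scaleD X (s t : R) : mxexp ((s + t) *: X) = mxexp (s *: X) *m mxexp (t *: X).
Proof.
by rewrite scalerDl mxexpD// -!scalemxAl -!scalemxAr !scalerA mulrC.
Qed.

Lemma mxexp_scale_rem1 X : exists2 C, 0 <= C & forall s, 0 <= s <= 1 ->
  nrm (mxexp (s *: X) - (1%:M + s *: X)) <= C * s ^+ 2.
Proof.
exists (nrm X ^+ 2 * expR (nrm X)); first by rewrite mulr_ge0 ?sqr_ge0 ?expR_ge0.
move=> s /andP[s0 s1]; apply: le_trans (mxexp_rem1 _) _.
rewrite nrmZ ger0_norm// exprMn [s ^+ 2 * _]mulrC -[leLHS]mulrA -[leRHS]mulrA.
rewrite ler_wpM2l ?sqr_ge0//.
by rewrite [leRHS]mulrC ler_wpM2l ?sqr_ge0// ler_expR ler_piMl ?nrm_ge0.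
Qed.

End Exponential.

(** * Continuity and compactness for matrices *)

Section PolynomialContinuity.
Variable R : numFieldType.

Lemma continuous_cst_fun (T : topologicalType) (c : R) : continuous (fun _ : T => c).
Proof. by move=> t; exact: cvg_cst. Qed.

Lemma continuous_mul_fun (T : topologicalType) (f g : T -> R) :
  continuous f -> continuous g -> continuous (fun t => f t * g t).
Proof. by move=> cf cg t; apply: cvgM; [exact: cf|exact: cg]. Qed.

Lemma continuous_exp_fun (T : topologicalType) (f : T -> R) m :
  continuous f -> continuous (fun t => f t ^+ m).
Proof.
move=> cf; elim: m => [|m IH].
  by under eq_fun do rewrite expr0; exact: continuous_cst_fun.
by under eq_fun do rewrite exprS; exact: continuous_mul_fun.
Qed.

Lemma continuous_sum_fun (T : topologicalType) (I : Type) (s : seq I) (F : I -> T -> R) :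
  (forall i, continuous (F i)) -> continuous (fun X => \sum_(i <- s) F i X).
Proof.
move=> cF X; elim: s => [|i s IH].
  by under eq_fun do rewrite big_nil; exact: cvg_cst.
by under eq_fun do rewrite big_cons; apply: cvgD => //; exact: cF.
Qed.

Lemma continuous_prod_fun (T : topologicalType) (I : Type) (s : seq I) (F : I -> T -> R) :
  (forall i, continuous (F i)) -> continuous (fun X => \prod_(i <- s) F i X).
Proof.
move=> cF X; elim: s => [|i s IH].
  by under eq_fun do rewrite big_nil; exact: cvg_cst.
by under eq_fun do rewrite big_cons; apply: cvgM => //; exact: cF.
Qed.

Lemma continuous_evalmx (K : comNzRingType) (f : K -> R) n (p : mpoly.mpoly (n * n) K) :
  continuous (evalmx f p : 'M[R]_n -> R).
Proof.
rewrite /evalmx /mpoly.mmap; apply: continuous_sum_fun => m; apply: continuous_mul_fun.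
  exact: continuous_cst_fun.
apply: continuous_prod_fun => k; case/mxvec_indexP: k => i j.
by apply: continuous_exp_fun; under eq_fun do [rewrite mxvecE]; exact: coord_continuous.
Qed.

End PolynomialContinuity.

Section MatrixTopology.
Variables (R : realType) (n : nat).
Lemma closed_nrm (C : set 'M[R]_n) X : closed C ->
  (forall e, 0 < e -> exists2 Y, C Y & nrm (Y - X) <= e) -> C X.
Proof.
move=> cC CX; apply: cC => B /nbhs_ballP[e /= e0 eB].
have [Y CY YX] := CX _ (divr_gt0 e0 (ltr0n _ 2)).
exists Y; split=> //; apply: eB; split=> [//|i j].
rewrite /ball/= distrC (le_lt_trans (y := nrm (Y - X)))//.
  by apply: le_trans (nrm_entry _ i j); rewrite !mxE.
by rewrite (le_lt_trans YX)// ltr_pdivrMr// ltr_pMr// ltr1n.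
Qed.

Lemma continuous_entries (T : topologicalType) m p (F : T -> 'M[R]_(m, p)) :
  (forall i j, continuous (fun X => F X i j)) -> continuous F.
Proof.
move=> cF X; apply/cvg_ballP => e e0.
have cFij (ij : 'I_m * 'I_p) : \forall Y \near X, ball (F X ij.1 ij.2) e (F Y ij.1 ij.2).
  by move/cvg_ballP: (cF ij.1 ij.2 X) => /(_ e e0).
apply: filterS (filter_forall _ cFij) => t Ft; split=> // i j; exact: (Ft (i, j)).
Qed.

(** The extreme value theorem is used for row vectors and carried over by [vec_mx]. *)
Lemma compact_max_mx (C : set 'M[R]_n) (f : 'M[R]_n -> R) b : closed C ->
  (forall X, C X -> nrm X <= b) -> C !=set0 -> continuous f ->
  exists2 X, C X & forall Y, C Y -> f Y <= f X.
Proof.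
move=> cC Cb [X0 CX0] cf.
have cvec : continuous (vec_mx : 'rV[R]_(n * n) -> 'M[R]_n).
  apply: continuous_entries => i j X.
  by under eq_fun do rewrite mxE; exact: coord_continuous.
pose A : set 'rV[R]_(n * n) := vec_mx @^-1` C.
have cA : closed A by apply: closed_comp => // X _; exact: cvec.
have bA : bounded_set A.
  exists `|b|; split; first exact: normr_real.
  move=> M bM v /Cb vb /=; rewrite [leLHS]/Num.norm/= mx_normrE; apply/bigmax_leP; split=> /=.
    by rewrite (le_trans _ (ltW bM)).
  move=> [i j] _ /=; rewrite ord1; case/mxvec_indexP: j => a c.
  have := le_trans (nrm_entry (vec_mx v) a c) vb; rewrite mxE => /le_trans; apply.
  by rewrite (le_trans (ler_norm _))// ltW.
have A0 : A !=set0 by exists (mxvec X0); rewrite /A/= mxvecK.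
have cfA : {within A, continuous (f \o vec_mx)}.
  apply: continuous_subspaceT => X; apply: continuous_comp; [exact: cvec|exact: cf].
have [c] := EVT_max_rV A0 (bounded_closed_compact bA cA) cfA.
rewrite inE => Ac cmax; exists (vec_mx c) => // Y CY.
by have := cmax (mxvec Y); rewrite inE /A/= mxvecK; apply.
Qed.

Lemma continuous_mulmx (T : topologicalType) m p q (F : T -> 'M[R]_(m, p))
    (H : T -> 'M[R]_(p, q)) :
  (forall i j, continuous (fun X => F X i j)) ->
  (forall i j, continuous (fun X => H X i j)) ->
  forall i j, continuous (fun X => (F X *m H X) i j).
Proof.
move=> cF cH i j; under eq_fun do rewrite mxE.
by apply: continuous_sum_fun => k X; apply: cvgM; [exact: cF|exact: cH].
Qed.

Lemma continuous_trmx (T : topologicalType) m p (F : T -> 'M[R]_(m, p)) :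
  (forall i j, continuous (fun X => F X i j)) ->
  forall i j, continuous (fun X => (F X)^T i j).
Proof. by move=> cF i j; under eq_fun do [rewrite mxE]; exact: cF. Qed.

Lemma continuous_det (T : topologicalType) m (F : T -> 'M[R]_m) :
  (forall i j, continuous (fun X => F X i j)) -> continuous (fun X => \det (F X)).
Proof.
move=> cF; apply: continuous_sum_fun => s X; apply: cvgM; first exact: cvg_cst.
by apply: continuous_prod_fun.
Qed.

Lemma continuous_adj (T : topologicalType) m (F : T -> 'M[R]_m) :
  (forall i j, continuous (fun X => F X i j)) ->
  forall i j, continuous (fun X => (\adj (F X)) i j).
Proof.
move=> cF i j; under eq_fun do rewrite mxE /cofactor.
move=> X; apply: cvgM; first exact: cvg_cst.
apply: (continuous_det (F := fun t => row' j (col' i (F t)))) => a c; by under eq_fun do [rewrite !mxE]; exact: cF.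
Qed.

Lemma closed_level (T : topologicalType) (f : T -> R) c : continuous f ->
  closed [set X | f X = c].
Proof.
move=> cf; rewrite [X in closed X](_ : _ = f @^-1` [set c]); last by [].
by apply: closed_comp; [move=> X _; exact: cf|exact: closed_eq].
Qed.

Lemma closed_forall (T : topologicalType) (I : Type) (C : I -> set T) :
  (forall i, closed (C i)) -> closed [set X | forall i, C i X].
Proof.
move=> cC; rewrite [X in closed X](_ : _ = \bigcap_(i in setT) C i).
  exact: closed_bigI.
by apply/seteqP; split=> X /= CX i; [move=> _|]; apply: CX.
Qed.

Lemma closed_evalmx (K : rcfType) (iR : {rmorphism K -> R})
    (G : seq (mpoly.mpoly (n * n) K)) : closed (points iR G).
Proof.
have cp p : closed [set g : 'M[R]_n | evalmx iR p g = 0].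
  by apply: closed_level; exact: continuous_evalmx.
elim: G => [|p G IH].
  by rewrite [X in closed X](_ : _ = setT); [exact: closedT|apply/seteqP].
rewrite [X in closed X](_ : _ = [set g : 'M[R]_n | evalmx iR p g = 0] `&` points iR G).
  exact: closedI.
by apply/seteqP; split=> g /=; rewrite /points/=; [move=> /andP[/eqP]|
  move=> [/eqP-> ->]].
Qed.

End MatrixTopology.

(** * The Lie algebra of a closed matrix group *)

Section PowerClose.
Variables (R : realType) (n : nat).
Implicit Types X Y Z g h : 'M[R]_n.

(** Telescoping: g^(m+1) - h^(m+1) = g (g^m - h^m) + (g - h) h^m. *)
Lemma mx_pow_close g h b d m : 0 <= b -> nrm (g - 1%:M) <= b -> nrm (h - 1%:M) <= b ->
  nrm (g - h) <= d -> nrm (g ^+ m - h ^+ m) <= m%:R * (1 + b) ^+ m * d.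
Proof.
move=> b0 gb hb ghd; have d0 : 0 <= d := le_trans (nrm_ge0 _) ghd.
have mull Y : nrm (g *m Y) <= (1 + b) * nrm Y.
  rewrite -[g](subrK 1%:M) mulmxDl mul1mx mulrDl mul1r addrC.
  apply: le_trans (nrmD _ _) _; rewrite lerD2l; apply: le_trans (nrmM _ _) _.
  by rewrite ler_wpM2r ?nrm_ge0.
have mulr k Y : nrm (Y *m h ^+ k) <= (1 + b) ^+ k * nrm Y.
  elim: k Y => [|k IH] Y; first by rewrite !expr0 mulmx1 mul1r.
  rewrite !exprS mulmxA; apply: le_trans (IH _) _.
  rewrite [(1 + b) * _]mulrC -mulrA ler_wpM2l ?exprn_ge0 ?addr_ge0//.
  rewrite -[h](subrK 1%:M) mulmxDr mulmx1 mulrDl mul1r addrC.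
  apply: le_trans (nrmD _ _) _; rewrite lerD2l; apply: le_trans (nrmM _ _) _.
  by rewrite mulrC ler_wpM2r ?nrm_ge0.
elim: m => [|m IH]; first by rewrite subrr nrm0 !mul0r.
have -> : g ^+ m.+1 - h ^+ m.+1 = g *m (g ^+ m - h ^+ m) + (g - h) *m h ^+ m.
  by rewrite !exprS mulmxBr mulmxBl addrA subrK.
apply: le_trans (nrmD _ _) _.
apply: le_trans (lerD (mull _) (mulr _ _)) _.
have b1 : 0 <= 1 + b by rewrite addr_ge0.
have := lerD (ler_wpM2l b1 IH) (ler_wpM2l (exprn_ge0 m b1) ghd).
move=> /le_trans; apply; rewrite -natr1 exprS.
have : (1 + b) ^+ m * d <= (1 + b) * (1 + b) ^+ m * d.
  by rewrite ler_wpM2r// ler_peMl ?exprn_ge0// lerDl.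
move: ((1 + b) ^+ m * d) => Z; nra.
Qed.

End PowerClose.

Section LieAlgebra.
Variables (R : realType) (n : nat) (G : set 'M[R]_n).
Hypothesis Gcl : closed G.
Hypothesis Ggrp : matrix_group G.
Implicit Types X Y Z g : 'M[R]_n.

Definition bracket X Y := X *m Y - Y *m X.

Lemma matrix_group1 : G 1%:M. Proof. by case: Ggrp. Qed.
Lemma matrix_groupM g h : G g -> G h -> G (g *m h). Proof. by case: Ggrp => _ + _; apply. Qed.
Lemma matrix_groupV g : G g -> G (invmx g). Proof. by case: Ggrp => _ _ H /H[]. Qed.
Lemma matrix_group_unit g : G g -> g \in unitmx. Proof. by case: Ggrp => _ _ H /H[]. Qed.

Lemma mxexp_inv X : invmx (mxexp X) = mxexp (- X).
Proof.
have XN := mxexpN X; have [uX _] := mulmx1_unit XN.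
by rewrite -[mxexp (- X)](mulKmx uX) XN mulmx1.
Qed.

(** It suffices to approximate 1 + sX up to o(s) inside G: with s = t/m, the power g^m lies in G and
    is close to exp(sX)^m = exp(tX), and G is closed. Sums, limits and brackets in the Lie algebra
    all rest on this criterion. *)
Lemma Lie_tangent X :
  (forall e, 0 < e -> exists2 d, 0 < d & forall s, 0 < s < d ->
     exists2 g, G g & nrm (g - (1%:M + s *: X)) <= e * s) -> Lie G X.
Proof.
move=> tanX; suff pos t : 0 < t -> G (mxexp (t *: X)).
  move=> t; have [/pos//|t0|<-] := ltgtP 0 t; last by rewrite scale0r mxexp0; exact: matrix_group1.
  have : G (mxexp ((- t) *: X)) by apply: pos; rewrite oppr_gt0.
  by move=> /matrix_groupV; rewrite mxexp_inv scaleNr opprK.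
move=> t0; apply: closed_nrm => // e e0.
(* [M] bounds (1 + s(x + 1))^m for s = t/m, whatever m is; the final error is at most 2 e1 t M,
   which dictates [e1]. *)
set x := nrm X; pose M := expR (t * (x + 1)).
have M0 : 0 < M by exact: expR_gt0.
have den : 0 < 2 * t * M by rewrite !mulr_gt0.
pose e1 := Num.min 1 (e / (2 * t * M)).
have e10 : 0 < e1 by rewrite lt_min ltr01 divr_gt0.
have [C C0 CP] := mxexp_scale_rem1 X.
have [d d0 dP] := tanX _ e10.
have C1 : 0 < C + 1 by rewrite ltr_wpDl.
(* Below [b], both g and exp(sX) are within e1 s of 1 + sX. *)
pose b := Num.min 1 (Num.min d (e1 / (C + 1))).
have b0 : 0 < b by rewrite !lt_min ltr01 d0 divr_gt0.
have [m mP] : exists m : nat, t / b < m%:R.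
  by exists (Num.truncn (t / b)).+1; rewrite truncnS_gt.
have m0 : 0 < m%:R :> R by apply: lt_trans mP; rewrite divr_gt0.
pose s := t / m%:R; have s0 : 0 < s by rewrite divr_gt0.
have sb : s < b by rewrite /s ltr_pdivrMr// mulrC -ltr_pdivrMr.
move: sb; rewrite !lt_min => /andP[s1 /andP[sd se]].
have [g Gg gP] : exists2 g, G g & nrm (g - (1%:M + s *: X)) <= e1 * s.
  by apply: dP; rewrite s0.
have hP : nrm (mxexp (s *: X) - (1%:M + s *: X)) <= e1 * s.
  apply: le_trans (CP s _) _; first by rewrite !ltW.
  rewrite expr2 mulrA ler_wpM2r ?(ltW s0)//.
  apply: (@le_trans _ _ (s * (C + 1))); first by rewrite mulrC ler_wpM2l ?(ltW s0)// lerDl.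
  by rewrite -ler_pdivlMr// ltW.
have near1 h : nrm (h - (1%:M + s *: X)) <= e1 * s -> nrm (h - 1%:M) <= s * (x + 1).
  move=> hh; have -> : h - 1%:M = (h - (1%:M + s *: X)) + s *: X.
    by rewrite opprD addrA subrK.
  apply: le_trans (nrmD _ _) _; rewrite nrmZ gtr0_norm// mulrDr mulr1 addrC lerD2l.
  by apply: le_trans hh _; rewrite ler_piMl ?(ltW s0)// ge_min lexx.
exists (g ^+ m).
  elim: (m) => [|k IH]; first by rewrite expr0; exact: matrix_group1.
  by rewrite exprS; exact: matrix_groupM.
have -> : mxexp (t *: X) = mxexp (s *: X) ^+ m.
  by rewrite -mxexp_natmul scalerA /s mulrC divfK ?gt_eqF.
have gh : nrm (g - mxexp (s *: X)) <= 2 * e1 * s.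
  apply: le_trans (nrm_triangle _ (1%:M + s *: X) _) _.
  by rewrite [X in _ + X]nrmB -mulrA mulr_natl mulr2n; apply: lerD.
have sx0 : 0 <= s * (x + 1) by rewrite mulr_ge0 ?(ltW s0)// addr_ge0// nrm_ge0.
apply: le_trans (mx_pow_close m sx0 (near1 _ gP) (near1 _ hP) gh) _.
have pow : (1 + s * (x + 1)) ^+ m <= M.
  have -> : M = expR (m%:R * (s * (x + 1))).
    by rewrite mulrA /s [m%:R * _]mulrC divfK ?gt_eqF.
  rewrite expRM_natl.
  by apply: lerXn2r; rewrite ?nnegrE ?expR_ge0 ?addr_ge0// expR_ge1Dx.
have e1e : e1 * (2 * t * M) <= e by rewrite -ler_pdivlMr// ge_min lexx orbT.
apply: le_trans e1e.
have -> : m%:R * (1 + s * (x + 1)) ^+ m * (2 * e1 * s) =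
   (1 + s * (x + 1)) ^+ m * (2 * e1 * t).
  by rewrite /s; field; rewrite gt_eqF.
have -> : e1 * (2 * t * M) = M * (2 * e1 * t) by ring.
by rewrite ler_wpM2r// !mulr_ge0// ltW.
Qed.

Lemma Lie_tangent2 X C : (forall s, 0 <= s <= 1 ->
    exists2 g, G g & nrm (g - (1%:M + s *: X)) <= C * s ^+ 2) -> Lie G X.
Proof.
move=> XC; apply: Lie_tangent => e e0.
have C1 : 0 < `|C| + 1 by rewrite ltr_wpDl.
exists (Num.min 1 (e / (`|C| + 1))); first by rewrite lt_min ltr01 divr_gt0.
move=> s /andP[s0]; rewrite lt_min => /andP[s1 se].
have [|g Gg gP] := XC s; first by rewrite !ltW.
exists g => //; apply: le_trans gP _; rewrite expr2 mulrA ler_wpM2r ?(ltW s0)//.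
apply: (@le_trans _ _ ((`|C| + 1) * s)).
  by rewrite ler_wpM2r ?(ltW s0)// (le_trans (ler_norm _))// lerDl.
by rewrite mulrC -ler_pdivlMr// ltW.
Qed.

Lemma LieZ c X : Lie G X -> Lie G (c *: X).
Proof. by move=> GX t; rewrite scalerA; exact: GX. Qed.

Lemma LieN X : Lie G X -> Lie G (- X).
Proof. by rewrite -scaleN1r; exact: LieZ. Qed.

Lemma Lie0 : Lie G 0.
Proof. by move=> t; rewrite scaler0 mxexp0; exact: matrix_group1. Qed.

Lemma nrm_mxexp_scale X : exists2 C, 0 <= C &
  forall s, 0 <= s <= 1 -> nrm (mxexp (s *: X)) <= C.
Proof.
have [C C0 CP] := mxexp_scale_rem1 X.
exists (C + (nrm (1%:M : 'M[R]_n) + nrm X)); first by rewrite !addr_ge0 ?nrm_ge0.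
move=> s /[dup] s01 /andP[s0 s1]; rewrite -[mxexp _](subrK (1%:M + s *: X)).
apply: le_trans (nrmD _ _) _; apply: lerD.
  by apply: le_trans (CP s s01) _; rewrite ler_piMr// expr_le1.
by apply: le_trans (nrmD _ _) _; rewrite lerD2l nrmZ ger0_norm// ler_piMl ?nrm_ge0.
Qed.

(** The tangent curve is exp(sX) exp(sY). *)
Lemma LieD X Y : Lie G X -> Lie G Y -> Lie G (X + Y).
Proof.
move=> GX GY; have [CX CX0 XP] := mxexp_scale_rem1 X.
have [CY CY0 YP] := mxexp_scale_rem1 Y; have [M M0 MP] := nrm_mxexp_scale Y.
apply: (@Lie_tangent2 _ (CX * M + (nrm (1%:M : 'M[R]_n) + nrm X) * CY + nrm (X *m Y))).
move=> s s01; exists (mxexp (s *: X) *m mxexp (s *: Y)).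
  by apply: matrix_groupM; [exact: GX|exact: GY].
have -> : mxexp (s *: X) *m mxexp (s *: Y) - (1%:M + s *: (X + Y)) =
    (mxexp (s *: X) - (1%:M + s *: X)) *m mxexp (s *: Y) +
    (1%:M + s *: X) *m (mxexp (s *: Y) - (1%:M + s *: Y)) + s ^+ 2 *: (X *m Y).
  rewrite !(mulmxBl, mulmxBr, mulmxDl, mulmxDr, mul1mx, mulmx1, =^~ scalemxAl, =^~ scalemxAr).
  move: (mxexp _ *m _) (X *m mxexp _) (X *m Y) => a b c.
  by apply/matrixP => i j; rewrite !mxE; ring.
have [s0 s1] := andP s01.
rewrite [leRHS]mulrDl [X in _ <= X + _]mulrDl.
apply: le_trans (nrmD _ _) _; apply: lerD; last first.
  by rewrite nrmZ ger0_norm ?sqr_ge0// mulrC.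
apply: le_trans (nrmD _ _) _; apply: lerD; apply: le_trans (nrmM _ _) _.
  by rewrite mulrAC ler_pM ?nrm_ge0 ?XP ?MP.
rewrite -mulrA ler_pM ?nrm_ge0 ?YP//.
by apply: le_trans (nrmD _ _) _; rewrite lerD2l nrmZ ger0_norm// ler_piMl ?nrm_ge0.
Qed.

Lemma LieB X Y : Lie G X -> Lie G Y -> Lie G (X - Y).
Proof. by move=> GX GY; apply: LieD => //; exact: LieN. Qed.

Lemma Lie_limit X : (forall e, 0 < e -> exists2 Y, Lie G Y & nrm (Y - X) <= e) -> Lie G X.
Proof.
move=> lX; apply: Lie_tangent => e e0; have e20 : 0 < e / 2 by rewrite divr_gt0.
have [Y GY YX] := lX _ e20; have [C C0 CP] := mxexp_scale_rem1 Y.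
have C1 : 0 < C + 1 by rewrite ltr_wpDl.
exists (Num.min 1 (e / 2 / (C + 1))); first by rewrite lt_min ltr01 !divr_gt0.
move=> s /andP[s0]; rewrite lt_min => /andP[s1 se].
exists (mxexp (s *: Y)); first exact: GY.
apply: le_trans (nrm_triangle _ (1%:M + s *: Y) _) _.
rewrite [e]splitr mulrDl; apply: lerD; last first.
  by rewrite opprD addrACA subrr add0r -scalerBr nrmZ gtr0_norm// mulrC ler_wpM2r// ltW.
apply: le_trans (CP _ _) _; first by rewrite !ltW.
rewrite expr2 mulrA ler_wpM2r ?(ltW s0)// (@le_trans _ _ ((C + 1) * s))//.
  by rewrite ler_wpM2r ?(ltW s0)// lerDl.
by rewrite mulrC -ler_pdivlMr// ltW.
Qed.

Lemma Lie_conj g X : G g -> Lie G X -> Lie G (g *m X *m invmx g).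
Proof.
move=> Gg GX t; have -> : t *: (g *m X *m invmx g) = g *m (t *: X) *m invmx g.
  by rewrite -scalemxAr -scalemxAl.
rewrite mxexp_conj ?mulVmx ?matrix_group_unit//.
by apply: matrix_groupM; [apply: matrix_groupM => //; exact: GX|exact: matrix_groupV].
Qed.

(** The bracket is the derivative at 0 of s -> exp(sX) Y exp(-sX), hence a limit of difference
    quotients that lie in [Lie G]. *)
Lemma Lie_bracket X Y : Lie G X -> Lie G Y -> Lie G (bracket X Y).
Proof.
move=> GX GY; apply: Lie_limit => e e0.
have [C C0 CP] := mxexp_scale_rem1 X; have [C' C'0 C'P] := mxexp_scale_rem1 (- X).
have [M M0 MP] := nrm_mxexp_scale (- X).
pose D := nrm (bracket X Y) * (C' + nrm X) + 2 * C * nrm Y * M.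
have D0 : 0 <= D by rewrite !(addr_ge0, mulr_ge0)// nrm_ge0.
have D1 : 0 < D + 1 by rewrite ltr_wpDl.
pose s := Num.min 1 (e / (D + 1)).
have s0 : 0 < s by rewrite lt_min ltr01 divr_gt0.
have s1 : s <= 1 by rewrite ge_min lexx.
have s01 : 0 <= s <= 1 by rewrite ltW.
exists (s^-1 *: (mxexp (s *: X) *m Y *m invmx (mxexp (s *: X)) - Y)).
  by apply/LieZ/LieB => //; apply: Lie_conj => //; exact: GX.
rewrite mxexp_inv -scalerN; set E := mxexp (s *: X); set E' := mxexp (s *: - X).
pose A := E - (1%:M + s *: X).
have EE' : E *m E' = 1%:M by rewrite /E /E' scalerN mxexpN.
have YE : Y = Y *m E *m E' by rewrite -mulmxA EE' mulmx1.
(* Conjugation is replaced by the commutator of [E] with Y, whose linear part is exact; [A] is the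
   quadratic remainder. *)
have comm : E *m Y - Y *m E = s *: bracket X Y + (A *m Y - Y *m A).
  rewrite /A /bracket.
  rewrite !(mulmxBl, mulmxBr, mulmxDl, mulmxDr, mul1mx, mulmx1, =^~ scalemxAl, =^~ scalemxAr).
  move: (E *m _) (_ *m E) (X *m Y) (Y *m X) => a b c d.
  by apply/matrixP => i j; rewrite !mxE; ring.
have -> : s^-1 *: (E *m Y *m E' - Y) - bracket X Y =
   bracket X Y *m (E' - 1%:M) + s^-1 *: ((A *m Y - Y *m A) *m E').
  move: comm; move: (bracket X Y) (A *m Y - Y *m A) => B W comm.
  rewrite {2}YE -mulmxBl comm mulmxDl scalerDr -scalemxAl scalerA mulVf ?gt_eqF//.
  by rewrite scale1r mulmxBr mulmx1 addrAC.
have AC : nrm A <= C * s ^+ 2 by exact: CP.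
apply: (@le_trans _ _ (D * s)); last first.
  apply: (@le_trans _ _ ((D + 1) * s)); first by rewrite ler_wpM2r ?(ltW s0)// lerDl.
  by rewrite mulrC -ler_pdivlMr// ge_min lexx orbT.
rewrite /D mulrDl; apply: le_trans (nrmD _ _) _; apply: lerD.
  apply: le_trans (nrmM _ _) _; rewrite -mulrA ler_wpM2l ?nrm_ge0//.
  have -> : E' - 1%:M = (E' - (1%:M + s *: - X)) + s *: - X by rewrite opprD addrA subrK.
  apply: le_trans (nrmD _ _) _; rewrite mulrDl; apply: lerD.
    apply: le_trans (C'P _ s01) _; rewrite expr2 mulrA ler_piMr//.
    by rewrite mulr_ge0// ltW.
  by rewrite nrmZ nrmN gtr0_norm// mulrC.
rewrite nrmZ gtr0_norm ?invr_gt0// ler_pdivrMl//.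
apply: le_trans (nrmM _ _) _.
have -> : s * (2 * C * nrm Y * M * s) = (2 * (C * s ^+ 2) * nrm Y) * M by ring.
apply: ler_pM; rewrite ?nrm_ge0 ?MP//.
apply: le_trans (nrmD _ _) _; rewrite nrmN.
rewrite -mulrA mulr_natl mulr2n; apply: lerD; apply: le_trans (nrmM _ _) _.
  by rewrite ler_wpM2r ?nrm_ge0.
by rewrite mulrC ler_wpM2r ?nrm_ge0.
Qed.

End LieAlgebra.

(** * Symmetric matrices *)

Section Spectral.
Variable L : rcfType.
Local Notation C := L[i].

Definition sqnorm n (x : 'rV[L]_n) : L := \sum_i x 0 i ^+ 2.

Lemma sqnormE n (x : 'rV[L]_n) : x *m x^T = (sqnorm x)%:M.
Proof.
apply/matrixP => i j; rewrite !ord1 !mxE eqxx mulr1n.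
by apply: eq_bigr => k _; rewrite !mxE expr2.
Qed.

Lemma sqnorm_ge0 n (x : 'rV[L]_n) : 0 <= sqnorm x.
Proof. by apply: sumr_ge0 => i _; rewrite sqr_ge0. Qed.

Lemma sqnorm_eq0 n (x : 'rV[L]_n) : (sqnorm x == 0) = (x == 0).
Proof.
rewrite psumr_eq0; last by move=> i _; rewrite sqr_ge0.
apply/allP/eqP => [x0|-> i _]; last by rewrite mxE expr0n/= eqxx.
apply/rowP => i; rewrite mxE; apply/eqP.
by have := x0 i (mem_index_enum i) => /=; rewrite sqrf_eq0.
Qed.

(** An eigenvector exists over L[i]. With real and imaginary parts x, y and b the imaginary part of
    the eigenvalue, symmetry gives b (|x|^2 + |y|^2) = 0; so b = 0, and whichever of x, y is nonzero
    is an eigenvector over L. *)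
Lemma symmetric_eigenvector n d (M : 'M[L]_n) (W : 'M[L]_(d, n)) : M^T = M ->
  row_free W -> (0 < d)%N -> (W *m M <= W)%MS ->
  exists a, exists x : 'rV[L]_n, [/\ x != 0, (x <= W)%MS & x *m M = a *: x].
Proof.
move=> Ms Wf d0 /submxP[N WN].
pose rc := real_complex L; pose NC := map_mx rc N.
have [z rz] : exists z, root (char_poly NC) z.
  by apply/closed_rootP; rewrite size_char_poly eqSS -lt0n.
move: rz; rewrite -eigenvalue_root_char => /eigenvalueP[v vN v0].
pose w := v *m map_mx rc W.
have w0 : w != 0.
  apply: contra v0 => /eqP w0; apply/eqP.
  have Wcf : row_free (map_mx rc W) by rewrite row_free_map.
  by apply: (row_free_inj Wcf); rewrite -/w w0 mul0mx.
have wM : w *m map_mx rc M = z *: w.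
  by rewrite /w -mulmxA -map_mxM WN map_mxM mulmxA vN scalemxAl.
pose x := map_mx (@complex.Re L) w; pose y := map_mx (@complex.Im L) w.
have ReS (I : finType) (F : I -> C) : complex.Re (\sum_i F i) = \sum_i complex.Re (F i).
  by apply: (big_morph (@complex.Re L)) => [[a b] [a' b']|].
have ImS (I : finType) (F : I -> C) : complex.Im (\sum_i F i) = \sum_i complex.Im (F i).
  by apply: (big_morph (@complex.Im L)) => [[a b] [a' b']|].
have ReM (a : C) (b : L) : complex.Re (a * rc b) = complex.Re a * b.
  by case: a => a a' /=; rewrite mulr0 subr0.
have ImM (a : C) (b : L) : complex.Im (a * rc b) = complex.Im a * b.
  by case: a => a a' /=; rewrite mulr0 add0r.
have xE m p (u : 'M[C]_(m, p)) q (B : 'M[L]_(p, q)) :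
    map_mx (@complex.Re L) (u *m map_mx rc B) = map_mx (@complex.Re L) u *m B.
  apply/matrixP => i j; rewrite !mxE ReS; apply: eq_bigr => k _.
  by rewrite !mxE ReM.
have yE m p (u : 'M[C]_(m, p)) q (B : 'M[L]_(p, q)) :
    map_mx (@complex.Im L) (u *m map_mx rc B) = map_mx (@complex.Im L) u *m B.
  apply/matrixP => i j; rewrite !mxE ImS; apply: eq_bigr => k _.
  by rewrite !mxE ImM.
pose a := complex.Re z; pose b := complex.Im z.
have xM : x *m M = a *: x - b *: y.
  rewrite -xE wM /x /y /a /b; move: (w) (z) => t [p q].
  by apply/rowP => j; rewrite !mxE; case: (t 0 j).
have yM : y *m M = a *: y + b *: x.
  rewrite -yE wM /x /y /a /b; move: (w) (z) => t [p q].
  by apply/rowP => j; rewrite !mxE; case: (t 0 j).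
have xy0 : (x != 0) || (y != 0).
  rewrite -negb_and; apply: contra w0; rewrite /x /y; move: (w) => t.
  move=> /andP[/eqP/rowP x0 /eqP/rowP y0].
  apply/eqP/rowP => j; have := x0 j; have := y0 j; rewrite !mxE.
  by case: (t 0 j) => p q /= -> ->.
have b0 : b = 0.
  have e1 : x *m M *m y^T = x *m (y *m M)^T by rewrite trmx_mul Ms mulmxA.
  have yMT : (y *m M)^T = a *: y^T + b *: x^T by rewrite yM; apply/matrixP => i j; rewrite !mxE.
  move: e1; rewrite xM yMT mulmxBl mulmxDr -!scalemxAl -!scalemxAr !sqnormE.
  move=> /matrixP/(_ 0 0); rewrite !mxE !eqxx !mulr1n => e1.
  have /eqP : b * (sqnorm x + sqnorm y) = 0.
    by rewrite mulrDr; apply/eqP; rewrite addr_eq0 -(addrI _ e1).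
  rewrite mulf_eq0 => /orP[/eqP//|].
  by rewrite paddr_eq0 ?sqnorm_ge0// !sqnorm_eq0 -[_ && _]negbK negb_and xy0.
have xW : (x <= W)%MS by rewrite /x xE submxMl.
have yW : (y <= W)%MS by rewrite /y yE submxMl.
case/orP: xy0 => [x0|y0]; [exists a, x|exists a, y]; split => //.
  by rewrite xM b0 scale0r subr0.
by rewrite yM b0 scale0r addr0.
Qed.

(** Take a nonzero [F]-invariant subspace of least dimension. Its intersection with an eigenspace of
    X in [F] is again invariant, by commutation, so each X acts on it as a scalar. *)
Lemma common_eigenvector n (F : set 'M[L]_n) : (0 < n)%N ->
  (forall X, F X -> X^T = X) -> (forall X Y, F X -> F Y -> X *m Y = Y *m X) ->
  exists2 x : 'rV[L]_n, x != 0 & forall X, F X -> exists a, x *m X = a *: x.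
Proof.
move=> n0 Fs Fc.
pose P r := `[< exists W : 'M[L]_n, [/\ \rank W = r, (0 < r)%N &
   forall X, F X -> (W *m X <= W)%MS] >].
have exP : exists r, P r.
  exists n; apply/asboolP; exists 1%:M; split; rewrite ?mxrank1// => X _.
  by rewrite submx1.
case: (ex_minnP exP) => r /asboolP[W [Wr r0 WF]] rmin.
pose W' := row_base W; have W'f : row_free W' := row_base_free W.
have FW X : F X -> exists a, (W <= eigenspace X a)%MS.
  move=> FX.
  have W'X : (W' *m X <= W')%MS.
    by rewrite (eqmxMr _ (eq_row_base W)) eq_row_base; exact: WF.
  have [|a [x [x0 xW xX]]] := symmetric_eigenvector (Fs _ FX) W'f _ W'X.
    by rewrite Wr.
  exists a; rewrite eq_row_base in xW.
  pose V := (W :&: eigenspace X a)%MS.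
  have V0 : (0 < \rank V)%N.
    rewrite lt0n mxrank_eq0; apply: contra x0 => /eqP V0.
    by rewrite -submx0 -V0 sub_capmx xW; apply/eigenspaceP.
  have /rmin rV : P (\rank V).
    apply/asboolP; exists V; split=> // Y FY.
    rewrite sub_capmx (submx_trans (submxMr _ (capmxSl _ _)))/=; last exact: WF.
    apply/eigenspaceP; rewrite -mulmxA -(Fc X Y)// mulmxA scalemxAl; congr (_ *m _).
    by apply/eigenspaceP; exact: capmxSr.
  have := mxrank_leqif_sup (capmxSl W (eigenspace X a)); rewrite -/V => -[_].
  rewrite Wr eqn_leq rV andbT -Wr mxrankS ?capmxSl// => /esym WV.
  by rewrite (submx_trans WV) ?capmxSr.
have W0 : W != 0 by rewrite -mxrank_eq0 -lt0n Wr.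
have [i Wi] : exists i, row i W != 0.
  apply/existsP; apply: contraR W0; rewrite negb_exists => /forallP rW.
  apply/eqP/row_matrixP => i; rewrite row0; apply/eqP.
  by have := rW i; rewrite negbK.
exists (row i W) => // X /FW[a Wa]; exists a; apply/eigenspaceP.
by rewrite (submx_trans (row_sub _ _)).
Qed.

(* Householder reflection *)
Lemma orthogonal_first_row n (x : 'rV[L]_n.+1) : x != 0 ->
  exists u : 'M[L]_n.+1, exists c, [/\ u *m u^T = 1%:M, c != 0 & row 0 u = c *: x].
Proof.
move=> x0; pose c := Num.sqrt (sqnorm x).
have sx0 : 0 < sqnorm x by rewrite lt0r sqnorm_eq0 x0 sqnorm_ge0.
have c0 : c != 0 by rewrite sqrtr_eq0 -ltNge.
pose y := c^-1 *: x; pose e : 'rV[L]_n.+1 := delta_mx 0 0.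
have y1 : sqnorm y = 1.
  rewrite /sqnorm /y; under eq_bigr do rewrite mxE exprMn.
  rewrite -mulr_sumr -/(sqnorm x) -[sqnorm x]sqr_sqrtr ?sqnorm_ge0// -/c.
  by rewrite exprVn mulVf// expf_neq0.
have rowe (u : 'M[L]_n.+1) : row 0 u = e *m u by rewrite rowE.
have [ye|ye] := eqVneq y e.
  exists 1%:M, c^-1; split; rewrite ?trmx1 ?mulmx1 ?invr_eq0//.
  by rewrite rowe mulmx1 -ye.
have [v vE] : exists v, v = y - e by eexists.
pose q := sqnorm v.
have q0 : q != 0 by rewrite sqnorm_eq0 vE subr_eq0.
pose u := 1%:M - (2 / q) *: (v^T *m v).
have us : u^T = u by rewrite /u linearB/= linearZ/= trmx_mul trmxK trmx1.
have qE : q = 2 * (1 - y 0 0).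
  have ee : e *m e^T = 1%:M.
    by apply/matrixP => i j; rewrite trmx_delta mul_delta_mx !ord1 !mxE.
  have ey : e *m y^T = (y 0 0)%:M.
    by apply/matrixP => i j; rewrite -rowE !ord1 !mxE eqxx mulr1n.
  have : v *m v^T = (q)%:M by rewrite sqnormE.
  rewrite {1 2}vE linearB/= mulmxBl !mulmxBr sqnormE y1 ee ey.
  rewrite -[y *m e^T]trmxK trmx_mul trmxK ey tr_scalar_mx => /matrixP/(_ 0 0).
  by rewrite !mxE eqxx !mulr1n => <-; ring.
exists u, c^-1; split; rewrite ?invr_eq0//.
  rewrite us /u mulmxBl mul1mx mulmxBr mulmx1 -scalemxAl -scalemxAr scalerA.
  rewrite -mulmxA (mulmxA v) sqnormE -/q mul_scalar_mx -scalemxAr scalerA.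
  have -> : 2 / q * (2 / q) * q = 2 * (2 / q) by field.
  by move: (v^T *m v) => P; apply/matrixP => i j; rewrite !mxE; ring.
rewrite rowe /u mulmxBr mulmx1 -scalemxAr mulmxA.
have -> : e *m v^T = (y 0 0 - 1)%:M.
  by apply/matrixP => i j; rewrite -rowE vE !ord1 !mxE !eqxx mulr1n.
rewrite mul_scalar_mx scalerA.
have y01 : 1 - y 0 0 != 0 by apply: contra q0 => /eqP y01; rewrite qE y01 mulr0.
have -> : 2 / q * (y 0 0 - 1) = -1 by rewrite qE; field.
by rewrite scaleN1r opprK vE addrC subrK.
Qed.

(** Induction on n: a common eigenvector becomes the first vector of an orthonormal basis, and
    symmetry makes every member of [F] block diagonal there. [F] may be infinite. *)
Theorem simultaneous_diag n (F : set 'M[L]_n) :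
  (forall X, F X -> X^T = X) -> (forall X Y, F X -> F Y -> X *m Y = Y *m X) ->
  exists2 u : 'M[L]_n, u *m u^T = 1%:M & forall X, F X -> is_diag_mx (u *m X *m u^T).
Proof.
elim: n F => [|n IH] F Fs Fc.
  by exists 1%:M => [|X _]; [rewrite trmx1 mulmx1|apply/is_diag_mxP => -[]].
have [x x0 xF] := common_eigenvector (ltn0Sn n) Fs Fc.
have [u [c [uu c0 ux]]] := orthogonal_first_row x0.
have u'u : u^T *m u = 1%:M by exact: mulmx1C.
pose cj (X : 'M[L]_(1 + n)) : 'M[L]_(1 + n) := u *m X *m u^T.
have cjs X : F X -> (cj X)^T = cj X.
  by move=> FX; rewrite /cj !trmx_mul trmxK (Fs _ FX) mulmxA.
have cjM X Y : cj X *m cj Y = cj (X *m Y).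
  by rewrite /cj !mulmxA -(mulmxA _ u^T u) u'u mulmx1.
have cjblock X : F X -> exists a, cj X = block_mx a%:M 0 0 (drsubmx (cj X)).
  move=> FX; have [a xX] := xF _ FX; exists a.
  have r0 : row 0 (cj X) = a *: delta_mx 0 0.
    rewrite /cj !row_mul ux -scalemxAl xX scalerA mulrC -scalerA -ux.
    rewrite -scalemxAl -row_mul uu; congr (_ *: _).
    by apply/rowP => j; rewrite !mxE eqxx eq_sym.
  have e0 j : cj X 0 j = a *+ (j == 0).
    by have /rowP/(_ j) := r0; rewrite !mxE eqxx/= mulr_natr.
  move: {r0} (cj X) e0 (cjs _ FX) => Y e0 Ys.
  have l0 : lshift n (0 : 'I_1) = 0 by exact: val_inj.
  rewrite -[LHS]submxK; congr block_mx; apply/matrixP => i j; rewrite !ord1.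
  - by rewrite !mxE l0 e0 !eqxx.
  - by rewrite !mxE l0 e0.
  - by rewrite -{1}Ys !mxE l0 e0.
pose F' : set 'M[L]_n := [set drsubmx (cj X) | X in F].
have F's Y : F' Y -> Y^T = Y.
  by move=> [X FX <-]; rewrite trmx_drsub cjs.
have F'c X Y : F' X -> F' Y -> X *m Y = Y *m X.
  move=> [A FA <-] [B FB <-]; have := congr1 cj (Fc _ _ FA FB); rewrite -!cjM.
  have [a ->] := cjblock _ FA; have [b ->] := cjblock _ FB.
  by rewrite !mulmx_block !(mul0mx, mulmx0, addr0, add0r) !block_mxKdr => /eq_block_mx[].
have [v vv vF] := IH F' F's F'c.
pose w : 'M[L]_(1 + n) := block_mx 1%:M 0 0 v.
have wT : w^T = block_mx 1%:M 0 0 v^T by rewrite tr_block_mx trmx1 !trmx0.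
have ww : w *m w^T = 1%:M.
  by rewrite wT mulmx_block !(mul0mx, mulmx0, addr0, add0r, mulmx1) vv -scalar_mx_block.
exists (w *m u); first by rewrite trmx_mul mulmxA -(mulmxA w) uu mulmx1.
move=> X FX; rewrite trmx_mul.
have -> : w *m u *m X *m (u^T *m w^T) = w *m cj X *m w^T by rewrite /cj !mulmxA.
have [a ->] := cjblock _ FX; rewrite wT !mulmx_block.
rewrite !(mul0mx, mulmx0, addr0, add0r, mulmx1, mul1mx).
apply: (etrans (is_diag_block_mx _ _ _ _ (erefl 1%N))).
by rewrite !eqxx scalar_mx_is_diag/=; apply: vF; exists X.
Qed.

End Spectral.

(** * First and second variations along one-parameter groups *)

Section Perturbation.
Variables (R : realType) (n : nat).
Implicit Types X Y Z P H : 'M[R]_n.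

Lemma le0_of_le_linear (x D : R) : (forall s, 0 < s <= 1 -> x <= D * s) -> x <= 0.
Proof.
move=> xD; rewrite leNgt; apply/negP => x0.
have D1 : 0 < `|D| + 1 by rewrite ltr_wpDl.
pose s := Num.min 1 (x / (2 * (`|D| + 1))).
have s0 : 0 < s by rewrite lt_min ltr01 divr_gt0// mulr_gt0.
have xDs : x <= D * s by apply: xD; rewrite s0 ge_min lexx.
have sx : 2 * ((`|D| + 1) * s) <= x.
  by rewrite mulrA mulrC -ler_pdivlMr ?mulr_gt0// ge_min lexx orbT.
have : D * s <= (`|D| + 1) * s by rewrite ler_wpM2r ?(ltW s0)// (le_trans (ler_norm _))// lerDl.
lra.
Qed.

(** Small s and -s together force the linear coefficient to vanish; division by s^2 then gives the
    sign of the quadratic one. *)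
Lemma second_order_max (c1 c2 C : R) :
  (forall s, `|s| <= 1 -> c1 * s + c2 * s ^+ 2 <= C * `|s| ^+ 3) -> c1 = 0 /\ c2 <= 0.
Proof.
move=> H; have half (c : R) : (forall s, 0 < s <= 1 -> c * s + c2 * s ^+ 2 <= C * s ^+ 3) -> c <= 0.
  move=> Hc; apply: (@le0_of_le_linear _ (`|c2| + `|C|)) => s s01.
  have [s0 s1] := andP s01; have := Hc _ s01.
  have -> : c * s + c2 * s ^+ 2 = (c + c2 * s) * s by ring.
  have -> : C * s ^+ 3 = (C * s ^+ 2) * s by ring.
  rewrite ler_pM2r// => le1.
  have le2 : C * s ^+ 2 <= `|C| * s.
    apply: (@le_trans _ _ (`|C| * s ^+ 2)); first by rewrite ler_wpM2r ?sqr_ge0// ler_norm.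
    by rewrite ler_wpM2l// expr2 ler_piMr// ltW.
  have le3 : - (c2 * s) <= `|c2| * s by rewrite -mulNr ler_wpM2r ?(ltW s0)// -normrN ler_norm.
  by lra.
have c10 : c1 = 0.
  apply/eqP; rewrite eq_le; apply/andP; split.
    by apply: half => s /andP[s0 s1]; have := H s; rewrite gtr0_norm//; apply.
  rewrite -oppr_le0; apply: half => s /andP[s0 s1]; have := H (- s).
  rewrite normrN gtr0_norm// => /(_ s1); rewrite sqrrN; apply: le_trans.
  by rewrite lerD2r mulrN mulNr.
split=> //; apply: (@le0_of_le_linear _ C) => s /andP[s0 s1]; have := H s.
rewrite gtr0_norm// c10 mul0r add0r => /(_ s1).
by have -> : C * s ^+ 3 = C * s * s ^+ 2; [ring|rewrite ler_pM2r// exprn_gt0].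
Qed.

Lemma norm_mxtrace X : `|\tr X| <= nrm X.
Proof.
apply: le_trans (ler_norm_sum _ _ _) _; apply: ler_sum => i _.
by rewrite (bigD1 i)//= lerDl sumr_ge0.
Qed.

Lemma mxexp_scale_rem2 X : exists2 C, 0 <= C & forall s, `|s| <= 1 ->
  nrm (mxexp (s *: X) - (1%:M + s *: X + (2^-1 * s ^+ 2) *: (X *m X))) <= C * `|s| ^+ 3.
Proof.
exists (nrm X ^+ 3 * expR (nrm X)).
  by rewrite mulr_ge0 ?exprn_ge0 ?expR_ge0 ?nrm_ge0.
move=> s s1; have := mxexp_rem2 (s *: X).
rewrite -scalemxAl -scalemxAr !scalerA -mulrA -expr2 => /le_trans; apply.
rewrite nrmZ exprMn [_ ^+ 3 * _]mulrC -[leLHS]mulrA -[leRHS]mulrA.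
rewrite ler_wpM2l ?exprn_ge0 ?nrm_ge0// [leRHS]mulrC ler_wpM2l ?exprn_ge0//.
by rewrite ler_expR ler_piMl ?nrm_ge0.
Qed.

Lemma nrm_mxexp_scale_norm X : exists2 C, 0 <= C &
  forall s, `|s| <= 1 -> nrm (mxexp (s *: X)) <= C.
Proof.
have [C C0 CP] := nrm_mxexp_scale X; have [D D0 DP] := nrm_mxexp_scale (- X).
exists (C + D); first by rewrite addr_ge0.
move=> s s1; have [s0|s0] := leP 0 s.
  by apply: le_trans (CP s _) _; rewrite ?s0 ?lerDl//; move: s1; rewrite ger0_norm.
rewrite -[s]opprK scaleNr -scalerN; apply: le_trans (DP (- s) _) _; rewrite ?lerDr//.
by move: s1; rewrite ltr0_norm// => ->; rewrite oppr_ge0 ltW.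
Qed.

(** Since Z is antisymmetric, the transpose of exp(sZ) is exp(-sZ), and the expansion is that of the
    adjoint action: H + s[Z,H] + s^2 [Z,[Z,H]]/2. *)
Lemma conj_expansion Z H P : Z^T = - Z -> exists C, forall s, `|s| <= 1 ->
  `|\tr (mxexp (s *: Z) *m H *m (mxexp (s *: Z))^T *m P) -
    (\tr (H *m P) + \tr (bracket Z H *m P) * s +
     2^-1 * \tr (bracket Z (bracket Z H) *m P) * s ^+ 2)| <= C * `|s| ^+ 3.
Proof.
move=> Za; have [C C0 CP] := mxexp_scale_rem2 Z.
have [M M0 MP] := nrm_mxexp_scale_norm Z.
pose B := Z *m H *m (Z *m Z) - Z *m Z *m H *m Z.
pose B' := Z *m Z *m H *m (Z *m Z).
pose N := nrm (1%:M : 'M[R]_n) + nrm Z + nrm (Z *m Z).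
have N0 : 0 <= N by rewrite !addr_ge0 ?nrm_ge0.
exists ((C * nrm H * M + N * nrm H * C + nrm B + nrm B') * nrm P) => s s1.
set E := mxexp (s *: Z); pose T := 1%:M + s *: Z + (2^-1 * s ^+ 2) *: (Z *m Z).
pose T' := 1%:M - s *: Z + (2^-1 * s ^+ 2) *: (Z *m Z).
have TT : T^T = T'.
  rewrite /T /T' !linearD/= trmx1 !linearZ/= trmx_mul Za mulmxN mulNmx opprK.
  by rewrite scalerN.
pose r := E - T; have rC : nrm r <= C * `|s| ^+ 3 by exact: CP.
have EE : E *m H *m E^T = H + s *: bracket Z H + (2^-1 * s ^+ 2) *: bracket Z (bracket Z H)
   + ((2^-1 * s ^+ 3) *: B + (4^-1 * s ^+ 4) *: B' + (r *m H *m E^T + T *m H *m r^T)).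
  have -> : E *m H *m E^T = T *m H *m T' + (r *m H *m E^T + T *m H *m r^T).
    rewrite -TT /r linearB/= !(mulmxBl, mulmxBr).
    move: (E *m H *m E^T) (T *m H *m E^T) (T *m H *m T^T) => a b c.
    by apply/matrixP => i j; rewrite !mxE; ring.
  rewrite [RHS]addrA; congr (_ + _); rewrite /T /T' /B /B' /bracket.
  rewrite !(mulmxBl, mulmxBr, mulmxDl, mulmxDr, mul1mx, mulmx1, mulmxN, mulNmx,
    =^~ scalemxAl, =^~ scalemxAr, scalerDr, scalerBr, scalerN, scalerA, mulmxA).
  move: (Z *m H) (Z *m H *m Z) (Z *m Z *m H) (H *m Z *m Z) (Z *m H *m Z *m Z)
    (Z *m Z *m H *m Z) (Z *m Z *m H *m Z *m Z) (H *m Z) => a b c d e f g h.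
  by apply/matrixP => i j; rewrite !mxE; field.
have lin (a b c d e f g : 'M[R]_n) (x y z w : R) :
    \tr ((a + x *: b + y *: c + (z *: d + w *: e + (f + g))) *m P) =
    \tr (a *m P) + x * \tr (b *m P) + y * \tr (c *m P) +
    (z * \tr (d *m P) + w * \tr (e *m P) + (\tr (f *m P) + \tr (g *m P))).
  by rewrite !mulmxDl !mxtraceD -!scalemxAl !mxtraceZ.
rewrite EE lin; set t0 := \tr (H *m P).
set t1 := \tr (bracket Z H *m P); set t2 := \tr (bracket Z (bracket Z H) *m P).
rewrite (_ : forall w, t0 + s * t1 + 2^-1 * s ^+ 2 * t2 + w -
  (t0 + t1 * s + 2^-1 * t2 * s ^+ 2) = w); last by move=> w; ring.
have trle Y : `|\tr (Y *m P)| <= nrm Y * nrm P.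
  by apply: le_trans (norm_mxtrace _) (nrmM _ _).
have s0 := normr_ge0 s.
have s34 : `|s| ^+ 4 <= `|s| ^+ 3 by rewrite exprS ler_piMl ?exprn_ge0.
have s30 : 0 <= `|s| ^+ 3 by rewrite exprn_ge0.
have TN : nrm T <= N.
  apply: le_trans (nrmD _ _) _; apply: lerD.
    by apply: le_trans (nrmD _ _) _; rewrite lerD2l nrmZ ler_piMl ?nrm_ge0.
  rewrite nrmZ ler_piMl ?nrm_ge0// normrM normrX ger0_norm ?invr_ge0//.
  by rewrite mulr_ile1 ?invr_ge0 ?exprn_ge0 ?exprn_ile1// invf_le1 ?ler1n.
apply: le_trans (ler_normD _ _) _.
apply: le_trans (lerD (ler_normD _ _) (ler_normD _ _)) _.
have b1 : `|2^-1 * s ^+ 3 * \tr (B *m P)| <= nrm B * nrm P * `|s| ^+ 3.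
  rewrite 2!normrM normrX [`|2^-1|]ger0_norm ?invr_ge0// mulrC.
  apply: (ler_pM _ _ (trle B)); rewrite ?normr_ge0 ?mulr_ge0//.
  by rewrite ler_piMl// invf_le1// ler1n.
have b2 : `|4^-1 * s ^+ 4 * \tr (B' *m P)| <= nrm B' * nrm P * `|s| ^+ 3.
  rewrite 2!normrM normrX [`|4^-1|]ger0_norm ?invr_ge0// mulrC.
  apply: (ler_pM _ _ (trle B')); rewrite ?normr_ge0 ?mulr_ge0 ?exprn_ge0//.
  by apply: le_trans s34; rewrite ler_piMl ?exprn_ge0// invf_le1// ler1n.
have b3 : `|\tr (r *m H *m E^T *m P)| <= C * nrm H * M * nrm P * `|s| ^+ 3.
  apply: le_trans (trle _) _; rewrite mulrAC ler_wpM2r ?nrm_ge0//.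
  apply: le_trans (nrmM _ _) _; rewrite mulrAC; apply: ler_pM; rewrite ?nrm_ge0 ?nrm_trmx ?MP//.
  by apply: le_trans (nrmM _ _) _; rewrite mulrAC ler_wpM2r ?nrm_ge0.
have b4 : `|\tr (T *m H *m r^T *m P)| <= N * nrm H * C * nrm P * `|s| ^+ 3.
  apply: le_trans (trle _) _; rewrite mulrAC ler_wpM2r ?nrm_ge0//.
  apply: le_trans (nrmM _ _) _; rewrite -[leRHS]mulrA; apply: ler_pM; rewrite ?nrm_ge0 ?nrm_trmx//.
  by apply: le_trans (nrmM _ _) _; rewrite ler_wpM2r ?nrm_ge0.
lra.
Qed.

Lemma orthogonal_bounded X : X *m X^T = 1%:M -> nrm X <= (n * n)%:R.
Proof.
move=> XX; rewrite natrM /nrm; apply: (@le_trans _ _ (\sum_(i < n) \sum_(j < n) 1)).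
  apply: ler_sum => i _; apply: ler_sum => j _.
  rewrite -(@expr_le1 _ 2)// real_normK ?num_real//.
  have <- : (X *m X^T) i i = 1 by rewrite XX mxE eqxx.
  rewrite mxE.
  rewrite (bigD1 j)//= mxE -expr2 lerDl sumr_ge0// => k _.
  by rewrite mxE -expr2 sqr_ge0.
by rewrite !sumr_const !card_ord mulr_natr.
Qed.

Lemma closed_orthogonal : closed [set X : 'M[R]_n | X *m X^T = 1%:M].
Proof.
have cE : closed [set X : 'M[R]_n | forall ij : 'I_n * 'I_n,
    (X *m X^T) ij.1 ij.2 = (1%:M : 'M[R]_n) ij.1 ij.2].
  apply: closed_forall => ij; apply: (closed_level (f := fun X : 'M[R]_n => (X *m X^T) ij.1 ij.2)).
  apply: continuous_mulmx => [i j|i j]; first exact: coord_continuous.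
  by apply: continuous_trmx => k l; exact: coord_continuous.
rewrite [X in closed X](_ : _ = [set X : 'M[R]_n | forall ij : 'I_n * 'I_n,
    (X *m X^T) ij.1 ij.2 = (1%:M : 'M[R]_n) ij.1 ij.2])//.
apply/seteqP; split=> X /= XX; first by move=> ij; rewrite XX.
by apply/matrixP => i j; exact: (XX (i, j)).
Qed.

(* The first and second variation of k |-> tr (k X k^T P) at a maximum *)
Lemma conj_max (K : set 'M[R]_n) X P : closed K ->
  (forall k, K k -> k *m k^T = 1%:M) -> K 1%:M ->
  (forall k m, K k -> K m -> K (k *m m)) ->
  exists2 k, K k & let H := k *m X *m k^T in
    (forall m, K m -> \tr (m *m X *m m^T *m P) <= \tr (H *m P)) /\
    forall Z, Z^T = - Z -> (forall t, K (mxexp (t *: Z))) ->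
      \tr (bracket Z H *m P) = 0 /\ \tr (bracket Z (bracket Z H) *m P) <= 0.
Proof.
move=> Kc Ko K1 KM.
have cf : continuous (fun k : 'M[R]_n => \tr (k *m X *m k^T *m P)).
  apply: continuous_sum_fun => i; apply: continuous_mulmx => [{}i j|{}i j].
    apply: continuous_mulmx => [{}i {}j|{}i {}j].
      apply: continuous_mulmx => [{}i {}j|{}i {}j]; first exact: coord_continuous.
      exact: continuous_cst_fun.
    by apply: continuous_trmx => k l; exact: coord_continuous.
  exact: continuous_cst_fun.
have [||k Kk kmax] := compact_max_mx (b := (n * n)%:R) Kc _ _ cf.
- by move=> Y /Ko; exact: orthogonal_bounded.
- by exists 1%:M.
exists k => //; set H := _ *m k^T; split=> // Z Za KZ.
have [C CP] := conj_expansion H P Za.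
suff [-> c2] : \tr (bracket Z H *m P) = 0 /\ 2^-1 * \tr (bracket Z (bracket Z H) *m P) <= 0.
  by split=> //; rewrite -(pmulr_rle0 _ (_ : 0 < 2^-1 :> R)) ?invr_gt0.
apply: (@second_order_max _ _ C) => s s1.
have := CP s s1; rewrite ler_norml => /andP[+ _].
have := kmax _ (KM _ _ (KZ s) Kk).
rewrite trmx_mul !mulmxA -/H.
have -> : mxexp (s *: Z) *m k *m X *m k^T *m (mxexp (s *: Z))^T =
    mxexp (s *: Z) *m H *m (mxexp (s *: Z))^T by rewrite /H !mulmxA.
lra.
Qed.

(** Differentiation at t = 0 of a linear identity valid along exp(tX). Symmetry, commutation and
    diagonality pass from A to its Lie algebra in this way. *)
Lemma mxexp_linear_vanish (F : 'M[R]_n -> 'M[R]_n) M X :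
  (forall Y Z, F (Y + Z) = F Y + F Z) -> (forall c Y, F (c *: Y) = c *: F Y) ->
  0 <= M -> (forall Y, nrm (F Y) <= M * nrm Y) -> F 1%:M = 0 ->
  (forall t, F (mxexp (t *: X)) = 0) -> F X = 0.
Proof.
move=> FD FZ M0 FM F1 FE; apply: nrm_eq0; apply/eqP; rewrite eq_le nrm_ge0 andbT.
have [C C0 CP] := mxexp_scale_rem1 X.
apply: (@le0_of_le_linear _ (M * C)) => s /andP[s0 s1].
rewrite -(ler_pM2l s0).
have FXE : F (mxexp (s *: X) - (1%:M + s *: X)) = - (s *: F X).
  by rewrite -scaleN1r !FD FZ FD FE F1 FZ !add0r scaleN1r.
have -> : s * nrm (F X) = nrm (F (mxexp (s *: X) - (1%:M + s *: X))).
  by rewrite FXE nrmN nrmZ gtr0_norm.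
apply: le_trans (FM _) _; apply: (@le_trans _ _ (M * (C * s ^+ 2))).
  by apply: ler_wpM2l => //; apply: CP; rewrite s1 ltW.
by rewrite expr2 [leRHS]mulrC !mulrA lexx.
Qed.

End Perturbation.

(** * Cartan decomposition and Kostant's inequality *)

Lemma interpolation (F : fieldType) (s : seq F) (w : F -> F) :
  exists q : {poly F}, {in s, forall x, q.[x] = w x}.
Proof.
elim: s => [|x s [q qP]]; first by exists 0.
have [xs|xs] := boolP (x \in s).
  by exists q => y; rewrite inE => /orP[/eqP->|]; exact: qP.
pose p := \prod_(y <- s) ('X - y%:P).
have px : p.[x] != 0 by rewrite -/(root p x) root_prod_XsubC.
exists (q + ((w x - q.[x]) / p.[x]) *: p) => y; rewrite inE hornerD hornerZ => /orP[/eqP->|ys].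
  by rewrite divfK// addrC subrK.
have /eqP-> : p.[y] == 0 by rewrite -/(root p y) root_prod_XsubC.
by rewrite mulr0 addr0 qP.
Qed.

(** * Cartan and Iwasawa decompositions over the reals *)

Section SymmetricSpace.
Variables (R : realType) (n : nat) (G A : set 'M[R]_n) (a : {vspace 'M[R]_n}).
Implicit Types X Y Z P H V : 'M[R]_n.
Hypothesis Gcl : closed G.
Hypothesis Ggrp : matrix_group G.
Hypothesis Gtr : forall g, G g -> G g^T.
Hypothesis Gdet : forall g, G g -> \det g = 1.
Hypothesis Gpow : forall X, X^T = X -> (forall m : nat, G (mxexp (m%:R *: X))) -> Lie G X.
Hypothesis AG : A `<=` G.
Hypothesis Asym : forall x, A x -> x^T = x.
Hypothesis Acomm : forall x y, A x -> A y -> x *m y = y *m x.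
Hypothesis aP : forall X, X \in a <-> Lie A X.
Hypothesis Aexp : forall x, A x -> exists2 X, X \in a & x = mxexp X.
Hypothesis Amax : forall q, G q -> q^T = q -> (forall x, A x -> q *m x = x *m q) ->
  A (q *m q).

Definition KG : set 'M[R]_n := [set k | G k /\ k *m k^T = 1%:M].
Definition pG X : Prop := Lie G X /\ X^T = X.

Lemma KG_orth k : KG k -> k *m k^T = 1%:M. Proof. by case. Qed.
Lemma KG_orth' k : KG k -> k^T *m k = 1%:M. Proof. by move=> [_ /mulmx1C]. Qed.
Lemma KG1 : KG 1%:M.
Proof. by split; rewrite ?trmx1 ?mulmx1//; exact: matrix_group1 Ggrp. Qed.
Lemma KGM k m : KG k -> KG m -> KG (k *m m).
Proof.
move=> [Gk kk] [Gm mm]; split; first exact: matrix_groupM Ggrp _ _ Gk Gm.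
by rewrite trmx_mul mulmxA -(mulmxA k) mm mulmx1.
Qed.
Lemma KGT k : KG k -> KG k^T.
Proof. by move=> [Gk /mulmx1C kk]; split; rewrite ?trmxK//; exact: Gtr. Qed.
Lemma KG_inv k : KG k -> invmx k = k^T.
Proof.
move=> [Gk kk]; have uk := matrix_group_unit Ggrp Gk.
by rewrite -[k^T](mulKmx uk) kk mulmx1.
Qed.
Lemma closed_KG : closed KG.
Proof. exact: closedI Gcl (@closed_orthogonal R n). Qed.

Lemma pG_conj k X : KG k -> pG X -> pG (k *m X *m k^T).
Proof.
move=> Kk [GX Xs]; split; last by rewrite !trmx_mul trmxK Xs mulmxA.
by rewrite -(KG_inv Kk); apply: Lie_conj => //; case: Kk.
Qed.

Lemma a_sym X : X \in a -> X^T = X.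
Proof.
move=> /aP AX; apply/eqP; rewrite -subr_eq0; apply/eqP.
apply: (@mxexp_linear_vanish _ _ (fun Y => Y^T - Y) 2) => //=.
- by move=> Y Z; rewrite linearD opprD addrACA.
- by move=> c Y; rewrite linearZ/= scalerBr.
- by move=> Y; apply: le_trans (nrmD _ _) _; rewrite nrmN nrm_trmx mulr_natl mulr2n.
- by rewrite trmx1 subrr.
- by move=> t; rewrite (Asym (AX t)) subrr.
Qed.

Lemma comm_of_exp X Y : (forall t, mxexp (t *: X) *m Y = Y *m mxexp (t *: X)) ->
  X *m Y = Y *m X.
Proof.
move=> XY; apply/eqP; rewrite -subr_eq0; apply/eqP.
apply: (@mxexp_linear_vanish _ _ (fun Z => Z *m Y - Y *m Z) (2 * nrm Y)) => //=.
- by move=> Z W; rewrite mulmxDl mulmxDr opprD addrACA.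
- by move=> c Z; rewrite -scalemxAl -scalemxAr scalerBr.
- by rewrite mulr_ge0 ?nrm_ge0.
- move=> Z; apply: le_trans (nrmD _ _) _; rewrite nrmN -mulrA mulr_natl mulr2n.
  by apply: lerD; apply: le_trans (nrmM _ _) _ => //; rewrite mulrC.
- by rewrite mul1mx mulmx1 subrr.
- by move=> t; rewrite XY subrr.
Qed.

Lemma a_comm X Y : X \in a -> Y \in a -> X *m Y = Y *m X.
Proof.
move=> /aP AX /aP AY; apply: comm_of_exp => t.
by apply/esym/comm_of_exp => s; exact: Acomm.
Qed.

Lemma a_pG X : X \in a -> pG X.
Proof. by move=> aX; split; [move=> t; apply: AG; move: t; exact/aP|exact: a_sym]. Qed.

Lemma mxexp_sym X : X^T = X -> (mxexp X)^T = mxexp X.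
Proof. by rewrite -mxexp_tr => ->. Qed.

(** [Amax] speaks of squares only, so it is applied to exp(tY/2), whose square is exp(tY). *)
Lemma a_max Y : pG Y -> (forall X, X \in a -> X *m Y = Y *m X) -> Y \in a.
Proof.
move=> [GY Ys] Yc; apply/aP => t.
have -> : t *: Y = (t / 2) *: Y + (t / 2) *: Y by rewrite -scalerDl -splitr.
rewrite mxexpD//; apply: Amax; first exact: GY.
  by apply: mxexp_sym; rewrite linearZ/= Ys.
move=> x /Aexp[X aX ->]; apply: mxexp_comm; apply/esym/mxexp_comm.
by rewrite -scalemxAl -scalemxAr Yc.
Qed.

Lemma Lie_orth_exp Z t : Z^T = - Z -> mxexp (t *: Z) *m (mxexp (t *: Z))^T = 1%:M.
Proof. by move=> Za; rewrite -mxexp_tr linearZ/= Za scalerN mxexpN. Qed.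

Lemma bracket_antisym X Y : X^T = X -> Y^T = Y -> (bracket X Y)^T = - bracket X Y.
Proof. by move=> Xs Ys; rewrite /bracket linearB/= !trmx_mul Xs Ys opprB. Qed.

Lemma tr_antisym_sq Z : Z^T = - Z -> \tr (Z *m Z) = 0 -> Z = 0.
Proof.
move=> Za Z0; have : \tr (Z *m Z^T) = 0 by rewrite Za mulmxN linearN/= Z0 oppr0.
rewrite /mxtrace => /eqP; rewrite psumr_eq0 => [/allP ZZ|i _]; last first.
  by rewrite mxE sumr_ge0// => k _; rewrite mxE -expr2 sqr_ge0.
apply/matrixP => i j; rewrite mxE; have /= := ZZ i (mem_index_enum i).
rewrite mxE psumr_eq0 => [/allP/(_ j (mem_index_enum j))/=|k _]; last first.
  by rewrite mxE -expr2 sqr_ge0.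
by rewrite mxE -expr2 sqrf_eq0 => /eqP.
Qed.

Lemma tr_bracket X Y Z : \tr (bracket X Y *m Z) = \tr (X *m bracket Y Z).
Proof.
rewrite /bracket mulmxBl mulmxBr !linearB/= -!mulmxA; congr (_ - _).
by rewrite mxtrace_mulC -mulmxA.
Qed.

(* K' is KG or the centralizer in KG of an element of a *)
Lemma conj_commute (K' : set 'M[R]_n) X P : closed K' -> K' `<=` KG -> K' 1%:M ->
  (forall k m, K' k -> K' m -> K' (k *m m)) ->
  pG X -> pG P ->
  (forall k Z, K' k -> Z = bracket (k *m X *m k^T) P -> forall t, K' (mxexp (t *: Z))) ->
  exists2 k, K' k & let H := k *m X *m k^T in
    [/\ H *m P = P *m H,
        forall m, K' m -> \tr (m *m X *m m^T *m P) <= \tr (H *m P) &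
        forall Z, Z^T = - Z -> (forall t, K' (mxexp (t *: Z))) ->
          \tr (bracket Z (bracket Z H) *m P) <= 0].
Proof.
move=> K'c K'K K'1 K'M pX pP K'Z.
have [k Kk [kmax kvar]] := conj_max X P K'c (fun k K'k => KG_orth (K'K k K'k)) K'1 K'M.
exists k => //=; set H := k *m X *m k^T.
have pH : pG H by apply: pG_conj => //; exact: K'K.
split=> //; last by move=> Z Za /(kvar Z Za)[].
have Ha : (bracket H P)^T = - bracket H P by apply: bracket_antisym; [case: pH|case: pP].
(* The variation is tested on Z = [H,P] itself: tr([Z,H]P) = tr(Z[H,P]) = tr(Z^2), and an
   antisymmetric Z with tr(Z^2) = 0 vanishes. *)
have [+ _] := kvar _ Ha (K'Z k _ Kk erefl).
rewrite tr_bracket -/H => /(tr_antisym_sq Ha)/eqP.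
by rewrite subr_eq0 => /eqP.
Qed.

Lemma exp_bracket_KG X P : pG X -> pG P -> forall t, KG (mxexp (t *: bracket X P)).
Proof.
move=> [GX Xs] [GP Ps] t; split; first by apply: Lie_bracket.
by apply: Lie_orth_exp; exact: bracket_antisym.
Qed.

(** Diagonalize q = g g^T, which is positive definite, and take half its logarithm. The natural
    powers of q lie in G, so [Gpow] puts the logarithm in the Lie algebra. *)
Lemma polar g : G g -> exists (v : 'M[R]_n) (y : 'rV[R]_n),
  [/\ v *m v^T = 1%:M, pG (v^T *m diag_mx y *m v) &
      g *m g^T = v^T *m diag_mx (map_mx (fun x => expR (2 * x)) y) *m v].
Proof.
move=> Gg; set q := g *m g^T.
have qs : q^T = q by rewrite /q trmx_mul trmxK.
have [||v vv vq] := @simultaneous_diag R n [set q]; [by move=> _ ->|by move=> _ _ -> ->|].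
have v'v := mulmx1C vv.
have /diag_mxP[d dE] : is_diag_mx (v *m q *m v^T) by exact: vq.
have qE : q = v^T *m diag_mx d *m v by rewrite -dE !mulmxA v'v mul1mx -mulmxA v'v mulmx1.
have d0 i : 0 < d 0 i.
  have -> : d 0 i = \sum_k (v *m g) i k ^+ 2.
    have -> : d 0 i = (v *m q *m v^T) i i by rewrite dE mxE eqxx mulr1n.
    have -> : v *m q *m v^T = (v *m g) *m (v *m g)^T by rewrite trmx_mul !mulmxA.
    by rewrite mxE; apply: eq_bigr => k _; rewrite [in X in _ * X]mxE expr2.
  rewrite lt0r sumr_ge0 ?andbT; last by move=> k _; rewrite sqr_ge0.
  rewrite psumr_eq0; last by move=> k _; rewrite sqr_ge0.
  apply/negP => /allP vg0; have gU := matrix_group_unit Ggrp Gg.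
  have : (v *m g) *m (invmx g *m v^T) = 1%:M by rewrite mulmxA mulmxK.
  move=> /matrixP/(_ i i)/eqP; rewrite !mxE eqxx big1 ?(eq_sym 0) ?oner_eq0// => k _.
  by have /= := vg0 k (mem_index_enum k); rewrite sqrf_eq0 => /eqP->; rewrite mul0r.
pose y : 'rV[R]_n := map_mx (fun x => ln x / 2) d.
have yd : map_mx (fun x => expR (2 * x)) y = d.
  apply/rowP => i; rewrite !mxE mulrC divfK// lnK// posrE; exact: d0.
exists v, y; rewrite yd; split=> //.
have ys : (v^T *m diag_mx y *m v)^T = v^T *m diag_mx y *m v.
  by rewrite !trmx_mul trmxK tr_diag_mx mulmxA.
split=> //; set Y := v^T *m diag_mx y *m v.
have -> : Y = 2^-1 *: (2 *: Y) by rewrite scalerA mulVf// scale1r.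
apply: LieZ; apply: Gpow => [|m]; first by rewrite linearZ/= ys.
rewrite mxexp_natmul.
have -> : mxexp (2 *: Y) = q.
  have -> : 2 *: Y = v^T *m diag_mx (2 *: y) *m v.
    by rewrite linearZ/= -scalemxAr -scalemxAl.
  rewrite mxexp_conj// mxexp_diag qE; congr (_ *m diag_mx _ *m _).
  by rewrite -yd; apply/rowP => i; rewrite !mxE.
elim: m => [|m IH]; first by rewrite expr0; exact: matrix_group1 Ggrp.
rewrite exprS; apply: matrix_groupM => //; apply: matrix_groupM => //; exact: Gtr.
Qed.

Lemma polar_K g X : G g -> pG X -> g *m g^T = mxexp (2 *: X) -> KG (mxexp (- X) *m g).
Proof.
move=> Gg [GX Xs] gX; split.
  by apply: matrix_groupM => //; have := GX (-1); rewrite scaleN1r.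
rewrite trmx_mul mxexp_sym ?linearN/= ?Xs// -mulmxA (mulmxA g) gX.
have -> : 2 *: X = X + X by rewrite scaler_nat mulr2n.
by rewrite mxexpD// -mulmxA mxexpN mulmx1 -{2}[X]opprK mxexpN.
Qed.

Variable u : 'M[R]_n.
Hypothesis uu : u *m u^T = 1%:M.
Hypothesis udiag : forall X, X \in a -> is_diag_mx (u *m X *m u^T).

Definition cj X : 'M[R]_n := u *m X *m u^T.

Lemma u'u : u^T *m u = 1%:M. Proof. exact: mulmx1C uu. Qed.

Lemma cjM X Y : cj (X *m Y) = cj X *m cj Y.
Proof. by rewrite /cj !mulmxA -(mulmxA _ u^T u) u'u mulmx1. Qed.
Lemma cj_inj X Y : cj X = cj Y -> X = Y.
Proof.
move=> /(congr1 (fun Z => u^T *m Z *m u)).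
by rewrite /cj !mulmxA u'u !mul1mx -!mulmxA u'u !mulmx1.
Qed.
Lemma cjK X : cj (u^T *m X *m u) = X.
Proof. by rewrite /cj !mulmxA uu mul1mx -mulmxA uu mulmx1. Qed.
Lemma cjD X Y : cj (X + Y) = cj X + cj Y. Proof. by rewrite /cj mulmxDr mulmxDl. Qed.
Lemma cjB X Y : cj (X - Y) = cj X - cj Y. Proof. by rewrite /cj mulmxBr mulmxBl. Qed.
Lemma cjN X : cj (- X) = - cj X. Proof. by rewrite /cj mulmxN mulNmx. Qed.
Lemma cjZ c X : cj (c *: X) = c *: cj X. Proof. by rewrite /cj -scalemxAr -scalemxAl. Qed.
Lemma cjT X : cj X^T = (cj X)^T. Proof. by rewrite /cj !trmx_mul trmxK mulmxA. Qed.
Lemma cj1 : cj 1%:M = 1%:M. Proof. by rewrite /cj mulmx1. Qed.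
Lemma tr_cj X : \tr (cj X) = \tr X.
Proof. by rewrite /cj mxtrace_mulC mulmxA u'u mul1mx. Qed.

Definition dg X i := cj X i i.

Lemma cj_a X : X \in a -> cj X = diag_mx (\row_i dg X i).
Proof.
move=> /udiag/diag_mxP[d dE]; rewrite /dg /cj dE; congr diag_mx.
by apply/rowP => i; rewrite !mxE eqxx mulr1n.
Qed.

(** In the basis that diagonalizes [a], ad P acts on each entry by a scalar, so root spaces can be
    handled entrywise. *)
Lemma bracket_a P Y i j : P \in a -> cj (bracket P Y) i j = (dg P i - dg P j) * cj Y i j.
Proof.
move=> aP'; rewrite /bracket cjB !cjM cj_a//; move: (cj Y) => W.
by rewrite mul_diag_mx mul_mx_diag !mxE mulrBl [W i j * _]mulrC.
Qed.

(** A difference of diagonal entries that vanishes at P vanishes on all of [a]: what commutes with P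
    commutes with [a]. *)
Definition regular P := P \in a /\
  forall i j, dg P i = dg P j -> forall H, H \in a -> dg H i = dg H j.

(** The matrix is q(ad P) Y, built by Horner's scheme from brackets with P. *)
Lemma Lie_adpoly P Y (q : {poly R}) : P \in a -> Lie G Y ->
  Lie G (u^T *m (\matrix_(i, j) (q.[dg P i - dg P j] * cj Y i j)) *m u).
Proof.
move=> aP' GY; elim/poly_ind: q => [|q c IH].
  have -> : \matrix_(i, j) ((0 : {poly R}).[dg P i - dg P j] * cj Y i j) = 0.
    by apply/matrixP => i j; rewrite !mxE horner0 mul0r.
  by rewrite mulmx0 mul0mx; exact: Lie0.
set W := u^T *m _ *m u in IH.
have -> : u^T *m (\matrix_(i, j) ((q * 'X + c%:P).[dg P i - dg P j] * cj Y i j)) *m u =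
    bracket P W + c *: Y.
  apply: cj_inj; rewrite cjK cjD cjZ; apply/matrixP => i j.
  rewrite [RHS]mxE bracket_a// /W cjK [in RHS]mxE; move: (cj Y) => Z.
  by rewrite !mxE hornerMXaddC; ring.
apply: LieD => //; last exact: LieZ.
by apply: Lie_bracket => //; have [] := a_pG aP'.
Qed.

Lemma regular_centralizer P Y : regular P -> pG Y -> Y *m P = P *m Y -> Y \in a.
Proof.
move=> [aP' Preg] pY YP; apply: a_max => // X aX; apply: cj_inj.
rewrite !cjM (cj_a aX); apply/matrixP => i j.
have -> : (diag_mx (\row_i dg X i) *m cj Y) i j = cj Y i j * dg X i.
  by move: (cj Y) => W; rewrite mul_diag_mx !mxE mulrC.
have -> : (cj Y *m diag_mx (\row_i dg X i)) i j = cj Y i j * dg X j.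
  by move: (cj Y) => W; rewrite mul_mx_diag !mxE.
have [->|Yij] := eqVneq (cj Y i j) 0; first by rewrite !mul0r.
congr (_ * _); apply: Preg aX; apply/eqP; rewrite -subr_eq0; apply/eqP.
apply: (mulIf Yij); rewrite mul0r -bracket_a// /bracket YP subrr.
by rewrite /cj mulmx0 mul0mx mxE.
Qed.

(** Upper triangular once the basis is ordered by decreasing [dg P], and diagonal inside each block
    on which [dg P] is constant. *)
Definition shape P X := forall i j, i != j -> ~~ (dg P j < dg P i) -> cj X i j = 0.

Lemma shape1 P : shape P 1%:M.
Proof. by move=> i j /negbTE ij _; rewrite cj1 mxE ij. Qed.

Lemma shapeM P X Y : shape P X -> shape P Y -> shape P (X *m Y).
Proof.
move=> sX sY i j ij pij; rewrite cjM mxE big1// => k _.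
have [ik|ik] := eqVneq i k; first by rewrite -ik (sY i j) ?mulr0// ik.
have [pik|pik] := boolP (dg P k < dg P i); last by rewrite sX// mul0r.
have [kj|kj] := eqVneq k j; first by rewrite kj (negbTE pij) in pik.
rewrite (sY k j) ?mulr0//; apply: contra pij => /lt_trans; exact.
Qed.

Lemma shapeD P X Y : shape P X -> shape P Y -> shape P (X + Y).
Proof. by move=> sX sY i j ij pij; rewrite cjD mxE sX// sY// addr0. Qed.

Lemma shapeZ P c X : shape P X -> shape P (c *: X).
Proof. by move=> sX i j ij pij; rewrite cjZ mxE sX// mulr0. Qed.

Lemma closed_shape P : closed [set X | shape P X].
Proof.
pose I := {ij : 'I_n * 'I_n | (ij.1 != ij.2) && ~~ (dg P ij.2 < dg P ij.1)}.
have cE : closed [set X : 'M[R]_n | forall ij : I, cj X (val ij).1 (val ij).2 = 0].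
  apply: closed_forall => -[[i j] _] /=.
  apply: (closed_level (f := fun X : 'M[R]_n => cj X i j)).
  apply: continuous_mulmx => [k l|k l]; last exact: continuous_cst_fun.
  apply: continuous_mulmx => [{}k {}l|{}k {}l]; last exact: coord_continuous.
  exact: continuous_cst_fun.
rewrite [X in closed X](_ : _ =
  [set X : 'M[R]_n | forall ij : I, cj X (val ij).1 (val ij).2 = 0])//.
apply/seteqP; split=> X /= sX.
  by move=> [[i j] /= /andP[]]; exact: sX.
move=> i j ij pij; have c : ((i, j).1 != (i, j).2) && ~~ (dg P (i, j).2 < dg P (i, j).1).
  by rewrite /= ij pij.
exact: (sX (exist _ (i, j) c)).
Qed.

Lemma shape_exp P X : shape P X -> shape P (mxexp X).
Proof.
move=> sX; apply: (@closed_nrm R n [set X | shape P X]); first exact: closed_shape.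
move=> e e0.
have [N NP] := mxexp_cvg X e0; exists (epsum X N); last exact: NP.
rewrite /epsum; elim: N {NP} => [|N IH].
  by rewrite big_ord0 => i j _ _; rewrite /cj mulmx0 mul0mx mxE.
rewrite big_ord_recr/=; apply: shapeD => //; apply: shapeZ.
elim: N {IH} => [|N IH]; first by rewrite expr0; exact: shape1.
by rewrite exprS; apply: shapeM.
Qed.

(** The factor AN of the Iwasawa decomposition, except that signs on the diagonal remain possible.
    Demanding the shape of the inverse as well makes it a group at once. *)
Definition BG P : set 'M[R]_n := [set b | [/\ G b, shape P b & shape P (invmx b)]].

Lemma BGM P b c : BG P b -> BG P c -> BG P (b *m c).
Proof.
move=> [Gb sb sb'] [Gc sc sc']; split; first exact: matrix_groupM.
  exact: shapeM.
have [ub uc] := (matrix_group_unit Ggrp Gb, matrix_group_unit Ggrp Gc).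
have -> : invmx (b *m c) = invmx c *m invmx b.
  have bc1 : b *m c *m (invmx c *m invmx b) = 1%:M by rewrite mulmxA mulmxK// mulmxV.
  have ubc : b *m c \in unitmx by rewrite unitmx_mul ub.
  by rewrite -[RHS](mulKmx ubc) bc1 mulmx1.
exact: shapeM.
Qed.

Lemma BGV P b : BG P b -> BG P (invmx b).
Proof. by move=> [Gb sb sb']; split; rewrite ?invmxK//; exact: matrix_groupV. Qed.

Lemma closed_BG P : closed (BG P).
Proof.
(* On G the determinant is 1, so the inverse is the adjugate, which is polynomial and hence
   continuous. *)
rewrite [X in closed X](_ : _ = G `&` [set X | shape P X] `&`
    (fun X => \adj X) @^-1` [set X | shape P X] `&` G); last first.
  have invE X : G X -> invmx X = \adj X.
    by move=> GX; rewrite /invmx (matrix_group_unit Ggrp GX) Gdet// invr1 scale1r.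
  apply/seteqP; split=> X /=.
    by move=> [GX sX sX']; split; [split; [split|rewrite -invE]|].
  by move=> [[[_ sX] sX'] GX]; split=> //; rewrite invE.
apply: closedI => //; apply: closedI; first by apply: closedI => //; exact: closed_shape.
apply: closed_comp; last exact: closed_shape.
move=> X _; apply: continuous_entries => i j.
by apply: continuous_adj => k l; exact: coord_continuous.
Qed.

Lemma BG_diag P b c i : shape P b -> shape P c -> dg (b *m c) i = dg b i * dg c i.
Proof.
move=> sb sc; rewrite /dg cjM mxE (bigD1 i)//= big1 ?addr0// => k ki.
have [pik|pik] := boolP (dg P k < dg P i); last by rewrite sb ?mul0r// eq_sym.
by rewrite (sc k i) ?mulr0// -leNgt ltW.
Qed.

(** Only the squares of the diagonal entries are determined, which is why [bL] below takes
    logarithms of squares. *)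
Lemma KG_BG_diag P k i : KG k -> BG P k -> dg k i ^+ 2 = 1.
Proof.
move=> Kk [Gk sk]; rewrite (KG_inv Kk) => sk'.
have /(congr1 (fun X => dg X i)) := KG_orth Kk.
by rewrite (BG_diag i sk sk') /dg cjT cj1 !mxE eqxx expr2.
Qed.

Lemma Lie_BG P V t : Lie G V -> shape P V -> BG P (mxexp (t *: V)).
Proof.
move=> GV sV; split; first exact: GV.
  by apply: shape_exp; exact: shapeZ.
by rewrite mxexp_inv -scaleN1r scalerA; apply: shape_exp; exact: shapeZ.
Qed.

(** ad P has finitely many eigenvalues, so an arbitrary function of it is an interpolating
    polynomial of it. This gives the projections on root spaces. *)
Lemma Lie_weighted P Y (w : R -> R) : P \in a -> Lie G Y -> exists2 V, Lie G V &
  forall i j, cj V i j = w (dg P i - dg P j) * cj Y i j.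
Proof.
move=> aP' GY.
have [q qP] := interpolation [seq dg P i - dg P j | i <- enum 'I_n, j <- enum 'I_n] w.
exists (u^T *m (\matrix_(i, j) (q.[dg P i - dg P j] * cj Y i j)) *m u).
  exact: Lie_adpoly.
move=> i j; rewrite cjK [LHS]mxE qP//; apply/allpairsP; exists (i, j).
by rewrite !mem_enum.
Qed.

Lemma cj_sym X i j : X^T = X -> cj X i j = cj X j i.
Proof. by move=> Xs; rewrite -{1}Xs cjT [LHS]mxE. Qed.

Lemma sym_of_cj X : (forall i j, cj X i j = cj X j i) -> X^T = X.
Proof. by move=> Xs; apply: cj_inj; apply/matrixP => i j; rewrite cjT [LHS]mxE. Qed.

(** The component of Y that commutes with P is symmetric and in [Lie G], hence in [a] by regularity,
    hence diagonal. *)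
Lemma regular_zero P Y i j : regular P -> pG Y -> i != j -> dg P i = dg P j -> cj Y i j = 0.
Proof.
move=> Preg [GY Ys] ij pij; have [aP' _] := Preg.
have [V GV VY] := @Lie_weighted P Y (fun x => (x == 0)%:R) aP' GY.
have Vs : V^T = V.
  by apply: sym_of_cj => k l; rewrite !VY (cj_sym _ _ Ys) -opprB oppr_eq0.
have aV : V \in a.
  apply: (regular_centralizer Preg) => //.
  apply: cj_inj; apply/esym/eqP; rewrite -subr_eq0 -cjB -/(bracket P V); apply/eqP.
  apply/matrixP => k l; rewrite bracket_a// VY [RHS]mxE.
  by have [->|/negbTE nz] := eqVneq (dg P k - dg P l) 0; rewrite ?mul0r ?mulr0.
have := VY i j; rewrite pij subrr eqxx mul1r => <-.
by rewrite cj_a// mxE (negbTE ij).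
Qed.

Lemma iwasawa_vector P Y : regular P -> pG Y -> exists V,
  [/\ Lie G V, shape P V & (V - Y)^T = - (V - Y)].
Proof.
move=> Preg pY; have [aP' _] := Preg; have [GY Ys] := pY.
pose w (x : R) : R := if x == 0 then 1 else if 0 < x then 2 else 0.
have [V GV VY] := @Lie_weighted P Y w aP' GY; exists V; split=> //.
  move=> i j ij; rewrite -leNgt le_eqVlt VY => /orP[/eqP pij|pij].
    by rewrite (regular_zero Preg pY) ?mulr0.
  have x0 : dg P i - dg P j < 0 by rewrite subr_lt0.
  by rewrite /w lt_eqF// ltNge ltW// mul0r.
apply: cj_inj; apply/matrixP => i j; rewrite cjT cjN cjB.
have -> : (cj V - cj Y)^T i j = cj V j i - cj Y j i by move: (cj V) (cj Y) => ? ?; rewrite !mxE.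
have -> : (- (cj V - cj Y)) i j = - (cj V i j - cj Y i j).
  by move: (cj V) (cj Y) => ? ?; rewrite !mxE.
rewrite !VY (cj_sym j i Ys) -{2 4}[cj Y i j]mul1r -!mulrBl -mulNr; congr (_ * _).
rewrite -[dg P j - _]opprB /w oppr_eq0 oppr_gt0.
by case: (ltgtP (dg P i - dg P j) 0) => _; ring.
Qed.

(** The first variation of tr(exp(tV) Q exp(tV)^T) at t = 0 is 2 tr(VQ). *)
Lemma trace_min Q V : Q^T = Q ->
  (forall t, \tr Q <= \tr (mxexp (t *: V) *m Q *m (mxexp (t *: V))^T)) -> \tr (V *m Q) = 0.
Proof.
suff H W : Q^T = Q -> (forall t, \tr Q <= \tr (mxexp (t *: W) *m Q *m (mxexp (t *: W))^T)) ->
    0 <= \tr (W *m Q).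
  move=> Qs VQ; apply/eqP; rewrite eq_le H// andbT -oppr_ge0.
  have -> : - \tr (V *m Q) = \tr ((- V) *m Q) by rewrite mulNmx linearN.
  by apply: (H _ Qs) => t; rewrite scalerN -scaleNr; exact: VQ.
move=> Qs WQ; have [C C0 CP] := mxexp_scale_rem1 W.
have [M M0 MP] := nrm_mxexp_scale W.
pose D := C * nrm Q * M + (nrm (1%:M : 'M[R]_n) + nrm W) * nrm Q * C + nrm (W *m Q *m W^T).
rewrite -oppr_le0 -(pmulr_rle0 _ (ltr0n _ 2)) mulrN.
apply: (@le0_of_le_linear _ _ D) => t t01; have [t0 t1] := andP t01.
have t01' : 0 <= t <= 1 by rewrite ltW.
set E := mxexp (t *: W); pose r := E - (1%:M + t *: W).
have rC : nrm r <= C * t ^+ 2 by exact: CP.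
have EQ : E *m Q *m E^T = Q + t *: (W *m Q + Q *m W^T) +
    (r *m Q *m E^T + (1%:M + t *: W) *m Q *m r^T + t ^+ 2 *: (W *m Q *m W^T)).
  have -> : r *m Q *m E^T + (1%:M + t *: W) *m Q *m r^T =
     E *m Q *m E^T - (1%:M + t *: W) *m Q *m (1%:M + t *: W)^T.
    rewrite /r linearB/= !(mulmxBl, mulmxBr).
    by rewrite addrA subrK.
  have -> : (1%:M + t *: W)^T = 1%:M + t *: W^T.
    by apply/matrixP => i j; rewrite !mxE eq_sym.
  rewrite !(mulmxDl, mulmxDr, mul1mx, mulmx1, =^~ scalemxAl, =^~ scalemxAr, scalerDr, scalerA).
  move: (E *m Q *m E^T) (W *m Q) (Q *m W^T) (W *m Q *m W^T) => x y z p.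
  by apply/matrixP => i j; rewrite !mxE; ring.
have := WQ t; rewrite -/E EQ !mxtraceD !mxtraceZ !mxtraceD.
have -> : \tr (Q *m W^T) = \tr (W *m Q) by rewrite -mxtrace_tr trmx_mul trmxK Qs.
have b1 : \tr (r *m Q *m E^T) <= C * nrm Q * M * t ^+ 2.
  apply: le_trans (ler_norm _) _; apply: le_trans (norm_mxtrace _) _.
  apply: le_trans (nrmM _ _) _; rewrite mulrAC nrm_trmx; apply: ler_pM; rewrite ?nrm_ge0 ?MP//.
  by apply: le_trans (nrmM _ _) _; rewrite mulrAC ler_wpM2r ?nrm_ge0.
have b2 : \tr ((1%:M + t *: W) *m Q *m r^T) <=
    (nrm (1%:M : 'M[R]_n) + nrm W) * nrm Q * C * t ^+ 2.
  apply: le_trans (ler_norm _) _; apply: le_trans (norm_mxtrace _) _.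
  apply: le_trans (nrmM _ _) _; rewrite nrm_trmx -[leRHS]mulrA; apply: ler_pM; rewrite ?nrm_ge0//.
  apply: le_trans (nrmM _ _) _; rewrite ler_wpM2r ?nrm_ge0//.
  by apply: le_trans (nrmD _ _) _; rewrite lerD2l nrmZ gtr0_norm// ler_piMl ?nrm_ge0.
have b3 : t ^+ 2 * \tr (W *m Q *m W^T) <= nrm (W *m Q *m W^T) * t ^+ 2.
  rewrite mulrC ler_wpM2r ?sqr_ge0//.
  by apply: le_trans (ler_norm _) _; exact: norm_mxtrace.
move=> le1; rewrite -(ler_pM2r t0) -[D * t * t]mulrA -expr2 /D.
lra.
Qed.

Lemma tr_antisym_sym Z Q : Z^T = - Z -> Q^T = Q -> \tr (Z *m Q) = 0.
Proof.
move=> Za Qs; have : \tr (Z *m Q) = - \tr (Z *m Q).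
  by rewrite -{1}mxtrace_tr trmx_mul Za Qs mulmxN linearN/= mxtrace_mulC.
lra.
Qed.

Lemma nrm_le_sq X : nrm X <= (n * n)%:R + \tr (X *m X^T).
Proof.
have -> : (n * n)%:R + \tr (X *m X^T) = \sum_i \sum_j (1 + X i j ^+ 2).
  under [RHS]eq_bigr do rewrite big_split/=.
  rewrite big_split/= !sumr_const !card_ord natrM mulr_natr; congr (_ + _).
  by apply: eq_bigr => i _; rewrite mxE; apply: eq_bigr => j _; rewrite mxE expr2.
apply: ler_sum => i _; apply: ler_sum => j _.
rewrite -[X i j ^+ 2]real_normK ?num_real//; move: (normr_ge0 (X i j)).
by move: `|_| => x x0; nra.
Qed.

(** Minimize tr(y y^T) over the coset y in BG h, cut by a sublevel set for compactness. At a minimum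
    write y y^T = exp(2Y), where Y has eigenvalues d_i. The triangular vector of Y gives tr(Y y y^T)
    = 0, that is sum d_i exp(2 d_i) = 0, while det = 1 gives sum d_i = 0. The terms d_i (exp(2 d_i)
    - 1) are nonnegative with sum 0, so all d_i vanish and y is orthogonal. *)
Lemma iwasawa_min P h : regular P -> G h -> exists2 b, BG P b & KG (b *m h).
Proof.
move=> Preg Gh; have uh := matrix_group_unit Ggrp Gh.
pose F (y : 'M[R]_n) : R := \tr (y *m y^T).
pose C := [set y | BG P (y *m invmx h)] `&` [set y | F y <= F h].
have cF : continuous F.
  apply: continuous_sum_fun => i.
  apply: continuous_mulmx => [{}i j|{}i j]; first exact: coord_continuous.
  by apply: continuous_trmx => k l; exact: coord_continuous.
have cC : closed C.
  apply: closedI.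
    rewrite [X in closed X](_ : _ = (fun y => y *m invmx h) @^-1` BG P)//.
    apply: closed_comp; last exact: closed_BG.
    move=> y _; apply: continuous_entries => i j.
    apply: continuous_mulmx => [k l|k l]; first exact: coord_continuous.
    exact: continuous_cst_fun.
  rewrite [X in closed X](_ : _ = F @^-1` [set x | x <= F h])//.
  by apply: closed_comp; [move=> y _; exact: cF|exact: closed_le].
have Ch : C h.
  split=> //=; rewrite mulmxV//; split; first exact: matrix_group1 Ggrp.
    exact: shape1.
  by rewrite invmx1; exact: shape1.
have [|||y [By Fy] ymin] := @compact_max_mx R n C (fun y => - F y) ((n * n)%:R + F h) cC.
- by move=> y [_ Fy]; apply: le_trans (nrm_le_sq y) _; rewrite lerD2l.
- by exists h.
- by move=> y; exact: (continuousN (cF y)).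
exists (y *m invmx h) => //; rewrite mulmxKV//.
have Gy : G y.
  by rewrite -[y](mulmxKV uh); apply: matrix_groupM => //; case: By.
have [v [d [vv pY yy]]] := polar Gy; set Q := y *m y^T in yy.
have Qs : Q^T = Q by rewrite /Q trmx_mul trmxK.
have [V [GV sV Va]] := iwasawa_vector Preg pY.
have VQ : \tr (V *m Q) = 0.
  apply: trace_min => // t; have Bt := Lie_BG t GV sV.
  have Et : mxexp (t *: V) *m Q *m (mxexp (t *: V))^T =
      (mxexp (t *: V) *m y) *m (mxexp (t *: V) *m y)^T by rewrite trmx_mul !mulmxA.
  rewrite Et -/(F (mxexp (t *: V) *m y)) -/(F y).
  have [/ltW//|Fle] := ltP (F y) (F (mxexp (t *: V) *m y)).
  rewrite -lerN2; apply: ymin; split; last exact: le_trans Fle Fy.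
  by rewrite /= -mulmxA; exact: BGM.
set Y := v^T *m diag_mx d *m v in pY Va.
have YQ : \tr (Y *m Q) = 0.
  have : \tr ((V - Y) *m Q) = 0 by exact: tr_antisym_sym.
  by rewrite mulmxBl linearB/= VQ sub0r => /eqP; rewrite oppr_eq0 => /eqP.
have v'v := mulmx1C vv.
have s1 : \sum_i d 0 i * expR (2 * d 0 i) = 0.
  rewrite -[RHS]YQ yy /Y !mulmxA -(mulmxA _ v v^T) vv mulmx1 -mulmxA mxtrace_mulC mulmxA.
  rewrite -!mulmxA (mulmxA v) vv mul1mx mulmx_diag mxtrace_diag.
  by apply: eq_bigr => i _; rewrite !mxE mulrC.
have s2 : \sum_i d 0 i = 0.
  have : \det Q = 1 by rewrite /Q det_mulmx det_tr Gdet// mulr1.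
  rewrite yy !det_mulmx mulrAC -det_mulmx v'v det1 mul1r det_diag.
  under eq_bigr do rewrite mxE.
  have -> : \prod_i expR (2 * d 0 i) = expR (\sum_i 2 * d 0 i).
    by rewrite (big_morph _ (@expRD R) (@expR0 R)).
  rewrite -[RHS]expR0 => /expR_inj; rewrite -mulr_sumr => /eqP.
  by rewrite mulf_eq0 pnatr_eq0 => /eqP.
have d0 i : d 0 i = 0.
  have : \sum_i d 0 i * (expR (2 * d 0 i) - 1) = 0.
    under eq_bigr do rewrite mulrBr mulr1.
    by rewrite sumrB s1 s2 subrr.
  have ge0 k : 0 <= d 0 k * (expR (2 * d 0 k) - 1).
    have [dk|dk] := leP 0 (d 0 k).
      by rewrite mulr_ge0// subr_ge0 -[leLHS]expR0 ler_expR mulr_ge0.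
    by rewrite mulr_le0 ?(ltW dk)// subr_le0 -[leRHS]expR0 ler_expR mulr_ge0_le0// ltW.
  move/eqP; rewrite psumr_eq0// => /allP/(_ i (mem_index_enum i))/=.
  rewrite mulf_eq0 subr_eq0 -[X in _ || (_ == X)]expR0 => /orP[/eqP//|/eqP/expR_inj/eqP].
  by rewrite mulf_eq0 pnatr_eq0 => /eqP.
split=> //; rewrite -/Q yy.
have -> : diag_mx (map_mx (fun x => expR (2 * x)) d) = 1%:M.
  by apply/matrixP => i j; rewrite !mxE d0 mulr0 expR0.
by rewrite mulmx1.
Qed.

Lemma iwasawa P h : regular P -> G h -> exists k b, [/\ KG k, BG P b & h = k *m b].
Proof.
move=> Preg Gh; have uh := matrix_group_unit Ggrp Gh.
have [b Bb Kbh] := iwasawa_min Preg (matrix_groupV Ggrp Gh).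
set k := b *m invmx h in Kbh; have kb : k *m h = b by exact: mulmxKV.
exists k^T, b; split=> //; first exact: KGT.
by rewrite -[X in _ *m X]kb mulmxA (KG_orth' Kbh) mul1mx.
Qed.

(* Elements of a that are conjugate under KG are conjugate under the normalizer of a *)
Lemma fusion P L k : regular P -> L \in a -> KG k -> k *m L *m k^T \in a ->
  exists2 w, KG w & (forall X, X \in a -> w *m X *m w^T \in a) /\
    k *m L *m k^T = w^T *m L *m w.
Proof.
move=> Preg aL Kk aL'; have [aP' _] := Preg.
have [kk kk'] := (KG_orth Kk, KG_orth' Kk).
pose K' : set 'M[R]_n := KG `&` [set m | m *m L = L *m m].
have K'c : closed K'.
  apply: closedI; first exact: closed_KG.
  have cE : closed [set m : 'M[R]_n | forall ij : 'I_n * 'I_n,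
      (m *m L - L *m m) ij.1 ij.2 = 0].
    apply: closed_forall => -[i j] /=.
    apply: (closed_level (f := fun m : 'M[R]_n => (m *m L - L *m m) i j)).
    under eq_fun do rewrite mxE [X in _ + X]mxE.
    move=> m; apply: (@continuousB _ _ _ (fun m : 'M[R]_n => (m *m L) i j)
      (fun m : 'M[R]_n => (L *m m) i j)).
      apply: continuous_mulmx => [{}i {}j|{}i {}j]; first exact: coord_continuous.
      exact: continuous_cst_fun.
    apply: continuous_mulmx => [{}i {}j|{}i {}j]; last exact: coord_continuous.
    exact: continuous_cst_fun.
  rewrite [X in closed X](_ : _ = [set m : 'M[R]_n | forall ij : 'I_n * 'I_n,
      (m *m L - L *m m) ij.1 ij.2 = 0])//.
  apply/seteqP; split=> m /=; first by move=> -> ij; rewrite subrr mxE.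
  by move=> mL; apply/eqP; rewrite -subr_eq0; apply/eqP/matrixP => i j;
    rewrite [RHS]mxE; exact: (mL (i, j)).
have K'T m : K' m -> m^T *m L = L *m m^T.
  by move=> [_ mL]; rewrite -[L in LHS]a_sym// -trmx_mul -[L in RHS]a_sym// -trmx_mul mL.
(* X commutes with L because k L k^T and P are both in [a]. Moving X within the centralizer of L
   until it commutes with P changes k into w^T without changing the conjugate of L. *)
have [X XE] : exists X, X = k^T *m P *m k by eexists.
have XL : X *m L = L *m X.
  have /(congr1 (fun Z => k^T *m Z *m k)) := a_comm aP' aL'.
  by rewrite XE !mulmxA kk' mul1mx -!mulmxA kk' mulmx1.
have pX : pG X by rewrite XE; have := pG_conj (KGT Kk) (a_pG aP'); rewrite trmxK.
have [|||m K'm] := @conj_commute K' X P K'c (fun m (h : K' m) => h.1) _ _ pX (a_pG aP').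
- by split; [exact: KG1|rewrite /= mul1mx mulmx1].
- move=> m1 m2 [Km1 m1L] [Km2 m2L]; split; first exact: KGM.
  by rewrite /= -mulmxA m2L mulmxA m1L mulmxA.
- move=> m Z K'm -> t; split.
    by apply: exp_bracket_KG; [apply: pG_conj => //; case: K'm|exact: a_pG].
  have mXL : m *m X *m m^T *m L = L *m (m *m X *m m^T).
    by rewrite -!mulmxA K'T// (mulmxA X) XL !mulmxA; case: K'm => _ ->.
  apply: mxexp_comm; rewrite -scalemxAl -scalemxAr; congr (_ *: _).
  move: mXL (a_comm aP' aL); move: (m *m X *m m^T) => W WL PL.
  by rewrite /bracket mulmxBl mulmxBr -!mulmxA PL WL !mulmxA WL PL.
have Km : KG m by case: K'm.
move=> [P1P _ _]; set P1 := m *m X *m m^T in P1P.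
have [w wE] : exists w, w = m *m k^T by eexists.
have Kw : KG w by rewrite wE; apply: KGM => //; exact: KGT.
have [ww ww'] := (KG_orth Kw, KG_orth' Kw).
have P1E : P1 = w *m P *m w^T by rewrite /P1 wE XE trmx_mul trmxK !mulmxA.
have aP1 : P1 \in a.
  by apply: (regular_centralizer Preg) => //; apply: pG_conj.
clearbody P1; have sub Y : Y \in a -> w^T *m Y *m w \in a.
  move=> aY; apply: (regular_centralizer Preg).
    by have := pG_conj (KGT Kw) (a_pG aY); rewrite trmxK.
  have PE : P = w^T *m P1 *m w by rewrite P1E !mulmxA ww' mul1mx -mulmxA ww' mulmx1.
  rewrite {1}PE [in RHS]PE !mulmxA -!(mulmxA _ w w^T) ww !mulmx1.
  by rewrite -!(mulmxA w^T) (a_comm aY aP1).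
(* Conjugation by w^T maps [a] injectively into itself; by dimension it is onto, so w preserves [a]
   too. *)
pose phi := linfun (mulmxr w \o mulmx w^T : 'M[R]_n -> 'M[R]_n).
have phiE Y : phi Y = w^T *m Y *m w by rewrite lfunE.
have phia : (phi @: a)%VS = a.
  apply/eqP; rewrite eqEdim; apply/andP; split.
    by apply/subvP => _ /memv_imgP[Y aY ->]; rewrite phiE sub.
  rewrite limg_dim_eq//; apply/eqP; rewrite -subv0; apply/subvP => Y.
  rewrite memv_cap memv_ker memv0 phiE => /andP[_ /eqP wY].
  have : w *m (w^T *m Y *m w) *m w^T = 0 by rewrite wY mulmx0 mul0mx.
  by rewrite !mulmxA ww mul1mx -mulmxA ww mulmx1 => ->.
exists w => //; split.
  move=> Y; rewrite -{1}phia => /memv_imgP[Z aZ ->]; rewrite phiE.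
  by rewrite !mulmxA ww mul1mx -mulmxA ww mulmx1.
rewrite wE trmx_mul trmxK -!mulmxA; congr (_ *m _); rewrite !mulmxA K'T//.
by rewrite -(mulmxA L) (KG_orth' Km) mulmx1.
Qed.

(** Along the line H + eP an unwanted coincidence of diagonal entries occurs for finitely many e
    only. *)
Lemma regular_near P H d : regular P -> H \in a -> 0 < d ->
  exists e, [/\ 0 < e, e < d & regular (H + e *: P)].
Proof.
move=> [aP' Preg] aH d0.
have small (s : seq R) : exists2 h, 0 < h & forall e, 0 < e < h -> e \notin s.
  elim: s => [|x s [h h0 hs]]; first by exists 1.
  have [x0|x0] := leP x 0.
    exists h => // e /andP[e0 eh]; rewrite inE negb_or hs ?e0// andbT.
    by rewrite gt_eqF// (le_lt_trans x0).
  exists (Num.min x h); first by rewrite lt_min x0.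
  move=> e /andP[e0]; rewrite lt_min => /andP[ex eh].
  by rewrite inE negb_or lt_eqF//= hs// e0.
pose bad := [seq - (dg H i - dg H j) / (dg P i - dg P j) | i <- enum 'I_n, j <- enum 'I_n].
have [h h0 hbad] := small bad.
pose e := Num.min h d / 2.
have m0 : 0 < Num.min h d by rewrite lt_min h0.
have e0 : 0 < e by rewrite divr_gt0.
have em : e < Num.min h d by rewrite ltr_pdivrMr// ltr_pMr// ltr1n.
move: (em); rewrite lt_min => /andP[eh ed].
exists e; split=> //; split; first by rewrite memvD// memvZ.
move=> i j; have dgE k : dg (H + e *: P) k = dg H k + e * dg P k.
  by rewrite /dg cjD cjZ; move: (cj H) (cj P) => ? ?; rewrite !mxE.
rewrite !dgE => Hij; apply: Preg; apply/eqP; rewrite -subr_eq0; apply/negPn/negP => pij.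
have : e \in bad.
  apply/allpairsP; exists (i, j); rewrite !mem_enum; split=> //=.
  by apply: (mulIf pij); rewrite divfK//; move: Hij; lra.
by rewrite (negbTE (hbad e _))// e0.
Qed.

Lemma conj_commute_KG X P : pG X -> pG P -> exists2 k, KG k & let H := k *m X *m k^T in
  [/\ H *m P = P *m H,
      forall m, KG m -> \tr (m *m X *m m^T *m P) <= \tr (H *m P) &
      forall Z, Z^T = - Z -> (forall t, KG (mxexp (t *: Z))) ->
        \tr (bracket Z (bracket Z H) *m P) <= 0].
Proof.
move=> pX pP; apply: conj_commute => //; first exact: closed_KG.
- exact: KG1.
- by move=> k m; exact: KGM.
- by move=> k Z Kk -> t; apply: exp_bracket_KG => //; exact: pG_conj.
Qed.

Theorem cartan_decomposition P g : regular P -> G g -> exists k k' H,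
  [/\ KG k, KG k', H \in a, g = k *m mxexp H *m k' &
    forall X c d, Lie G X -> X != 0 -> bracket H X = c *: X -> bracket P X = d *: X ->
      d != 0 -> 0 <= c * d].
Proof.
move=> Preg Gg; have [aP' _] := Preg.
have [v [y [vv pX gg]]] := polar Gg; set X := v^T *m diag_mx y *m v in pX.
have gX : g *m g^T = mxexp (2 *: X).
  have -> : 2 *: X = v^T *m diag_mx (2 *: y) *m v.
    by rewrite linearZ/= -scalemxAr -scalemxAl.
  rewrite gg mxexp_conj// mxexp_diag; congr (_ *m diag_mx _ *m _).
  by apply/rowP => i; rewrite !mxE.
have Kg := polar_K Gg pX gX.
have [k Kk [HP _ Hvar]] := conj_commute_KG pX (a_pG aP').
set H := k *m X *m k^T in HP Hvar.
have pH : pG H by exact: pG_conj.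
have aH : H \in a by exact: regular_centralizer Preg _ _.
have [kk kk'] := (KG_orth Kk, KG_orth' Kk).
exists k^T, (k *m (mxexp (- X) *m g)), H; split=> //; [exact: KGT|exact: KGM| |].
  have -> : H = k *m X *m k^T by [].
  rewrite mxexp_conj// !mulmxA kk' mul1mx -(mulmxA _ k^T k) kk' mulmx1.
  by rewrite mxexpN mul1mx.
move=> Y c d GY Y0 HY PY d0; have GYT : Lie G Y^T.
  by move=> t; have := Gtr (GY t); rewrite -mxexp_tr linearZ.
have brT M e : M^T = M -> bracket M Y = e *: Y -> bracket M Y^T = - (e *: Y^T).
  move=> Ms /(congr1 trmx); rewrite linearZ/= => <-.
  by rewrite /bracket linearB/= !trmx_mul Ms opprB.
(* Z lies in the Lie algebra of [KG], with [H,Z] = cW and [P,Z] = dW; the second variation in the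
   direction Z is -cd tr(W^2), and W is nonzero because d is. *)
pose Z := Y - Y^T; pose W := Y + Y^T.
have Za : Z^T = - Z by rewrite /Z linearB/= trmxK opprB.
have ZK t : KG (mxexp (t *: Z)).
  split; last exact: Lie_orth_exp.
  by have : Lie G Z; [exact: LieB|apply].
have brZ M e : M^T = M -> bracket M Y = e *: Y -> bracket M Z = e *: W.
  move=> Ms MY; have -> : bracket M Z = bracket M Y - bracket M Y^T.
    rewrite /bracket /Z mulmxBr mulmxBl.
    move: (M *m Y) (M *m Y^T) (Y *m M) (Y^T *m M) => p q r t.
    by apply/matrixP => i j; rewrite !mxE; ring.
  by rewrite MY (brT _ _ Ms MY) opprK scalerDr.
have Ws : W^T = W by rewrite /W linearD/= trmxK addrC.
have W0 : W != 0.
  apply: contra Y0 => /eqP W0; have YT : Y^T = - Y by apply/eqP; rewrite -addr_eq0 addrC -/W W0.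
  have := brT _ _ (a_sym aP') PY; rewrite YT scalerN opprK.
  have -> : bracket P (- Y) = - bracket P Y by rewrite /bracket mulmxN mulNmx opprB opprK addrC.
  rewrite PY => /eqP; rewrite eq_sym -subr_eq0 opprK -scalerDl scaler_eq0 => /orP[|//].
  by rewrite -mulr2n mulrn_eq0/= (negbTE d0).
have trW : 0 < \tr (W *m W).
  have WW : \tr (W *m W) = \sum_i \sum_j W i j ^+ 2.
    rewrite -{2}Ws; apply: eq_bigr => i _; rewrite mxE.
    by apply: eq_bigr => j _; rewrite [in X in _ * X]mxE expr2.
  have ge0 : forall i, 0 <= \sum_j W i j ^+ 2.
    by move=> i; apply: sumr_ge0 => j _; rewrite sqr_ge0.
  rewrite lt0r WW sumr_ge0 ?andbT// psumr_eq0//; apply: contra W0 => /allP W0.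
  apply/eqP/matrixP => i j; rewrite [RHS]mxE.
  have /= := W0 i (mem_index_enum i); rewrite psumr_eq0; last by move=> k0 _; rewrite sqr_ge0.
  by move=> /allP/(_ j (mem_index_enum j))/=; rewrite sqrf_eq0 => /eqP.
have := Hvar Z Za ZK.
have -> : bracket Z H = - (c *: W).
  by rewrite -(brZ H c) ?(a_sym aH)// /bracket opprB.
have -> : \tr (bracket Z (- (c *: W)) *m P) = - (c * d * \tr (W *m W)).
  rewrite -[bracket Z _]opprK.
  have -> : - bracket Z (- (c *: W)) = bracket (- (c *: W)) Z by rewrite /bracket opprB.
  rewrite mulNmx linearN/= tr_bracket.
  have -> : bracket Z P = - (d *: W) by rewrite -(brZ P d) ?(a_sym aP')// /bracket opprB.
  by rewrite mulmxN mulNmx opprK -scalemxAl -scalemxAr !mxtraceZ mulrA.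
by rewrite oppr_le0 pmulr_lge0.
Qed.

(** * Kostant's inequality and the triangle inequality over the reals *)

Section Triangle.
Variable P : 'M[R]_n.
Hypothesis Preg : regular P.
Variable f : 'M[R]_n -> R.
Hypothesis fD : forall X Y, X \in a -> Y \in a -> f (X + Y) <= f X + f Y.
Hypothesis fZ : forall c X, 0 <= c -> X \in a -> f (c *: X) = c * f X.
Hypothesis fK : forall w H, KG w -> (forall X, X \in a -> w *m X *m w^T \in a) ->
  H \in a -> f (w *m H *m w^T) <= f H.
Hypothesis fdual : forall H, H \in a -> exists2 L, L \in a &
  \tr (L *m H) = f H /\ forall H', H' \in a -> \tr (L *m H') <= f H'.

Definition dual L := L \in a /\ forall H', H' \in a -> \tr (L *m H') <= f H'.

(** For regular H the maximizer commutes with H and so lies in [a]; by [fusion] it is the conjugate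
    of L by an element preserving [a], under which f does not grow. The general case follows by
    perturbing H to H + tP. *)
Lemma linear_kostant L k H : dual L -> KG k -> H \in a ->
  \tr (k *m L *m k^T *m H) <= f H.
Proof.
move=> [aL Lf] Kk aH; have [aP' _] := Preg.
have pX : pG (k *m L *m k^T) by apply: pG_conj => //; exact: a_pG.
set X := k *m L *m k^T in pX *.
have reg H1 : regular H1 -> \tr (X *m H1) <= f H1.
  move=> H1reg; have [aH1 _] := H1reg.
  have [m Km [mH1 mmax _]] := conj_commute_KG pX (a_pG aH1).
  have := mmax _ KG1; rewrite mul1mx trmx1 mulmx1 => /le_trans; apply.
  set L' := m *m X *m m^T in mH1 *.
  have aL' : L' \in a by apply: (regular_centralizer H1reg) => //; exact: pG_conj.
  have L'E : L' = (m *m k) *m L *m (m *m k)^T by rewrite /L' /X trmx_mul !mulmxA.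
  rewrite L'E in aL' *.
  have [w Kw [wa ->]] := fusion Preg aL (KGM Km Kk) aL'.
  rewrite -!mulmxA mxtrace_mulC -!mulmxA (mulmxA w H1).
  by apply: le_trans (Lf _ (wa _ aH1)) _; exact: fK.
rewrite -subr_le0; apply/ler_addgt0Pl => e e0; rewrite addr0.
pose D := f P - \tr (X *m P).
have D1 : 0 < `|D| + 1 by rewrite ltr_wpDl.
have [t [t0 te treg]] := regular_near Preg aH (divr_gt0 e0 D1).
have := reg _ treg; rewrite mulmxDr -scalemxAr linearD/= linearZ/= => tr1.
have := fD aH (memvZ t aP'); rewrite fZ ?(ltW t0)// => f1.
have : t * D <= e.
  apply: (@le_trans _ _ (t * (`|D| + 1))).
    by rewrite ler_wpM2l ?(ltW t0)// (le_trans (ler_norm _))// lerDl.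
  by rewrite -ler_pdivlMr// ltW.
by rewrite /D; lra.
Qed.

Lemma dg1 i : dg 1%:M i = 1.
Proof. by rewrite /dg cj1 mxE eqxx. Qed.

(** Twice the pairing of L with the logarithm of the diagonal part, insensitive to signs; additive
    on [BG] because diagonals multiply there. *)
Definition bL L b := \sum_i dg L i * ln (dg b i ^+ 2).

Lemma BG_diag_sq_gt0 b i : BG P b -> 0 < dg b i ^+ 2.
Proof.
move=> [Gb sb sb']; have := BG_diag i sb sb'.
rewrite mulmxV ?(matrix_group_unit Ggrp Gb)// dg1 => /esym/eqP bb.
rewrite exprn_even_gt0//=.
by apply: contraTneq bb => ->; rewrite mul0r eq_sym oner_eq0.
Qed.

Lemma bLM L b c : BG P b -> BG P c -> bL L (b *m c) = bL L b + bL L c.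
Proof.
move=> Bb Bc; rewrite /bL -big_split/=; apply: eq_bigr => i _.
have [_ sb _] := Bb; have [_ sc _] := Bc.
by rewrite (BG_diag i sb sc) exprMn lnM ?posrE ?BG_diag_sq_gt0// mulrDr.
Qed.

Lemma bL_uniq L k b k' b' : KG k -> KG k' -> BG P b -> BG P b' ->
  k *m b = k' *m b' -> bL L b = bL L b'.
Proof.
move=> Kk Kk' Bb Bb' E; have ub := matrix_group_unit Ggrp (let: And3 h _ _ := Bb in h).
have cE : b' *m invmx b = k'^T *m k.
  have : k'^T *m (k *m b) *m invmx b = k'^T *m k by rewrite mulmxA mulmxK.
  by rewrite E !mulmxA (KG_orth' Kk') mul1mx.
have Bc : BG P (b' *m invmx b) by apply: BGM => //; exact: BGV.
have Kc : KG (b' *m invmx b) by rewrite cE; apply: KGM => //; exact: KGT.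
rewrite -[b'](mulmxKV ub) bLM// [X in X + _](_ : _ = 0) ?add0r//.
by rewrite /bL big1// => i _; rewrite (KG_BG_diag i Kc Bc) ln1 mulr0.
Qed.

Lemma tr_dg L M : L \in a -> \tr (L *m M) = \sum_i dg L i * dg M i.
Proof.
move=> aL; rewrite -tr_cj cjM cj_a// /dg; move: (cj M) (cj L) => X Y.
by rewrite mul_diag_mx; apply: eq_bigr => i _; rewrite !mxE.
Qed.

Lemma dg_sq_le_gram b i : dg b i ^+ 2 <= dg (b^T *m b) i.
Proof.
rewrite /dg cjM cjT; move: (cj b) => X; rewrite mxE (bigD1 i)//= mxE -expr2 lerDl.
by apply: sumr_ge0 => k _; rewrite mxE -expr2 sqr_ge0.
Qed.

Lemma ln_le_sub1 (x : R) : 0 < x -> ln x <= x - 1.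
Proof.
move=> x0; have := @le_ln1Dx R (x - 1); rewrite [1 + _]addrC subrK; apply.
by rewrite ltrBrDl subrr.
Qed.

Lemma norm_dg M i : `|dg M i| <= (n * n)%:R * nrm M * (n * n)%:R.
Proof.
apply: le_trans (nrm_entry _ _ _) _; apply: le_trans (nrmM _ _) _.
have uT := orthogonal_bounded uu; apply: ler_pM; rewrite ?nrm_ge0 ?nrm_trmx//.
by apply: le_trans (nrmM _ _) _; rewrite ler_wpM2r ?nrm_ge0.
Qed.

(** From b^T b = k^T exp(2sH) k, the logarithm of the squared diagonal of b is, up to O(s^2), 2s
    times the diagonal of k^T H k; pairing with L gives 2s tr(k L k^T H). That [C] does not depend
    on k is what allows the steps to be summed. *)
Lemma kostant_step L H : dual L -> H \in a -> exists2 C, 0 <= C & forall s k k' b,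
  0 <= s <= 1 -> KG k -> KG k' -> BG P b -> mxexp (s *: H) *m k = k' *m b ->
  bL L b <= 2 * s * f H + C * s ^+ 2.
Proof.
move=> Ldual aH; have [aL _] := Ldual.
have [C C0 CP] := mxexp_scale_rem1 (2 *: H).
have [C' C'0 C'P] := mxexp_scale_rem1 (- (2 *: H)).
pose N := ((n * n)%:R : R); have N0 : 0 <= N by [].
(* [N] bounds the norm of an orthogonal matrix: one pair of factors for conjugation by k, one for
   conjugation by u. *)
pose M := N * (N * (C + C') * N) * N.
have M0 : 0 <= M by rewrite !mulr_ge0// addr_ge0.
exists (\sum_i `|dg L i| * M); first by apply: sumr_ge0 => i _; rewrite mulr_ge0.
move=> s k k' b s01 Kk Kk' Bb kb.
have [kk kk'] := (KG_orth Kk, KG_orth' Kk).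
have ub := matrix_group_unit Ggrp (let: And3 h _ _ := Bb in h).
have Es : (mxexp (s *: H))^T = mxexp (s *: H) by apply: mxexp_sym; rewrite linearZ/= a_sym.
have gram : b^T *m b = k^T *m mxexp (s *: (2 *: H)) *m k.
  have -> : s *: (2 *: H) = s *: H + s *: H by rewrite scalerA mulrC -scalerA scaler_nat mulr2n.
  rewrite mxexpD// mulmxA -mulmxA kb -{1}Es -trmx_mul kb trmx_mul.
  by rewrite -mulmxA (mulmxA k'^T) (KG_orth' Kk') mul1mx.
have gram' : invmx b *m (invmx b)^T = k^T *m mxexp (s *: - (2 *: H)) *m k.
  have g1 : b^T *m b *m (k^T *m mxexp (s *: - (2 *: H)) *m k) = 1%:M.
    rewrite gram !mulmxA -(mulmxA _ k k^T) kk mulmx1 scalerN -(mulmxA k^T) mxexpN.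
    by rewrite mulmx1.
  have ubb : b^T *m b \in unitmx by rewrite unitmx_mul unitmx_tr ub.
  rewrite -[RHS](mulKmx ubb) g1 mulmx1 trmx_inv.
  have g2 : b^T *m b *m (invmx b *m invmx b^T) = 1%:M.
    by rewrite mulmxA mulmxK// mulmxV// unitmx_tr.
  by rewrite -[LHS](mulKmx ubb) g2 mulmx1.
pose x i := dg (k^T *m H *m k) i.
have dgX (c : R) Q : nrm (mxexp (s *: (c *: H)) - (1%:M + s *: (c *: H))) <= Q * s ^+ 2 ->
    0 <= Q -> Q <= C + C' -> forall i,
    dg (k^T *m mxexp (s *: (c *: H)) *m k) i - 1 <= c * s * x i + M * s ^+ 2.
  move=> rQ Q0 QC i; set E := mxexp _ in rQ *; set r := E - _ in rQ.
  have -> : dg (k^T *m E *m k) i - 1 = c * s * x i + dg (k^T *m r *m k) i.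
    have -> : k^T *m E *m k = 1%:M + ((c * s) *: (k^T *m H *m k) + k^T *m r *m k).
      rewrite -[E](subrK (1%:M + s *: (c *: H))) -/r !mulmxDr !mulmxDl mulmx1 kk'.
      rewrite -!scalemxAr -!scalemxAl scalerA [s * c]mulrC.
      by rewrite addrC -addrA.
    rewrite /dg !cjD cj1 cjZ /x /dg.
    move: (cj (k^T *m H *m k)) (cj (k^T *m r *m k)) => U V.
    by rewrite !mxE eqxx addrAC subrr add0r.
  rewrite lerD2l; apply: le_trans (ler_norm _) _; apply: le_trans (norm_dg _ _) _.
  have nr : nrm (k^T *m r *m k) <= N * ((C + C') * s ^+ 2) * N.
    apply: le_trans (nrmM _ _) _; apply: ler_pM; rewrite ?nrm_ge0 ?orthogonal_bounded//.
    apply: le_trans (nrmM _ _) _.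
    apply: ler_pM; rewrite ?nrm_ge0 ?nrm_trmx ?orthogonal_bounded//.
    by apply: le_trans rQ _; rewrite ler_wpM2r ?sqr_ge0.
  have -> : M * s ^+ 2 = N * (N * ((C + C') * s ^+ 2) * N) * N by rewrite /M; ring.
  by rewrite ler_wpM2r// ler_wpM2l.
have up i : ln (dg b i ^+ 2) <= 2 * s * x i + M * s ^+ 2.
  apply: le_trans (ln_le_sub1 (BG_diag_sq_gt0 i Bb)) _.
  apply: (@le_trans _ _ (dg (b^T *m b) i - 1)); first by rewrite lerD2r dg_sq_le_gram.
  by rewrite gram; apply: dgX (CP s s01) _ _ _; rewrite ?lerDl.
(* The Gram matrix bounds the squared diagonal from above only, so the lower bound comes from the
   inverse of b and exp(-2sH). Both are needed since [dg L i] has either sign. *)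
have dn i : - ln (dg b i ^+ 2) <= - (2 * s * x i) + M * s ^+ 2.
  have Bb' := BGV Bb; have [_ sb sb'] := Bb.
  have bb' : dg b i * dg (invmx b) i = 1.
    by rewrite -(BG_diag i sb sb') mulmxV// dg1.
  have -> : - ln (dg b i ^+ 2) = ln (dg (invmx b) i ^+ 2).
    apply/eqP; rewrite eq_sym -addr_eq0 -lnM ?posrE ?BG_diag_sq_gt0//.
    by rewrite -exprMn mulrC bb' expr1n ln1.
  apply: le_trans (ln_le_sub1 (BG_diag_sq_gt0 i Bb')) _.
  apply: (@le_trans _ _ (dg (invmx b *m (invmx b)^T) i - 1)).
    rewrite lerD2r; have := dg_sq_le_gram (invmx b)^T i.
    by rewrite trmxK /dg cjT [(cj _)^T i i]mxE.
  rewrite gram' -mulNr -mulNr -[- (2 *: H)]scaleNr.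
  by apply: (dgX (- 2) C') => //; [rewrite scaleNr; exact: C'P|rewrite lerDr].
have -> : 2 * s * f H + (\sum_i `|dg L i| * M) * s ^+ 2 =
    2 * s * f H + \sum_i `|dg L i| * M * s ^+ 2 by rewrite mulr_suml.
apply: (@le_trans _ _ (\sum_i (dg L i * (2 * s * x i) + `|dg L i| * M * s ^+ 2))).
  apply: ler_sum => i _; rewrite -[X in _ + X]mulrA; have [l0|l0] := leP 0 (dg L i).
    by rewrite ger0_norm// -mulrDr ler_wpM2l.
  rewrite ltr0_norm// -[dg L i * ln _]mulrNN -[dg L i * (_ * _)]mulrNN -mulrDr.
  by rewrite ler_wpM2l// oppr_ge0 ltW.
rewrite big_split/= lerD2r.
have -> : \sum_i dg L i * (2 * s * x i) = 2 * s * \tr (k *m L *m k^T *m H).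
  rewrite -!mulmxA mxtrace_mulC -!mulmxA (mulmxA k^T) tr_dg// mulr_sumr.
  by apply: eq_bigr => i _; rewrite mulrCA.
have [s0 _] := andP s01.
by rewrite ler_wpM2l ?mulr_ge0//; exact: linear_kostant.
Qed.

(** Apply N+1 steps of length s = 1/(N+1), each starting from the orthogonal factor left by the
    previous one; the errors add up to C/(N+1). *)
Lemma kostant L H k k' b : dual L -> H \in a -> KG k -> KG k' -> BG P b ->
  mxexp H *m k = k' *m b -> bL L b <= 2 * f H.
Proof.
move=> Ldual aH Kk Kk' Bb kb; have [C C0 CP] := kostant_step Ldual aH.
rewrite -subr_le0; apply/ler_addgt0Pl => e e0; rewrite addr0.
have [N NP] : exists N : nat, C / e < N.+1%:R.
  by exists (Num.truncn (C / e)); rewrite truncnS_gt.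
pose s : R := N.+1%:R^-1.
have s0 : 0 < s by rewrite invr_gt0.
have s01 : 0 <= s <= 1 by rewrite ltW//= invf_le1// ler1n.
have step m : exists km bm, [/\ KG km, BG P bm,
    mxexp ((m%:R * s) *: H) *m k = km *m bm &
    bL L bm <= m%:R * (2 * s * f H + C * s ^+ 2)].
  elim: m => [|m [km [bm [Kkm Bbm kbm bLm]]]].
    exists k, 1%:M; split=> //.
    - by split; rewrite ?invmx1; [exact: matrix_group1 Ggrp|exact: shape1|exact: shape1].
    - by rewrite mul0r scale0r mxexp0 mulmx1 mul1mx.
    - rewrite mul0r /bL big1// => i _.
      by rewrite dg1 expr1n ln1 mulr0.
  have GE : G (mxexp (s *: H) *m km).
    by apply: matrix_groupM => //; [case: (a_pG aH) => GH _; exact: GH|case: Kkm].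
  have [k1 [b1 [Kk1 Bb1 kb1]]] := iwasawa Preg GE.
  exists k1, (b1 *m bm); split=> //; first exact: BGM.
    rewrite -natr1 mulrDl mul1r [_ + s]addrC mxexp_scaleD -mulmxA kbm !mulmxA.
    by rewrite kb1.
  rewrite bLM// -natr1 mulrDl mul1r addrC; apply: lerD => //.
  exact: CP s01 Kkm Kk1 Bb1 kb1.
have [km [bm [Kkm Bbm kbm bLm]]] := step N.+1.
have Ns : N.+1%:R * s = 1 by rewrite /s mulfV.
rewrite Ns scale1r in kbm.
rewrite (bL_uniq L Kk' Kkm Bb Bbm) -?kb// lerBlDr.
apply: le_trans bLm _.
have -> : N.+1%:R * (2 * s * f H + C * s ^+ 2) = N.+1%:R * s * (2 * f H + C * s) by ring.
rewrite Ns mul1r addrC lerD2r /s ler_pdivrMr// mulrC -ler_pdivrMr//.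
exact: ltW.
Qed.

Lemma a_BG H : H \in a -> BG P (mxexp H).
Proof.
move=> aH; have [GH _] := a_pG aH; rewrite -[H]scale1r; apply: Lie_BG => //.
by move=> i j ij _; rewrite cj_a// mxE (negbTE ij).
Qed.

Theorem triangle_exp H1 H2 H3 k k' k'' : H1 \in a -> H2 \in a -> H3 \in a ->
  KG k -> KG k' -> KG k'' ->
  mxexp H1 *m k *m mxexp H2 = k' *m mxexp H3 *m k'' -> f H3 <= f H1 + f H2.
Proof.
move=> aH1 aH2 aH3 Kk Kk' Kk'' E.
(* The functional L attains f at H3, so [bL] of exp(H3) equals 2 f(H3), while its two Iwasawa pieces
   are bounded by 2 f(H1) and 2 f(H2). *)
have [L aL [LH3 Lf]] := fdual aH3; have Ldual : dual L by [].
have GE H : H \in a -> G (mxexp H) by move=> /a_BG[].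
have Kk''T := KGT Kk''.
have [k2 [b2 [Kk2 Bb2 kb2]]] : exists k b, [/\ KG k, BG P b & mxexp H2 *m k''^T = k *m b].
  by apply: iwasawa => //; apply: matrix_groupM => //; [exact: GE|case: Kk''T].
have Kkk2 : KG (k *m k2) by exact: KGM.
have [k1 [b1 [Kk1 Bb1 kb1]]] : exists k' b, [/\ KG k', BG P b & mxexp H1 *m (k *m k2) = k' *m b].
  by apply: iwasawa => //; apply: matrix_groupM => //; [exact: GE|case: Kkk2].
have E2 : k' *m mxexp H3 = k1 *m (b1 *m b2).
  have -> : k' *m mxexp H3 = k' *m mxexp H3 *m k'' *m k''^T.
    by rewrite -(mulmxA _ k'') (KG_orth Kk'') mulmx1.
  by rewrite -E mulmxA -kb1 -!mulmxA kb2.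
have := bL_uniq L Kk' Kk1 (a_BG aH3) (BGM Bb1 Bb2) E2.
rewrite bLM// => bL3.
have bL3E : bL L (mxexp H3) = 2 * f H3.
  rewrite -LH3 tr_dg// mulr_sumr; apply: eq_bigr => i _.
  have -> : dg (mxexp H3) i = expR (dg H3 i).
    have -> : H3 = u^T *m diag_mx (\row_i dg H3 i) *m u.
      by apply: cj_inj; rewrite cjK -cj_a.
    by rewrite mxexp_conj// mxexp_diag /dg !cjK !mxE eqxx !mulr1n.
  by rewrite -expRM_natl expRK mulrCA.
have f1 := kostant Ldual aH1 Kkk2 Kk1 Bb1 kb1.
have f2 := kostant Ldual aH2 Kk''T Kk2 Bb2 kb2.
by move: bL3E f1 f2; rewrite bL3; lra.
Qed.

End Triangle.

End SymmetricSpace.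

(** * Split tori *)

Section Dedekind.
Variables (T : Type) (op : T -> T -> T) (one : T) (K : fieldType).

Lemma dedekind (I : eqType) (s : seq I) (c : I -> K) (chi : I -> T -> K) : uniq s ->
  (forall i x y, chi i (op x y) = chi i x * chi i y) -> (forall i, chi i one = 1) ->
  {in s &, injective chi} ->
  (forall x, \sum_(i <- s) c i * chi i x = 0) -> {in s, forall i, c i = 0}.
Proof.
move=> + chiM chi1; elim: s c => [//|i0 s IH] c /= /andP[i0s us] cinj sum0.
have cs : {in s, forall i, c i = 0}.
  move=> i is_; have [x xi] : exists x, chi i x != chi i0 x.
    apply/not_existsP => eqx; move: i0s; rewrite -[i0](cinj i i0) ?inE ?eqxx ?is_ ?orbT//.
    by apply/funext => x; apply/eqP/negPn/negP/eqx.
  have sinj : {in s &, injective chi}.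
    by move=> j k js ks; apply: cinj; rewrite inE ?js ?ks orbT.
  have sum1 y : \sum_(j <- s) c j * (chi j x - chi i0 x) * chi j y = 0.
    have sxy := sum0 (op x y); have sy := sum0 y; rewrite !big_cons in sxy sy.
    have -> : \sum_(j <- s) c j * (chi j x - chi i0 x) * chi j y =
        \sum_(j <- s) c j * chi j (op x y) - chi i0 x * \sum_(j <- s) c j * chi j y.
      by rewrite mulr_sumr -sumrB; apply: eq_bigr => j _; rewrite chiM; ring.
    have -> : \sum_(j <- s) c j * chi j (op x y) = - (c i0 * chi i0 (op x y)).
      by apply/eqP; rewrite -addr_eq0 addrC sxy.
    have -> : \sum_(j <- s) c j * chi j y = - (c i0 * chi i0 y).
      by apply/eqP; rewrite -addr_eq0 addrC sy.
    by rewrite chiM; ring.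
  have /eqP := IH _ us sinj sum1 i is_.
  by rewrite mulf_eq0 subr_eq0 (negbTE xi) orbF => /eqP.
move=> i; rewrite inE => /orP[/eqP->|/cs//].
have := sum0 one; rewrite big_cons chi1 mulr1 big_seq big1 ?addr0// => j js.
by rewrite cs// mul0r.
Qed.

(** Group the indices by equal characters: by independence the coefficients of each group sum to 0,
    and z is constant on each group. *)
Lemma dedekind_transfer (L : fieldType) (f : {rmorphism K -> L}) (I : finType)
    (c : I -> K) (chi : I -> T -> K) (z : I -> L) :
  (forall i x y, chi i (op x y) = chi i x * chi i y) -> (forall i, chi i one = 1) ->
  (forall i j, chi i = chi j -> z i = z j) ->
  (forall x, \sum_i c i * chi i x = 0) -> \sum_i f (c i) * z i = 0.
Proof.
move=> chiM chi1 chiz sum0.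
pose rep i := odflt i [pick j | `[< chi j = chi i >]].
have repE i : chi (rep i) = chi i.
  by rewrite /rep; case: pickP => [j /asboolP //|_].
have rep_eq i j : chi i = chi j -> rep i = rep j.
  by move=> ij; rewrite /rep ij; case: pickP => // /(_ j) /asboolP; case.
have reprep i : rep (rep i) = rep i by apply: rep_eq.
pose s := [seq i <- enum I | rep i == i].
have us : uniq s by rewrite filter_uniq// enum_uniq.
have sinj : {in s &, injective chi}.
  move=> i j; rewrite !mem_filter => /andP[/eqP ii _] /andP[/eqP jj _] ij.
  by rewrite -ii -jj; exact: rep_eq.
have split (V : nmodType) (F : I -> V) :
    \sum_i F i = \sum_(j <- s) \sum_(i | rep i == j) F i.
  rewrite (partition_big rep (fun j => rep j == j))/=; last by move=> i _; rewrite reprep.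
  by rewrite /s big_filter big_enum_cond.
have sum1 x : \sum_(j <- s) (\sum_(i | rep i == j) c i) * chi j x = 0.
  rewrite -[RHS](sum0 x) [RHS]split; apply: eq_bigr => j _; rewrite mulr_suml.
  by apply: eq_bigr => i /eqP <-; rewrite repE.
have := dedekind us chiM chi1 sinj sum1 => c0.
rewrite split big_seq big1// => j js.
transitivity (\sum_(i | rep i == j) f (c i) * z j).
  by apply: eq_bigr => i /eqP ij; congr (_ * _); apply: chiz; rewrite -ij repE.
by rewrite -mulr_suml -rmorph_sum c0// rmorph0 mul0r.
Qed.

End Dedekind.

(** * Polynomial identities carried along multiplicative families *)

Section EvalMorph.
Variables (A : comNzRingType) (n : nat).

Lemma evalmx_morph (B C : comNzRingType) (phi : {rmorphism B -> C}) (g : A -> B)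
    (p : mpoly.mpoly (n * n) A) (M : 'M[B]_n) :
  phi (evalmx g p M) = evalmx (phi \o g) p (map_mx phi M).
Proof.
rewrite /evalmx /mpoly.mmap rmorph_sum; apply: eq_bigr => m _; rewrite rmorphM.
congr (_ * _); rewrite /mpoly.mmap1 rmorph_prod; apply: eq_bigr => k _.
by rewrite rmorphXn; case/mxvec_indexP: k => i j; rewrite !mxvecE mxE.
Qed.

Lemma points_morph (B C : fieldType) (phi : {rmorphism B -> C}) (g : A -> B)
    (P : seq (mpoly.mpoly (n * n) A)) (M : 'M[B]_n) :
  points (phi \o g) P (map_mx phi M) <-> points g P M.
Proof.
rewrite /points/=; elim: P => //= p P IH; rewrite -evalmx_morph fmorph_eq0.
by split=> /andP[-> /IH].
Qed.

End EvalMorph.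

Section PolynomialTransfer.
Variables (T : Type) (op : T -> T -> T) (one : T).
Variables (K0 : comNzRingType) (K L : fieldType) (g : {rmorphism K0 -> K}) (f : {rmorphism K -> L}).
Variables (N : nat) (x : T -> 'I_N -> K) (z : 'I_N -> L).
Hypothesis xM : forall a b i, x (op a b) i = x a i * x b i.
Hypothesis x1 : forall i, x one i = 1.
Hypothesis xz : forall m m' : 'I_N -> nat,
  (forall a, \prod_i x a i ^+ m i = \prod_i x a i ^+ m' i) ->
  \prod_i z i ^+ m i = \prod_i z i ^+ m' i.

(** Monomials in the coordinates [x] are characters. A polynomial that vanishes on the family
    therefore vanishes at every z satisfying the same monomial relations: a form of Zariski density
    used for tori and for real powers. *)
Lemma mpoly_transfer (F : mpoly.mpoly N K) : (forall a, mpoly.mmap idfun (x a) F = 0) ->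
  mpoly.mmap f z F = 0.
Proof.
move=> F0; pose s := mpoly.msupp F.
rewrite /mpoly.mmap -/s big_tnth.
pose mm (i : 'I_(size s)) := tnth (in_tuple s) i.
apply: (dedekind_transfer (op := op) (one := one) f
  (c := fun i => mpoly.mcoeff (mm i) F) (chi := fun i a => mpoly.mmap1 (x a) (mm i))
  (z := fun i => mpoly.mmap1 z (mm i))).
- move=> i a b; rewrite /mpoly.mmap1 -big_split/=.
  by apply: eq_bigr => k _; rewrite xM exprMn.
- by move=> i; rewrite /mpoly.mmap1 big1// => k _; rewrite x1 expr1n.
- by move=> i j ij; apply: xz => a; exact: (congr1 (fun h => h a) ij).
- by move=> a; have := F0 a; rewrite /mpoly.mmap -/s big_tnth.
Qed.

Lemma mmap_evalmx (L' : fieldType) (f' : {rmorphism K -> L'}) (y : 'I_N -> L') n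
    (Phi : 'M[mpoly.mpoly N K]_n) p :
  mpoly.mmap f' y (evalmx (@mpoly.mpolyC N K \o g) p Phi) =
  evalmx (f' \o g) p (map_mx (mpoly.mmap f' y) Phi).
Proof.
rewrite evalmx_morph /evalmx /mpoly.mmap; apply: eq_bigr => m _.
by rewrite /= mpoly.mmapC.
Qed.

Lemma points_mpoly_transfer n (Phi : 'M[mpoly.mpoly N K]_n) P :
  (forall a, points g P (map_mx (mpoly.mmap idfun (x a)) Phi)) ->
  points (f \o g) P (map_mx (mpoly.mmap f z) Phi).
Proof.
rewrite /points/=; elim: P => //= p P IH pP; apply/andP; split; last first.
  by apply: IH => a; have /andP[] := pP a.
rewrite -mmap_evalmx; apply/eqP/mpoly_transfer => a.
by rewrite mmap_evalmx; have /andP[/eqP <- _] := pP a.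
Qed.

End PolynomialTransfer.

Section DiagonalTransfer.
Variables (T : Type) (op : T -> T -> T) (one : T).
Variables (K0 : comNzRingType) (K L : fieldType) (g : {rmorphism K0 -> K}) (f : {rmorphism K -> L}).
Variables (n : nat) (u : 'M[K]_n) (x : T -> 'I_n -> K) (z : 'I_n -> L).
Hypothesis xM : forall a b i, x (op a b) i = x a i * x b i.
Hypothesis x1 : forall i, x one i = 1.
Hypothesis xz : forall m m' : 'I_n -> nat,
  (forall a, \prod_i x a i ^+ m i = \prod_i x a i ^+ m' i) ->
  \prod_i z i ^+ m i = \prod_i z i ^+ m' i.

Lemma points_transfer (P : seq (mpoly.mpoly (n * n) K0)) :
  (forall a, points g P (u^T *m diag_mx (\row_i x a i) *m u)) ->
  points (f \o g) P ((map_mx f u)^T *m diag_mx (\row_i z i) *m map_mx f u).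
Proof.
pose D : 'M[mpoly.mpoly n K]_n := diag_mx (\row_i mpoly.mpolyX K (mpoly.mnm1 i)).
pose M := map_mx (@mpoly.mpolyC n K) u^T *m D *m map_mx (@mpoly.mpolyC n K) u.
have ME (L' : fieldType) (f' : {rmorphism K -> L'}) (y : 'I_n -> L') :
    map_mx (mpoly.mmap f' y) M =
    (map_mx f' u)^T *m diag_mx (\row_i y i) *m map_mx f' u.
  have UE w : map_mx (mpoly.mmap f' y) (map_mx (@mpoly.mpolyC n K) w) = map_mx f' w.
    by apply/matrixP => i j; rewrite !mxE mpoly.mmapC.
  have DE : map_mx (mpoly.mmap f' y) D = diag_mx (\row_i y i).
    apply/matrixP => i j; rewrite !mxE.
    case: (eqVneq i j) => [->|_]; rewrite ?mulr1n ?mulr0n; last exact: mpoly.mmap0.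
    by rewrite mpoly.mmapX mpoly.mmap1U.
  by rewrite /M !map_mxM /= !UE DE map_trmx.
move=> xP; rewrite -ME; have := @points_mpoly_transfer _ op one _ _ _ g f _ x z xM x1 xz _ M P; apply => a.
by rewrite ME map_mx_id.
Qed.

End DiagonalTransfer.

(** * Saturated lattices and Laurent monomials *)

Section Lattice.
Variables (n : nat) (La : 'rV[int]_n -> Prop).
Hypothesis La0 : La 0.
Hypothesis LaD : forall a b, La a -> La b -> La (a + b).
Hypothesis LaZ : forall (c : int) a, La a -> La (c *: a).
Hypothesis La_sat : forall (c : int) a, c != 0 -> La (c *: a) -> La a.

Let La_sum (I : finType) (P : pred I) (F : I -> 'rV[int]_n) :
  (forall i, P i -> La (F i)) -> La (\sum_(i | P i) F i).
Proof. by move=> LF; elim/big_ind: _ => //; exact: LaD. Qed.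

Let La_mul k (c : 'rV[int]_k) (M : 'M[int]_(k, n)) :
  (forall i, La (row i M)) -> La (c *m M).
Proof.
by move=> LM; rewrite mulmx_sum_row; apply: La_sum => i _; exact: LaZ.
Qed.

(* Smith normal form of an integral matrix spanning the rational closure. *)
Lemma saturated_lattice_basis : exists2 V : 'M[int]_n, V \in unitmx &
  exists J : pred 'I_n, forall m, La m <-> forall j, ~~ J j -> (m *m invmx V) 0 j = 0.
Proof.
pose Q (M : 'M[int]_n) : 'M[rat]_n := map_mx intr M.
pose P r := `[< exists k (M : 'M[int]_(k, n)), (forall i, La (row i M)) /\
  \rank (map_mx intr M : 'M[rat]_(k, n)) = r >].
have P0 : exists r, P r.
  exists 0%N; apply/asboolP; exists 0%N, 0; split; first by case.
  by rewrite map_mx0 mxrank0.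
have Pn r : P r -> (r <= n)%N by move=> /asboolP[k [M [_ <-]]]; exact: rank_leq_col.
case: (ex_maxnP P0 Pn) => r /asboolP[k [M [LM rM]]] rmax {P0 Pn}.
have [L uL [V uV [d _ ME]]] := int_Smith_normal_form M.
set D := (\matrix_(i, j) _) in ME.
(* As M has maximal rank, any m in the lattice is a rational combination of the rows of M = L D V,
   so its coordinates in the rows of V live where d_j is nonzero. Conversely, d_j times row j of V
   is an integral combination of rows of M, and saturation divides by d_j. *)
exists V => //; exists (fun j => (j < k)%N && (d`_j != 0)) => m; split=> [Lm j|Hm].
  move=> Jj; pose N := col_mx M m.
  have rN : (\rank (map_mx intr N : 'M[rat]_(k + 1, n)) <= r)%N.
    apply: rmax; apply/asboolP; exists (k + 1)%N, N; split=> // i.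
    rewrite /N; case: (split_ordP i) => {}i ->; first by rewrite rowKu.
    by rewrite rowKd row_id.
  have MN : (map_mx intr M <= (map_mx intr N : 'M[rat]_(k + 1, n)))%MS.
    by rewrite map_col_mx -addsmxE addsmxSl.
  have NM : ((map_mx intr N : 'M[rat]_(k + 1, n)) <= map_mx intr M)%MS.
    by rewrite -(mxrank_leqif_sup MN) rM eqn_leq rN andbT -rM; exact: mxrankS MN.
  have /submxP[y yE] : ((map_mx intr m : 'rV[rat]_n) <= map_mx intr M)%MS.
    by apply: submx_trans NM; rewrite map_col_mx -addsmxE addsmxSr.
  have uVQ : map_mx intr V *m map_mx intr (invmx V) = 1%:M :> 'M[rat]_n.
    by rewrite -map_mxM mulmxV// map_mx1.
  apply/eqP; rewrite -(intr_eq0 rat); apply/eqP.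
  transitivity ((map_mx intr (m *m invmx V) : 'rV[rat]_n) 0 j); first by rewrite [RHS]mxE.
  rewrite map_mxM yE ME !map_mxM -!mulmxA uVQ mulmx1 mulmxA.
  rewrite mxE big1// => i _; rewrite !mxE; case: eqVneq => [ij|_]; last first.
    by rewrite mulr0n mulr0.
  move: Jj; rewrite -ij ltn_ord/= negbK => /eqP ->.
  by rewrite mul0rn mulr0.
have -> : m = (m *m invmx V) *m V by rewrite mulmxKV.
rewrite mulmx_sum_row; apply: La_sum => j _.
have [/andP[jk dj]|Jj] := boolP ((j < k)%N && (d`_j != 0)); last first.
  by rewrite Hm// scale0r.
apply/LaZ/(La_sat dj).
have -> : d`_j *: row j V = row (Ordinal jk) (invmx L *m M).
  rewrite ME !mulmxA mulVmx// mul1mx row_mul; apply/rowP => l; rewrite !mxE.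
  rewrite (bigD1 j)//= big1 ?addr0; last first.
    by move=> i; rewrite !mxE/= eq_sym -val_eqE/= => /negbTE ->; rewrite mulr0n mul0r.
  by rewrite !mxE/= eqxx mulr1n.
by rewrite row_mul; exact: La_mul.
Qed.

End Lattice.

Section LaurentMonomials.
Variables (L : fieldType).

Definition lmon n (y : 'I_n -> L) (m : 'rV[int]_n) := \prod_i y i ^ m 0 i.

Lemma lmonD n (y : 'I_n -> L) m m' : (forall i, y i != 0) ->
  lmon y (m + m') = lmon y m * lmon y m'.
Proof.
by move=> y0; rewrite -big_split; apply: eq_bigr => i _; rewrite mxE expfzDr.
Qed.

Lemma lmonZ n (y : 'I_n -> L) (c : int) (m : 'rV_n) : lmon y (c *: m) = lmon y m ^ c.
Proof.
rewrite /lmon (big_morph (fun x => x ^ c) (fun a b => expfzMl a b c) (exp1rz _ c)).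
by apply: eq_bigr => i _; rewrite mxE mulrC exprz_exp.
Qed.

Lemma lmon0 n (y : 'I_n -> L) : lmon y 0 = 1.
Proof. by rewrite /lmon big1// => i _; rewrite mxE expr0z. Qed.

Lemma lmon_neq0 n (y : 'I_n -> L) m : (forall i, y i != 0) -> lmon y m != 0.
Proof. by move=> y0; apply/prodf_neq0 => i _; rewrite expfz_neq0. Qed.

Lemma lmonM n (y z : 'I_n -> L) m : lmon (fun i => y i * z i) m = lmon y m * lmon z m.
Proof. by rewrite -big_split; apply: eq_bigr => i _; exact: expfzMl. Qed.

Lemma lmonV n (y : 'I_n -> L) m : lmon (fun i => (y i)^-1) m = (lmon y m)^-1.
Proof. by rewrite -prodfV; apply: eq_bigr => i _; rewrite exprz_inv invr_expz. Qed.

Lemma lmon_comp n k (w : 'I_k -> L) (y : 'I_n -> L) (W : 'M[int]_(n, k)) m :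
  (forall j, w j != 0) -> (forall i, y i = lmon w (row i W)) -> lmon y m = lmon w (m *m W).
Proof.
move=> w0 yE; rewrite mulmx_sum_row.
rewrite (big_morph (lmon w) (fun a b => lmonD a b w0) (lmon0 w)).
by apply: eq_bigr => i _; rewrite lmonZ yE.
Qed.

Lemma lmon_delta n (y : 'I_n -> L) i : lmon y (delta_mx 0 i) = y i.
Proof.
rewrite /lmon (bigD1 i)//= mxE !eqxx expr1z big1 ?mulr1// => j ji.
by rewrite mxE (negbTE ji) andbF expr0z.
Qed.

(** With [zneg], splits an exponent into two natural ones, so that a Laurent relation becomes an
    equality of two monomials. *)
Definition zpos (z : int) := if z is Posz k then k else 0%N.
Definition zneg (z : int) := if z is Negz k then k.+1 else 0%N.

Lemma exprz_zpos (y y' : L) z : y * y' = 1 -> y ^+ zpos z * y' ^+ zneg z = y ^ z.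
Proof.
move=> yy'; have y0 : y != 0.
  by apply: contra_eq_neq yy' => ->; rewrite mul0r eq_sym oner_neq0.
have -> : y' = y^-1 by rewrite -[LHS](mulKf y0) yy' mulr1.
by case: z => k /=; rewrite ?mulr1 ?mul1r// exprVn.
Qed.

Lemma lmon_natB n (y : 'I_n -> L) (m m' : 'I_n -> nat) : (forall i, y i != 0) ->
  (\prod_i y i ^+ m i = \prod_i y i ^+ m' i) <->
  lmon y (\row_i (m i)%:Z - \row_i (m' i)%:Z) = 1.
Proof.
move=> y0; rewrite lmonD// -scaleN1r lmonZ exprN1.
have E f : lmon y (\row_i (f i)%:Z) = \prod_i y i ^+ f i.
  by apply: eq_bigr => i _; rewrite mxE.
rewrite !E; have P0 : \prod_i y i ^+ m' i != 0.
  by apply/prodf_neq0 => i _; rewrite expf_neq0.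
split=> [->|/eqP]; first by rewrite divff.
by rewrite -[X in _ == X](divff P0) (inj_eq (mulIf _)) ?invr_eq0// => /eqP.
Qed.

Lemma lmon_eq1_sign n (y : 'I_n -> L) m : (forall i, y i != 0) ->
  (lmon y m = 1) <-> \prod_i y i ^+ zpos (m 0 i) = \prod_i y i ^+ zneg (m 0 i).
Proof.
move=> y0; rewrite lmon_natB//; have -> // :
  (\row_i (zpos (m 0 i))%:Z - \row_i (zneg (m 0 i))%:Z) = m.
by apply/rowP => i; rewrite !mxE; case: (m 0 i) => k //=; rewrite ?subr0 ?sub0r.
Qed.

End LaurentMonomials.

(** * The diagonal split torus of a saturated lattice *)

Section DiagonalCoordinates.
Variables (L : fieldType) (n : nat) (U : 'M[L]_n).
Hypothesis UU : U *m U^T = 1%:M.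

Definition dmx (y : 'I_n -> L) : 'M[L]_n := U^T *m diag_mx (\row_i y i) *m U.
Definition dco (X : 'M[L]_n) (i : 'I_n) : L := (U *m X *m U^T) i i.

Let U'U : U^T *m U = 1%:M. Proof. exact: mulmx1C. Qed.

Lemma conj_dmx y : U *m dmx y *m U^T = diag_mx (\row_i y i).
Proof. by rewrite /dmx !mulmxA UU mul1mx -mulmxA UU mulmx1. Qed.

Lemma dco_dmx y i : dco (dmx y) i = y i.
Proof. by rewrite /dco conj_dmx !mxE eqxx. Qed.

Lemma is_diag_dmx y : is_diag_mx (U *m dmx y *m U^T).
Proof. by rewrite conj_dmx diag_mx_is_diag. Qed.

Lemma dmx_dco X : is_diag_mx (U *m X *m U^T) -> dmx (dco X) = X.
Proof.
move=> dX; have XE : X = U^T *m (U *m X *m U^T) *m U.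
  by rewrite !mulmxA U'U mul1mx -mulmxA U'U mulmx1.
rewrite [RHS]XE /dmx; congr (_ *m _ *m _); rewrite /dco.
move: (U *m X *m U^T) dX => W /is_diag_mxP dW; apply/matrixP => i j; rewrite !mxE.
by have [->|ij] := eqVneq i j; rewrite ?mulr1n// mulr0n dW.
Qed.

Lemma eq_dmx y z : y =1 z -> dmx y = dmx z.
Proof. by move=> /funext ->. Qed.

Lemma dmxM y z : dmx y *m dmx z = dmx (fun i => y i * z i).
Proof.
rewrite /dmx -!mulmxA (mulmxA U) UU mul1mx (mulmxA (diag_mx _) (diag_mx _)).
rewrite mulmx_diag; congr (_ *m (diag_mx _ *m _)).
by apply/rowP => i; rewrite !mxE.
Qed.

Lemma dmx1 : dmx (fun=> 1) = 1%:M.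
Proof.
rewrite /dmx (_ : \row__ _ = const_mx 1); last by apply/rowP => i; rewrite !mxE.
by rewrite diag_const_mx mulmx1 U'U.
Qed.

Lemma det_dmx y : \det (dmx y) = \prod_i y i.
Proof.
rewrite /dmx !det_mulmx mulrAC -det_mulmx U'U det1 mul1r det_diag.
by apply: eq_bigr => i _; rewrite mxE.
Qed.

Lemma dmx_unit y : (forall i, y i != 0) -> dmx y \in unitmx.
Proof.
by move=> y0; rewrite unitmxE det_dmx unitfE; apply/prodf_neq0 => i _; exact: y0.
Qed.

Lemma dmxV y : (forall i, y i != 0) -> invmx (dmx y) = dmx (fun i => (y i)^-1).
Proof.
move=> y0; apply: (can_inj (mulKmx (dmx_unit y0))).
rewrite mulmxV ?dmx_unit// dmxM -dmx1; apply: eq_dmx => i.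
by rewrite divff.
Qed.

End DiagonalCoordinates.

Section Entries.
Variables (K : fieldType) (n : nat) (u : 'M[K]_n).

Let gen : 'M[mpoly.mpoly (n * n) K]_n :=
  \matrix_(i, j) mpoly.mpolyX K (mpoly.mnm1 (mxvec_index i j)).

Definition entry (i j : 'I_n) : mpoly.mpoly (n * n) K :=
  (map_mx (@mpoly.mpolyC _ K) u *m gen *m map_mx (@mpoly.mpolyC _ K) u^T) i j.

Lemma evalmx_entry (L : fieldType) (f : {rmorphism K -> L}) X i j :
  evalmx f (entry i j) X = (map_mx f u *m X *m (map_mx f u)^T) i j.
Proof.
rewrite /evalmx; set h := (fun k => _).
have UE v : map_mx (mpoly.mmap f h) (map_mx (@mpoly.mpolyC _ K) v) = map_mx f v.
  by apply/matrixP => a b; rewrite !mxE mpoly.mmapC.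
have GE : map_mx (mpoly.mmap f h) gen = X.
  by apply/matrixP => a b; rewrite !mxE mpoly.mmapX mpoly.mmap1U /h mxvecE.
transitivity (map_mx (mpoly.mmap f h)
    (map_mx (@mpoly.mpolyC _ K) u *m gen *m map_mx (@mpoly.mpolyC _ K) u^T) i j).
  by rewrite [RHS]mxE.
by rewrite !map_mxM !UE GE map_trmx.
Qed.

Lemma evalmx_dco (L : fieldType) (f : {rmorphism K -> L}) X i :
  evalmx f (entry i i) X = dco (map_mx f u) X i.
Proof. exact: evalmx_entry. Qed.

End Entries.

Section EvalRing.
Variables (K : fieldType) (L : fieldType) (f : {rmorphism K -> L}) (n : nat) (X : 'M[L]_n).
Implicit Types p q : mpoly.mpoly (n * n) K.

Lemma evalmxM p q : evalmx f (p * q) X = evalmx f p X * evalmx f q X.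
Proof. exact: (rmorphM (mpoly.mmap f (fun k => mxvec X 0 k))). Qed.
Lemma evalmxB p q : evalmx f (p - q) X = evalmx f p X - evalmx f q X.
Proof. exact: (rmorphB (mpoly.mmap f (fun k => mxvec X 0 k))). Qed.
Lemma evalmx1 : evalmx f 1 X = 1.
Proof. exact: (rmorph1 (mpoly.mmap f (fun k => mxvec X 0 k))). Qed.
Lemma evalmx_prod (I : finType) (P : pred I) F :
  evalmx f (\prod_(i | P i) F i) X = \prod_(i | P i) evalmx f (F i) X.
Proof. exact: (rmorph_prod (mpoly.mmap f (fun k => mxvec X 0 k))). Qed.
Lemma evalmxXn p k : evalmx f (p ^+ k) X = evalmx f p X ^+ k.
Proof. exact: (rmorphXn (mpoly.mmap f (fun k => mxvec X 0 k))). Qed.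

End EvalRing.

Section DiagonalTorus.
Variables (K : rcfType) (n : nat) (u : 'M[K]_n) (V : 'M[int]_n) (J : pred 'I_n).
Hypothesis uu : u *m u^T = 1%:M.
Hypothesis uV : V \in unitmx.
Hypothesis detJ : forall j, ~~ J j -> (const_mx 1 *m invmx V : 'rV_n) 0 j = 0.

Notation poly := (mpoly.mpoly (n * n) K).

Let relation (j : 'I_n) : poly :=
  \prod_i entry u i i ^+ zpos (V j i) - \prod_i entry u i i ^+ zneg (V j i).

(** The rows of V in J give the relations, the other rows give the coordinates. The equation that
    the product of the eigenvalues be 1 makes them invertible, so clearing denominators in the
    relations is harmless. *)
Definition diag_torus : seq poly :=
  [seq entry u ij.1 ij.2 | ij : 'I_n * 'I_n in [pred ij | ij.1 != ij.2]] ++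
  (\prod_i entry u i i - 1) :: [seq relation j | j : 'I_n in J].

Lemma diag_torusP (L : fieldType) (f : {rmorphism K -> L}) X :
  let U := map_mx f u in let y := dco U X in
  points f diag_torus X <->
  [/\ is_diag_mx (U *m X *m U^T), \prod_i y i = 1 &
    forall j, J j -> lmon y (row j V) = 1].
Proof.
move=> U y.
have y0 : \prod_i y i = 1 -> forall i, y i != 0.
  by move=> y1 i; apply: contra_eq_neq y1 => yi; rewrite (bigD1 i)//= yi mul0r eq_sym oner_neq0.
have relE j : evalmx f (relation j) X =
    \prod_i y i ^+ zpos (V j i) - \prod_i y i ^+ zneg (V j i).
  rewrite evalmxB !evalmx_prod; congr (_ - _); apply: eq_bigr => i _;
  by rewrite evalmxXn evalmx_dco.
have relP j : (forall i, y i != 0) -> lmon y (row j V) = 1 <->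
    \prod_i y i ^+ zpos (V j i) = \prod_i y i ^+ zneg (V j i).
  move=> yN0; rewrite lmon_eq1_sign//.
  have E (s : int -> nat) : \prod_i y i ^+ s (row j V 0 i) = \prod_i y i ^+ s (V j i).
    by apply: eq_bigr => i _; rewrite mxE.
  by rewrite (E zpos) (E zneg).
have prodE : evalmx f (\prod_i entry u i i - 1) X = \prod_i y i - 1.
  by rewrite evalmxB evalmx1 evalmx_prod; congr (_ - _); apply: eq_bigr => i _; rewrite evalmx_dco.
rewrite /points/= /diag_torus all_cat /= prodE subr_eq0; split.
  move=> /and3P[/allP dX /eqP py /allP rX]; split=> //.
    apply/is_diag_mxP => i j ij; rewrite -evalmx_entry; apply/eqP/dX.
    by apply/mapP; exists (i, j); rewrite // mem_enum.
  move=> j Jj; apply/relP; first exact: y0.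
  have /rX : relation j \in [seq relation j | j : 'I_n in J] by apply/mapP; exists j; rewrite // mem_enum.
  by rewrite relE subr_eq0 => /eqP.
move=> [/is_diag_mxP dX py rX]; apply/and3P; split; [|exact/eqP|].
  by apply/allP => p /mapP[[i j]]; rewrite mem_enum => ij ->; rewrite evalmx_entry dX.
apply/allP => p /mapP[j]; rewrite mem_enum => Jj ->; rewrite relE subr_eq0; apply/eqP.
by apply/relP; [exact: y0|exact: rX].
Qed.

Local Notation C := (K[i]).
Local Notation rc := (real_complex K).
Local Notation v := (map_mx rc u).

Let vv : v *m v^T = 1%:M.
Proof. by rewrite map_trmx -map_mxM uu map_mx1. Qed.

Lemma diag_torus_dmx (y : 'I_n -> C) :
  geom_points diag_torus (dmx v y) <->
  \prod_i y i = 1 /\ forall j, J j -> lmon y (row j V) = 1.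
Proof.
have dE : dco v (dmx v y) = y by apply/funext => i; exact: dco_dmx.
rewrite /geom_points; split.
  by move=> /(diag_torusP rc)/=; rewrite dE => -[].
by move=> [py rX]; apply/(diag_torusP rc); rewrite dE; split=> //; exact: is_diag_dmx.
Qed.

Lemma geom_diag_torus X : geom_points diag_torus X ->
  exists2 y, X = dmx v y & \prod_i y i = 1 /\ forall j, J j -> lmon y (row j V) = 1.
Proof.
move=> /(diag_torusP rc)/= [dX py rX]; exists (dco v X) => //.
by rewrite dmx_dco.
Qed.

Let prod1_neq0 (y : 'I_n -> C) : \prod_i y i = 1 -> forall i, y i != 0.
Proof.
by move=> y1 i; apply: contra_eq_neq y1 => yi; rewrite (bigD1 i)//= yi mul0r eq_sym oner_neq0.
Qed.

Lemma diag_torus_group : algebraic_group diag_torus.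
Proof.
split; last first.
  by move=> X /geom_diag_torus[y -> [py _]]; rewrite /= det_dmx.
split.
- rewrite -(dmx1 vv); apply/diag_torus_dmx; split=> [|j _]; first by rewrite big1.
  by rewrite /lmon big1// => i _; rewrite exp1rz.
- move=> _ _ /geom_diag_torus[y -> [py ry]] /geom_diag_torus[z -> [pz rz]].
  rewrite dmxM//; apply/diag_torus_dmx; split=> [|j Jj].
    by rewrite big_split/= py pz mulr1.
  by rewrite lmonM ry// rz// mulr1.
- move=> _ /geom_diag_torus[y -> [py ry]]; have y0 := prod1_neq0 py.
  split; first exact: dmx_unit.
  rewrite dmxV//; apply/diag_torus_dmx; split=> [|j Jj].
    by rewrite prodfV py invr1.
  by rewrite lmonV ry// invr1.
Qed.

Let r := #|[pred j | ~~ J j]|.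
Let e (k : 'I_r) : 'I_n := enum_val k.

(** Extends t by 1 on the indices in J; the product has at most one factor. *)
Let par (t : 'rV[C]_r) (j : 'I_n) : C := \prod_(k | e k == j) t 0 k.

Let parE t k : par t (e k) = t 0 k.
Proof. by rewrite /par (big_pred1 k)// => l; rewrite (inj_eq enum_val_inj). Qed.

Let parJ t j : J j -> par t j = 1.
Proof.
move=> Jj; rewrite /par big1// => k /eqP ek.
by have := enum_valP k; rewrite -/(e k) ek inE Jj.
Qed.

Let par_neq0 t j : Gm t -> par t j != 0.
Proof. by move=> t0; apply/prodf_neq0 => k _; exact: t0. Qed.

Let par_entry (i : 'I_n) : mpoly.mpoly (r + r) K :=
  \prod_k (mpoly.mpolyX K (mpoly.mnm1 (lshift r k)) ^+ zpos (invmx V i (e k)) *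
           mpoly.mpolyX K (mpoly.mnm1 (rshift r k)) ^+ zneg (invmx V i (e k))).

Let f (i j : 'I_n) : mpoly.mpoly (r + r) K :=
  (map_mx (@mpoly.mpolyC _ K) u^T *m diag_mx (\row_i par_entry i) *m
   map_mx (@mpoly.mpolyC _ K) u) i j.

(** The Laurent monomial of row [e k] of V: since the eigenvalues have product 1, the inverse of one
    is the product of the others. *)
Let h (k : 'I_r) : poly :=
  \prod_i (entry u i i ^+ zpos (V (e k) i) *
           (\prod_(l | l != i) entry u l l) ^+ zneg (V (e k) i)).

Let coord t (i : 'I_n) := lmon (par t) (row i (invmx V)).

Let phiE t : Gm t -> \matrix_(i, j) Gm_eval (f i j) t = dmx v (coord t).
Proof.
move=> t0; pose g := fun k => row_mx t (map_mx (fun c => c^-1) t) 0 k.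
have UE w : map_mx (mpoly.mmap rc g) (map_mx (@mpoly.mpolyC _ K) w) = map_mx rc w.
  by apply/matrixP => a b; rewrite !mxE mpoly.mmapC.
have DE : map_mx (mpoly.mmap rc g) (diag_mx (\row_i par_entry i)) =
    diag_mx (\row_i coord t i).
  apply/matrixP => a b; rewrite !mxE; case: (eqVneq a b) => [->|_]; last first.
    by rewrite !mulr0n mpoly.mmap0.
  rewrite !mulr1n rmorph_prod/=.
  have -> : coord t b = \prod_(j | ~~ J j) par t j ^ invmx V b j.
    rewrite /coord /lmon (bigID J)/= big1 ?mul1r; last by move=> j Jj; rewrite parJ// exp1rz.
    by apply: eq_bigr => j _; rewrite mxE.
  rewrite (big_enum_val (A := [pred j | ~~ J j]))/=; apply: eq_bigr => k _.
  rewrite parE rmorphM/= !rmorphXn/= !mpoly.mmapX !mpoly.mmap1U /g.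
  by rewrite row_mxEl row_mxEr mxE exprz_zpos// divff.
transitivity (map_mx (mpoly.mmap rc g) (map_mx (@mpoly.mpolyC _ K) u^T *m
    diag_mx (\row_i par_entry i) *m map_mx (@mpoly.mpolyC _ K) u)).
  by apply/matrixP => a b; rewrite [LHS]mxE [RHS]mxE.
by rewrite !map_mxM/= !UE DE -map_trmx.
Qed.

Let psiE y k : \prod_i y i = 1 -> evalmx rc (h k) (dmx v y) = lmon y (row (e k) V).
Proof.
move=> py; rewrite evalmx_prod; apply: eq_bigr => i _.
rewrite evalmxM !evalmxXn evalmx_prod evalmx_dco dco_dmx// mxE.
under eq_bigr do rewrite evalmx_dco dco_dmx//.
by rewrite exprz_zpos// -[RHS]py [RHS](bigD1 i)//=.
Qed.

Let lmon_coord t m : Gm t -> lmon (coord t) m = lmon (par t) (m *m invmx V).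
Proof. by move=> t0; apply: lmon_comp => // j; exact: par_neq0. Qed.

Let coord_rel t : Gm t ->
  \prod_i coord t i = 1 /\ forall j, lmon (coord t) (row j V) = par t j.
Proof.
move=> t0; split; last first.
  by move=> j; rewrite lmon_coord// -row_mul mulmxV// row1 lmon_delta.
transitivity (lmon (coord t) (const_mx 1)).
  by apply: eq_bigr => i _; rewrite mxE expr1z.
rewrite lmon_coord// /lmon big1// => j _.
have [Jj|Jj] := boolP (J j); first by rewrite parJ// exp1rz.
by rewrite detJ// expr0z.
Qed.

(** V and its inverse are integral, so the monomial maps they define are inverse to each other:
    J-coordinates equal to 1 describe the torus, the remaining ones are free. [detJ] ensures that
    free coordinates give eigenvalues with product 1. *)
Lemma diag_torus_split : split_torus diag_torus.
Proof.
split; first exact: diag_torus_group.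
exists r, f, h; split.
- move=> t t0; rewrite phiE//; apply/diag_torus_dmx.
  have [p1 rel] := coord_rel t0; split=> // j Jj; by rewrite rel parJ.
- move=> s /geom_diag_torus[y -> [py ry]] k.
  by rewrite mxE psiE//; apply/lmon_neq0/prod1_neq0.
- move=> t t0; apply/rowP => k; rewrite mxE phiE//.
  by have [p1 rel] := coord_rel t0; rewrite psiE// rel parE.
- move=> s /geom_diag_torus[y -> [py ry]]; have y0 := prod1_neq0 py.
  set t := \row_k _; have t0 : Gm t by move=> k; rewrite mxE psiE//; exact: lmon_neq0.
  apply: etrans (phiE t0) _; apply: eq_dmx => i; rewrite /coord.
  have -> : par t = (fun j => lmon y (row j V)).
    apply/funext => j; have [Jj|Jj] := boolP (J j); first by rewrite parJ// ry.
    have [k ->] : exists k, j = e k by exists (enum_rank_in (A := [pred j | ~~ J j]) Jj j); rewrite /e enum_rankK_in.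
    by rewrite parE mxE psiE.
  by rewrite (lmon_comp _ y0 (W := V) (y := fun j => lmon y (row j V)))// -row_mul mulVmx// row1 lmon_delta.
- move=> t t' t0 t'0; have tt0 : Gm (Gm_mul t t') by move=> k; rewrite mxE mulf_neq0.
  apply: etrans (phiE tt0) _.
  apply: etrans _ (esym (congr2 mulmx (phiE t0) (phiE t'0))).
  rewrite (dmxM vv); apply: eq_dmx => i; rewrite /coord -lmonM.
  congr lmon; apply/funext => j; rewrite /par -big_split.
  by apply: eq_bigr => k _; rewrite mxE.
Qed.

End DiagonalTorus.

Lemma mmap_morph (A B C : comNzRingType) (phi : {rmorphism B -> C}) (g : A -> B)
    N (y : 'I_N -> B) (p : mpoly.mpoly N A) :
  phi (mpoly.mmap g y p) = mpoly.mmap (phi \o g) (phi \o y) p.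
Proof.
rewrite /mpoly.mmap rmorph_sum; apply: eq_bigr => m _; rewrite rmorphM.
congr (_ * _); rewrite /mpoly.mmap1 rmorph_prod; apply: eq_bigr => k _.
by rewrite rmorphXn.
Qed.

(** The points with positive split coordinates. It will be identified with the identity component;
    in this form it makes sense over every extension and is first order. *)
Definition torus_pos (K : rcfType) n r (S : seq (mpoly.mpoly (n * n) K))
    (h : 'I_r -> mpoly.mpoly (n * n) K) (L : rcfType) (g : K -> L) : set 'M[L]_n :=
  [set s | points g S s /\ forall k, 0 < evalmx g (h k) s].

(** * Positive points of a split torus *)

Section SplitTorus.
Variables (K : rcfType) (n : nat) (S : seq (mpoly.mpoly (n * n) K)) (r : nat).
Variables (f : 'I_n -> 'I_n -> mpoly.mpoly (r + r) K) (h : 'I_r -> mpoly.mpoly (n * n) K).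

Local Notation C := (K[i]).
Local Notation rc := (real_complex K).
Variables (phiC : 'rV[C]_r -> 'M[C]_n) (psiC : 'M[C]_n -> 'rV[C]_r).
Hypothesis phiE : forall t, phiC t = \matrix_(i, j) Gm_eval (f i j) t.
Hypothesis psiE : forall s, psiC s = \row_k evalmx rc (h k) s.
Hypothesis S_group : algebraic_group S.
Hypothesis phiS : forall t, Gm t -> geom_points S (phiC t).
Hypothesis psiS : forall s, geom_points S s -> Gm (psiC s).
Hypothesis phiK : forall t, Gm t -> psiC (phiC t) = t.
Hypothesis psiK : forall s, geom_points S s -> phiC (psiC s) = s.
Hypothesis phiM : forall t u, Gm t -> Gm u -> phiC (Gm_mul t u) = phiC t *m phiC u.

Local Notation pos := (torus_pos S h idfun).

Let geomP s : geom_points S (map_mx rc s) <-> points idfun S s.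
Proof. exact: (points_morph rc idfun). Qed.

Let hC k s : evalmx rc (h k) (map_mx rc s) = rc (evalmx idfun (h k) s).
Proof. by rewrite evalmx_morph. Qed.

Let map_rc_inj : injective (map_mx rc : 'M[K]_n -> 'M[C]_n).
Proof. exact: map_mx_inj. Qed.

Definition Gmx (L : fieldType) (t : 'I_r -> L) (k : 'I_(r + r)) :=
  row_mx (\row_k t k) (\row_k (t k)^-1) 0 k.

Let tvec (t : 'I_r -> K) : 'rV[C]_r := \row_k rc (t k).

Let F : 'M[mpoly.mpoly (r + r) K]_n := \matrix_(i, j) f i j.

Let par (t : 'I_r -> K) : 'M[K]_n := map_mx (mpoly.mmap idfun (Gmx t)) F.

Let parC t : map_mx rc (par t) = phiC (tvec t).
Proof.
rewrite phiE; apply/matrixP => i j; rewrite !mxE.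
rewrite (mmap_morph rc idfun) /Gm_eval; congr (mpoly.mmap _ _ _).
apply/funext => k; rewrite /= /Gmx.
by case: (split_ordP k) => l ->; rewrite ?row_mxEl ?row_mxEr !mxE// fmorphV.
Qed.

Let tvec_Gm t : (forall k, 0 < t k) -> Gm (tvec t).
Proof. by move=> t0 k; rewrite mxE fmorph_eq0 gt_eqF. Qed.

Let pos_par t : (forall k, 0 < t k) -> pos (par t).
Proof.
move=> t0; split; first by apply/geomP; rewrite parC; apply/phiS/tvec_Gm.
move=> k; have := congr1 (fun M : 'rV_r => M 0 k) (phiK (tvec_Gm t0)).
by rewrite psiE !mxE -parC hC => /complexI ->.
Qed.

Let pos_parE s : pos s -> s = par (fun k => evalmx idfun (h k) s).
Proof.
move=> [Ss hs]; apply: map_rc_inj; rewrite parC.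
rewrite -[LHS]psiK; last by apply/geomP.
by congr phiC; rewrite psiE; apply/rowP => k; rewrite !mxE hC.
Qed.

(** The positive points are Zariski dense: monomials in the coordinates and their inverses that
    agree at all positive points have the same exponents. *)
Lemma torus_dense P : (forall s, pos s -> points idfun P s) ->
  geom_points S `<=` geom_points P.
Proof.
move=> posP s Ss; rewrite -(psiK Ss); have z0 := psiS Ss; move: (psiC s) z0 => z z0.
pose Pt (t : 'I_r -> K) := forall k, 0 < t k; pose T := {t | Pt t}.
pose op (a b : T) : T := exist Pt (fun k => sval a k * sval b k)
  (fun k => mulr_gt0 (svalP a k) (svalP b k)).
pose one : T := exist Pt (fun=> 1) (fun=> ltr01).
pose x (a : T) := Gmx (sval a).
have -> : phiC z = map_mx (mpoly.mmap rc (Gmx (z 0))) F.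
  rewrite phiE; apply/matrixP => i j; rewrite !mxE /Gm_eval; congr (mpoly.mmap _ _ _).
  apply/funext => k; rewrite /Gmx.
  by case: (split_ordP k) => l ->; rewrite ?row_mxEl ?row_mxEr !mxE.
have aux (L : fieldType) (y : L) (a b c d : nat) : y != 0 ->
    (y ^+ a * y^-1 ^+ b = y ^+ c * y^-1 ^+ d) <-> y ^+ (a + d) = y ^+ (c + b).
  move=> y0; rewrite !exprVn !exprD.
  by split=> /eqP; [rewrite eqr_div ?expf_neq0// => /eqP|
    rewrite -eqr_div ?expf_neq0// => /eqP].
have E (L : fieldType) (y : 'I_r -> L) (q : 'I_(r + r) -> nat) :
    \prod_i Gmx y i ^+ q i = \prod_l (y l ^+ q (lshift r l) * (y l)^-1 ^+ q (rshift r l)).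
  rewrite big_split_ord/= -big_split; apply: eq_bigr => l _.
  by rewrite /Gmx row_mxEl row_mxEr !mxE.
have := @points_mpoly_transfer T op one K K C idfun rc (r + r) x (Gmx (z 0)).
move=> /(_ _ _ _ n F P) H; apply: H.
- move=> a b k; rewrite /x /Gmx.
  by case: (split_ordP k) => l ->; rewrite ?row_mxEl ?row_mxEr !mxE//= invfM.
- move=> k; rewrite /x /Gmx.
  by case: (split_ordP k) => l ->; rewrite ?row_mxEl ?row_mxEr !mxE//= invr1.
- move=> m m' mm.
  rewrite !E; apply: eq_bigr => l _; apply/aux; first exact: z0.
  (* The exponent of the coordinate l is isolated by setting it to 2 and all others to 1; powers of
     2 are distinct. *)
  pose t k : K := if k == l then 2 else 1.
  have t0 k : 0 < t k by rewrite /t; case: ifP.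
  have E2 q : \prod_i x (exist Pt t t0) i ^+ q i = 2 ^+ q (lshift r l) * 2^-1 ^+ q (rshift r l).
    rewrite E (bigD1 l)//= /t eqxx big1 ?mulr1// => k kl.
    by rewrite (negbTE kl) invr1 !expr1n mulr1.
  have N2 : (2 : K) != 0 by rewrite pnatr_eq0.
  have := mm (exist Pt t t0); rewrite !E2 => /(aux _ _ _ _ _ _ N2).
  by move=> /(ieexprIn (ltr0n K 2)) -> //; rewrite pnatr_eq1.
- by move=> a; apply/posP/pos_par/(svalP a).
Qed.

Let h_mul s s' k : points idfun S s -> points idfun S s' ->
  evalmx idfun (h k) (s *m s') = evalmx idfun (h k) s * evalmx idfun (h k) s'.
Proof.
move=> /geomP Ss /geomP Ss'; apply: (@complexI K); rewrite rmorphM/= -!hC map_mxM.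
have t0 := psiS Ss; have t'0 := psiS Ss'.
have E := phiM t0 t'0; rewrite (psiK Ss) (psiK Ss') in E.
have tt0 : Gm (Gm_mul (psiC (map_mx rc s)) (psiC (map_mx rc s'))).
  by move=> l; rewrite mxE mulf_neq0.
have := congr1 (fun M : 'rV_r => M 0 k) (phiK tt0).
by rewrite E !psiE !mxE.
Qed.

Let SM s s' : points idfun S s -> points idfun S s' -> points idfun S (s *m s').
Proof.
move=> /geomP Ss /geomP Ss'; have [[_ SMul _] _] := S_group.
by have := SMul _ _ Ss Ss'; rewrite -map_mxM => /geomP.
Qed.

Let hN0 s k : points idfun S s -> evalmx idfun (h k) s != 0.
Proof. by move=> /geomP /psiS /(_ k); rewrite psiE mxE hC fmorph_eq0. Qed.

Lemma torus_pos_square s : points idfun S s -> pos (s *m s).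
Proof.
move=> Ss; split=> [|k]; first exact: SM.
by rewrite h_mul// -expr2 lt_neqAle sqr_ge0 eq_sym sqrf_eq0 hN0.
Qed.

Lemma torus_pos_group : matrix_group pos.
Proof.
have S1 : points idfun S 1%:M by apply/geomP; rewrite map_mx1; have [[]] := S_group.
have h1 k : evalmx idfun (h k) 1%:M = 1.
  have := h_mul k S1 S1; rewrite mulmx1 => /eqP; rewrite -[X in X == _]mulr1.
  by rewrite (inj_eq (mulfI (hN0 k S1))) => /eqP.
split.
- by split=> // k; rewrite h1.
- by move=> s s' [Ss hs] [Ss' hs']; split=> [|k]; [exact: SM|rewrite h_mul ?mulr_gt0].
- move=> s [Ss hs]; have [[_ _ SVg] _] := S_group.
  have [us] := SVg _ ((geomP s).2 Ss); rewrite map_unitmx in us; rewrite -map_invmx => /geomP SV; split=> //; split=> // k.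
  by rewrite -(pmulr_rgt0 _ (hs k)) -h_mul// mulmxV// h1.
Qed.

Lemma torus_pos_comm s s' : pos s -> pos s' -> s *m s' = s' *m s.
Proof.
move=> [/geomP Ss _] [/geomP Ss' _]; apply: map_rc_inj; rewrite !map_mxM.
have t0 := psiS Ss; have t'0 := psiS Ss'.
have := phiM t0 t'0; have := phiM t'0 t0; rewrite (psiK Ss) (psiK Ss') => <- <-.
by congr phiC; apply/rowP => k; rewrite !mxE mulrC.
Qed.

(** Take square roots of the split coordinates. *)
Lemma torus_pos_sqrt s : pos s -> exists2 q, pos q & s = q *m q.
Proof.
move=> ps; pose t k := Num.sqrt (evalmx idfun (h k) s).
have t0 k : 0 < t k by rewrite sqrtr_gt0; have [_] := ps.
exists (par t); first exact: pos_par.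
rewrite {1}(pos_parE ps); apply: map_rc_inj; rewrite map_mxM !parC -phiM; try exact: tvec_Gm.
congr phiC; apply/rowP => k; rewrite !mxE -rmorphM.
by rewrite -expr2 sqr_sqrtr// ltW//; have [_] := ps.
Qed.

End SplitTorus.

Section Points.
Variables (K : rcfType) (n : nat) (G : seq (mpoly.mpoly (n * n) K)).
Hypothesis GG : algebraic_group G.

Let geomP g : geom_points G (map_mx (real_complex K) g) <-> points idfun G g.
Proof. exact: (points_morph (real_complex K) idfun). Qed.

Lemma points_group : matrix_group (points idfun G).
Proof.
have [[G1 GM GV] _] := GG; split.
- by apply/geomP; rewrite map_mx1.
- move=> g h /geomP Gg /geomP Gh; have := GM _ _ Gg Gh.
  by rewrite -map_mxM => /geomP.
- move=> g /geomP /GV[ug GVg]; rewrite map_unitmx in ug; split=> //.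
  by apply/geomP; rewrite map_invmx.
Qed.

Lemma points_det g : points idfun G g -> \det g = 1.
Proof.
by move=> /geomP Gg; have [_ /(_ _ Gg)/=] := GG; rewrite det_map_mx => /eqP;
  rewrite fmorph_eq1 => /eqP.
Qed.

Lemma points_tr g : self_adjoint G -> points idfun G g -> points idfun G g^T.
Proof. by move=> Gsa /geomP /Gsa; rewrite map_trmx => /geomP. Qed.

End Points.

Lemma exprz_eq1 (K : realFieldType) (x : K) (c : int) : 0 < x -> c != 0 -> x ^ c = 1 -> x = 1.
Proof.
move=> x0; case: c => [k|k] c0 /eqP.
  by rewrite -exprnP pexpr_eq1 ?ltW// ?lt0n// => /eqP.
by rewrite NegzE -exprnN invr_eq1 pexpr_eq1// ?ltW// => /eqP.
Qed.

(** * Maximality of S among symmetric elements commuting with A *)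

Section Maximality.
Variables (K : rcfType) (n : nat) (G S : seq (mpoly.mpoly (n * n) K)) (r : nat).
Variables (f : 'I_n -> 'I_n -> mpoly.mpoly (r + r) K) (h : 'I_r -> mpoly.mpoly (n * n) K).

Local Notation C := (K[i]).
Local Notation rc := (real_complex K).
Variables (phiC : 'rV[C]_r -> 'M[C]_n) (psiC : 'M[C]_n -> 'rV[C]_r).
Hypothesis phiE : forall t, phiC t = \matrix_(i, j) Gm_eval (f i j) t.
Hypothesis psiE : forall s, psiC s = \row_k evalmx rc (h k) s.
Hypothesis S_group : algebraic_group S.
Hypothesis phiS : forall t, Gm t -> geom_points S (phiC t).
Hypothesis psiS : forall s, geom_points S s -> Gm (psiC s).
Hypothesis phiK : forall t, Gm t -> psiC (phiC t) = t.
Hypothesis psiK : forall s, geom_points S s -> phiC (psiC s) = s.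
Hypothesis phiM : forall t u, Gm t -> Gm u -> phiC (Gm_mul t u) = phiC t *m phiC u.
Hypothesis G_group : algebraic_group G.
Hypothesis S_max : maximal_split_torus G S.
Hypothesis S_sym : symmetric_points S.

Local Notation pos := (torus_pos S h idfun).

Let geomP (P : seq (mpoly.mpoly (n * n) K)) g :
  geom_points P (map_mx rc g) <-> points idfun P g.
Proof. exact: (points_morph rc idfun). Qed.

Lemma torus_pos_G s : pos s -> points idfun G s.
Proof. by move=> [/geomP Ss _]; apply/geomP; have [_ + _] := S_max; exact. Qed.

Lemma torus_pos_sym s : pos s -> s^T = s.
Proof.
move=> [/geomP Ss _]; apply: (@map_mx_inj _ _ rc).
by rewrite -map_trmx; exact: S_sym.
Qed.

Section Centralizer.
Variable q : 'M[K]_n.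
Hypothesis Gq : points idfun G q.
Hypothesis q_sym : q^T = q.
Hypothesis q_comm : forall s, pos s -> q *m s = s *m q.

Let F X := pos X \/ X = q.

Let F_sym X : F X -> X^T = X.
Proof. by case=> [/torus_pos_sym|->]. Qed.

Let F_comm X Y : F X -> F Y -> X *m Y = Y *m X.
Proof.
move=> [pX|->] [pY|->].
- exact: torus_pos_comm psiS psiK phiM _ _ pX pY.
- by rewrite q_comm.
- exact: q_comm.
- by [].
Qed.

Lemma torus_maximal : pos (q *m q).
Proof.
have [u uu du] := simultaneous_diag F_sym F_comm.
have [G1 GM GV] := points_group G_group.
pose Ga g := [/\ points idfun G g, is_diag_mx (u *m g *m u^T) & forall i, 0 < dco u g i].
have GaM g g' : Ga g -> Ga g' -> Ga (g *m g').
  move=> [Gg dg g0] [Gg' dg' g'0]; split; first exact: GM.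
    by rewrite -(dmx_dco uu dg) -(dmx_dco uu dg') dmxM//; exact: is_diag_dmx.
  by move=> i; rewrite -(dmx_dco uu dg) -(dmx_dco uu dg') dmxM// dco_dmx// mulr_gt0.
have Ga1 : Ga 1%:M.
  split=> //; rewrite -(dmx1 uu); first exact: is_diag_dmx.
  by move=> i; rewrite dco_dmx.
have Ga_sq g : points idfun G g -> is_diag_mx (u *m g *m u^T) -> Ga (g *m g).
  move=> Gg dg; split; first exact: GM.
    by rewrite -(dmx_dco uu dg) dmxM//; exact: is_diag_dmx.
  move=> i; rewrite -(dmx_dco uu dg) dmxM// dco_dmx// -expr2 lt_neqAle sqr_ge0 eq_sym.
  rewrite sqrf_eq0 andbT; have := points_det G_group Gg.
  rewrite -[in \det _](dmx_dco uu dg) det_dmx// => /eqP.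
  apply: contraTneq => gi; rewrite (bigD1 i)//= gi mul0r eq_sym oner_eq0//.
have Ga_pos s : pos s -> Ga s.
  move=> ps; have [b pb ->] := torus_pos_sqrt phiE psiE phiS phiK psiK phiM ps.
  by apply: Ga_sq; [exact: torus_pos_G|by apply: du; left].
have dq := du q (or_intror erefl).
have Ga_qq : Ga (q *m q) by exact: Ga_sq.
pose La m := forall g, Ga g -> lmon (dco u g) m = 1.
have Ga0 g i : Ga g -> dco u g i != 0 by move=> [_ _ /(_ i)/lt0r_neq0].
have lmon_gt0 (y : 'I_n -> K) m : (forall i, 0 < y i) -> 0 < lmon y m.
  by move=> y0; apply: prodr_gt0 => i _; exact: exprz_gt0.
have [V uV [J JP]] : exists2 V : 'M[int]_n, V \in unitmx &
    exists J : pred 'I_n, forall m, La m <-> forall j, ~~ J j -> (m *m invmx V) 0 j = 0.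
  apply: saturated_lattice_basis.
  - by move=> g _; rewrite lmon0.
  - by move=> a b la lb g gg; rewrite lmonD ?la ?lb ?mulr1// => i; exact: Ga0.
  - by move=> c a la g gg; rewrite lmonZ la// exp1rz.
  (* Saturation is where positivity of the eigenvalues enters: a positive element with a nonzero
     power equal to 1 is 1. *)
  - move=> c a c0 la g gg; apply: (@exprz_eq1 _ _ c) => //.
      by apply: lmon_gt0; case: gg.
    by rewrite -lmonZ la.
have LaV j : J j -> La (row j V).
  move=> Jj; apply/JP => k Jk; rewrite -row_mul mulmxV// !mxE.
  by case: eqVneq => // jk; rewrite -jk Jj in Jk.
have prod_det (g : 'M[K]_n) : Ga g -> \prod_i dco u g i = 1.
  by move=> [Gg dg _]; have := points_det G_group Gg; rewrite -{1}(dmx_dco uu dg) det_dmx.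
(* The all-ones vector belongs to the lattice because elements of G have determinant 1. *)
have detJ j : ~~ J j -> (const_mx 1 *m invmx V : 'rV_n) 0 j = 0.
  move: j; apply/JP => g gg; rewrite -[RHS](prod_det g gg).
  by apply: eq_bigr => i _; rewrite mxE expr1z.
pose Tor := diag_torus u V J.
have TorK (g : 'M[K]_n) : points idfun Tor g <-> [/\ is_diag_mx (u *m g *m u^T),
    \prod_i dco u g i = 1 & forall j, J j -> lmon (dco u g) (row j V) = 1].
  have := diag_torusP u V J (GRing.RMorphism.clone K K idfun _) g.
  by rewrite /= map_mx_id.
have S_Tor : geom_points S `<=` geom_points Tor.
  apply: (torus_dense phiE psiE phiS psiS phiK psiK) => s /Ga_pos gs; apply/TorK.
  by case: (gs) => [_ ds _]; split=> //; [exact: prod_det|move=> j /LaV; exact].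
have Tor_G : geom_points Tor `<=` geom_points G.
  move=> _ /(geom_diag_torus uu)[y -> [py ry]].
  have y0 i : y i != 0.
    by apply: contra_eq_neq py => yi; rewrite (bigD1 i)//= yi mul0r eq_sym oner_neq0.
  pose op (a b : {g | Ga g}) := exist Ga (sval a *m sval b) (GaM _ _ (svalP a) (svalP b)).
  pose one := exist Ga _ Ga1.
  have := @points_transfer {g | Ga g} op one K K C idfun rc n u
    (fun g i => dco u (sval g) i) y.
  move=> /(_ _ _ _ G) H; apply: H.
  - move=> [a ga] [b gb] i /=; case: ga gb => [_ da _] [_ db _].
    by rewrite -{1}(dmx_dco uu da) -{1}(dmx_dco uu db) dmxM// dco_dmx.
  - by move=> i; rewrite /= -(dmx1 uu) dco_dmx.
  - move=> m m' mm; apply/lmon_natB => //; set d := _ - _.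
    have : La d.
      by move=> g gg; apply/lmon_natB; [move=> i; exact: Ga0|exact: (mm (exist _ g gg))].
    move=> /JP dJ; rewrite -[d](mulmxKV uV).
    rewrite -(lmon_comp (y := fun j => lmon y (row j V)))//.
    rewrite /lmon big1// => j _; have [Jj|Jj] := boolP (J j).
      by have := ry j Jj; rewrite /lmon => ->; rewrite exp1rz.
    by rewrite dJ// expr0z.
  - by move=> [g [Gg dg g0]] /=; have := dmx_dco uu dg; rewrite /dmx => ->.
have TorS : geom_points Tor = geom_points S.
  have [_ _ Smax] := S_max.
  exact: Smax (diag_torus_split uu uV detJ) S_Tor Tor_G.
have qqE i : dco u (q *m q) i = dco u q i * dco u q i.
  by rewrite -{1 2}(dmx_dco uu dq) dmxM// dco_dmx.
(* q may have negative eigenvalues, so it is replaced by the positive square root w of q^2. The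
   relations hold for q^2 and thus for w, which puts w in the torus and its square among the
   positive points. *)
pose w := dmx u (fun i => `|dco u q i|).
have -> : q *m q = w *m w.
  rewrite -(dmx_dco uu dq) !dmxM//; apply: eq_dmx => i.
  by rewrite -normrM ger0_norm// -expr2 sqr_ge0.
apply: (torus_pos_square psiE S_group psiS phiK psiK phiM).
apply/geomP; rewrite -TorS; apply/geomP/TorK.
have wE i : dco u w i = `|dco u q i| by rewrite dco_dmx.
have w0 i : 0 < dco u w i.
  rewrite wE normr_gt0; have [_ _ /(_ i)] := Ga_qq.
  by rewrite qqE; apply: contraTneq => ->; rewrite mulr0 ltxx.
split; first exact: is_diag_dmx.
  rewrite (eq_bigr (fun i => `|dco u q i|)); last by move=> i _; rewrite wE.
  rewrite -normr_prod; have := points_det G_group Gq.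
  by rewrite -{1}(dmx_dco uu dq) det_dmx// => ->; rewrite normr1.
move=> j /LaV /(_ _ Ga_qq) L1.
apply: (@exprz_eq1 _ _ 2) => //; first exact: lmon_gt0.
rewrite -L1 -exprnP expr2 -lmonM; congr lmon; apply/funext => i.
rewrite wE qqE -normrM ger0_norm//.
by rewrite -expr2 sqr_ge0.
Qed.

End Centralizer.

End Maximality.

(** * The identity component of a split torus over extensions *)

Section TransferAll.
Variables (K : rcfType) (n : nat).

Lemma mdef_forall_env N (D : mx_family K n) : mdef D ->
  (forall (L : rcfType) (f : {rmorphism K -> L}) r r',
     (forall k, (k < N)%N -> r k = r' k) -> D L f r -> D L f r') ->
  mdef (n := n) (fun L f _ => forall r, D L f r).
Proof.
elim: N D => [|N IH] D dD Dr.
  by apply: mdef_ext dD _ => L f r; split=> [Dfr r'|]; [exact: (Dr L f r)|exact].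
pose D' : mx_family K n := fun L f r => forall g, D L f (upd r N g).
have dD' : mdef D'.
  apply: (mdef_forall (k := N) (D := fun L f r g => D L f (upd r N g))).
    apply: mdef_ext dD _ => L f r; rewrite (_ : upd r N (r N) = r)//.
    by apply/funext => l; rewrite /upd; case: eqP => [->|].
  move=> L f r g g'; rewrite (_ : upd (upd r N g') N g = upd r N g)//.
  by apply/funext => l; rewrite /upd; case: eqP.
apply: mdef_ext (IH D' dD' _) _ => [L f r r' rr' D'r g|L f _].
  apply: (Dr L f (upd r N g)) (D'r g) => k; rewrite ltnS leq_eqVlt /upd.
  by case: eqP => [//|_ /=]; exact: rr'.
split=> [H r|H r g]; last exact: H.
have := H r (r N); rewrite (_ : upd r N (r N) = r)//.
by apply/funext => l; rewrite /upd; case: eqP => [->|].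
Qed.

(** The second hypothesis says that only the first N matrices matter, so the quantification over
    whole environments amounts to N quantifiers. *)
Lemma transfer_forall N (D : mx_family K n) : mdef D ->
  (forall (L : rcfType) (f : {rmorphism K -> L}) r r',
     (forall k, (k < N)%N -> r k = r' k) -> D L f r -> D L f r') ->
  forall (L : rcfType) (f : {rmorphism K -> L}),
  (forall r, D K idfun r) <-> (forall r, D L f r).
Proof. by move=> dD Dr L f; exact: transfer (mdef_forall_env dD Dr). Qed.

Definition dset (P : forall L : rcfType, {rmorphism K -> L} -> set 'M[L]_n) :=
  forall T, mterm T -> mdef (fun L f r => @P L f (T L f r)).

Lemma dset_points P : dset (fun L f => points f P).
Proof. by move=> T; exact: mdef_points. Qed.

Lemma dset_torus_pos r S (h : 'I_r -> mpoly.mpoly (n * n) K) :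
  dset (fun L f => torus_pos S h f).
Proof.
move=> T dT; apply: mdef_and; first exact: mdef_points.
by apply: mdef_forall_fin => k; apply/mdef_gt0/sterm_evalmx.
Qed.

End TransferAll.

Ltac mdef_step := first
  [ apply: dset_torus_pos | apply: mdef_points | apply: mdef_sa_points
  | apply: mdef_and | apply: mdef_impl | apply: mdef_mxeq | apply: mdef_eq | apply: mdef_le
  | apply: mdef_lt | apply: sterm_evalmx | apply: mterm_mul | apply: mterm_tr
  | exact: mterm_var | exact: mterm_1 | exact: sterm_nat | exact: sterm_const ].
Ltac mdef_auto := repeat mdef_step.

Section MatrixGroupTransfer.
Variables (K : rcfType) (n : nat).

(** [invmx] is no polynomial term; an existential over a right inverse in P is definable. *)
Lemma matrix_group_mulP (L : fieldType) (P : set 'M[L]_n) :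
  matrix_group P <-> [/\ P 1%:M, forall g h, P g -> P h -> P (g *m h) &
    forall g, P g -> exists h, P h /\ g *m h = 1%:M].
Proof.
split=> -[P1 PM PV]; split=> // g Pg.
  by have [ug Pg'] := PV g Pg; exists (invmx g); rewrite mulmxV.
have [h [Ph gh]] := PV g Pg; have [ug _] := mulmx1_unit gh; split=> //.
by rewrite -[invmx g]mulmx1 -gh mulKmx.
Qed.

Variable P : forall L : rcfType, {rmorphism K -> L} -> set 'M[L]_n.
Hypothesis dP : dset P.
Variables (L : rcfType) (f : {rmorphism K -> L}).

Local Notation env s := (fun k => nth 0 s k).

Lemma matrix_group_transfer : matrix_group (@P K idfun) -> matrix_group (@P L f).
Proof.
move=> /matrix_group_mulP[P1 PM PV]; apply/matrix_group_mulP; split.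
- have T := @transfer_forall K n 0 (fun L f r => @P L f 1%:M) (dP (@mterm_1 K n)).
  have {}T := (T (fun _ _ _ _ _ => id) L f).1.
  by apply: (T _ (fun=> 0)) => _; exact: P1.
- have T := @transfer_forall K n 2
    (fun L f r => @P L f (r 0) -> @P L f (r 1) -> @P L f (r 0 *m r 1))%N.
  have {}T := (T _ _ L f).1 => g h.
  apply: (T _ _ _ (env [:: g; h])) => [||r]; last exact: PM.
    by mdef_auto; apply: dP; mdef_auto.
  by move=> L' f' r r' rr'; rewrite !rr'.
- have T := @transfer_forall K n 1
    (fun L f r => @P L f (r 0) -> exists h, @P L f h /\ r 0 *m h = 1%:M)%N.
  have {}T := (T _ _ L f).1 => g.
  apply: (T _ _ _ (env [:: g])) => [||r]; last exact: PV.
    apply: mdef_impl; first by apply: dP; mdef_auto.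
    apply: (mdef_exists (k := 1) (D := fun L f r h => @P L f h /\ r 0 *m h = 1%:M)%N) => //.
    by mdef_auto; apply: dP; mdef_auto.
  by move=> L' f' r r' rr'; rewrite !rr'.
Qed.

End MatrixGroupTransfer.

Section TorusTransfer.
Variables (K : rcfType) (n : nat) (G S : seq (mpoly.mpoly (n * n) K)) (r : nat).
Variables (h : 'I_r -> mpoly.mpoly (n * n) K) (L : rcfType) (f : {rmorphism K -> L}).

Local Notation pos L f := (torus_pos S h (L := L) f).
Local Notation env s := (fun k => nth 0 s k).

Lemma points_tr_transfer : (forall g, points idfun G g -> points idfun G g^T) ->
  forall g, points f G g -> points f G g^T.
Proof.
move=> H; have T := @transfer_forall K n 1
  (fun L f r => points f G (r 0) -> points f G (r 0)^T)%N.
have {}T := (T _ _ L f).1 => g.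
apply: (T _ _ _ (env [:: g])) => [||e]; [by mdef_auto| |exact: H].
by move=> L' f' e e' ee'; rewrite !ee'.
Qed.

Lemma points_det_transfer : (forall g, points idfun G g -> \det g = 1) ->
  forall g, points f G g -> \det g = 1.
Proof.
move=> H; have T := @transfer_forall K n 1
  (fun L f r => points f G (r 0%N) ->
    \sum_(s : 'S_n) (-1) ^+ s * \prod_i (r 0%N) i (s i) = 1%:R).
have {}T := (T _ _ L f).1 => g.
apply: (T _ _ _ (env [:: g])) => [||e]; [| |exact: H].
  apply: mdef_impl; first by mdef_auto.
  apply: mdef_eq; last by mdef_auto.
  apply: sterm_sum => s; apply: sterm_mul; last first.
    by apply: sterm_prod => i; exact: mterm_var.
  by apply: sterm_ext (sterm_const _ ((-1) ^+ s)) _ => L' f' e; rewrite rmorphXn/= rmorphN1.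
by move=> L' f' e e' ee'; rewrite !ee'.
Qed.

Lemma torus_pos_sym_transfer : (forall s, pos K idfun s -> s^T = s) ->
  forall s, pos L f s -> s^T = s.
Proof.
move=> H; have T := @transfer_forall K n 1 (fun L f r => pos L f (r 0) -> (r 0)^T = r 0)%N.
have {}T := (T _ _ L f).1 => s.
apply: (T _ _ _ (env [:: s])) => [||e]; [by mdef_auto| |exact: H].
by move=> L' f' e e' ee'; rewrite !ee'.
Qed.

Lemma torus_pos_comm_transfer :
  (forall s t, pos K idfun s -> pos K idfun t -> s *m t = t *m s) ->
  forall s t, pos L f s -> pos L f t -> s *m t = t *m s.
Proof.
move=> H; have T := @transfer_forall K n 2
  (fun L f r => pos L f (r 0) -> pos L f (r 1) -> r 0 *m r 1 = r 1 *m r 0)%N.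
have {}T := (T _ _ L f).1 => s t.
apply: (T _ _ _ (env [:: s; t])) => [||e]; [by mdef_auto| |exact: H].
by move=> L' f' e e' ee'; rewrite !ee'.
Qed.

Lemma torus_pos_sqrt_transfer :
  (forall s, pos K idfun s -> exists2 q, pos K idfun q & s = q *m q) ->
  forall s, pos L f s -> exists q, pos L f q /\ s = q *m q.
Proof.
move=> H; have T := @transfer_forall K n 1
  (fun L f r => pos L f (r 0) -> exists q, pos L f q /\ r 0 = q *m q)%N.
have {}T := (T _ _ L f).1 => s.
apply: (T _ _ _ (env [:: s])) => [||e].
- apply: mdef_impl; first by mdef_auto.
  apply: (mdef_exists (k := 1) (D := fun L f r q => pos L f q /\ r 0 = q *m q)%N) => //.
  by mdef_auto.
- by move=> L' f' e e' ee'; rewrite !ee'.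
- by move=> /H[q pq ->]; exists q.
Qed.

Lemma torus_pos_square_transfer :
  (forall s, points idfun S s -> pos K idfun (s *m s)) ->
  forall s, points f S s -> pos L f (s *m s).
Proof.
move=> H; have T := @transfer_forall K n 1
  (fun L f r => points f S (r 0) -> pos L f (r 0 *m r 0))%N.
have {}T := (T _ _ L f).1 => s.
apply: (T _ _ _ (env [:: s])) => [||e]; [by mdef_auto| |exact: H].
by move=> L' f' e e' ee'; rewrite !ee'.
Qed.

Lemma torus_pos_points_transfer (P : seq (mpoly.mpoly (n * n) K)) :
  pos K idfun `<=` points idfun P -> pos L f `<=` points f P.
Proof.
move=> H; have T := @transfer_forall K n 1
  (fun L f r => pos L f (r 0) -> points f P (r 0))%N.
have {}T := (T _ _ L f).1 => s.
apply: (T _ _ _ (env [:: s])) => [||e]; [by mdef_auto| |exact: H].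
by move=> L' f' e e' ee'; rewrite !ee'.
Qed.

(** Here the maximality of S, a property over K, becomes the maximality of A that the analysis over
    R relies on. *)
Lemma torus_maximal_transfer :
  (forall q, points idfun G q -> q^T = q ->
    (forall s, pos K idfun s -> q *m s = s *m q) -> pos K idfun (q *m q)) ->
  forall q, points f G q -> q^T = q ->
    (forall s, pos L f s -> q *m s = s *m q) -> pos L f (q *m q).
Proof.
move=> H; have T := @transfer_forall K n 1
  (fun L f r => points f G (r 0) -> (r 0)^T = r 0 ->
    (forall s, pos L f s -> r 0 *m s = s *m r 0) -> pos L f (r 0 *m r 0))%N.
have {}T := (T _ _ L f).1 => q.
apply: (T _ _ _ (env [:: q])) => [||e]; last exact: H.
- apply: mdef_impl; first by mdef_auto.
  apply: mdef_impl; first by mdef_auto.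
  apply: mdef_impl; last by mdef_auto.
  apply: (mdef_forall (k := 1)
    (D := fun L f r s => pos L f s -> r 0 *m s = s *m r 0)%N) => //.
  by mdef_auto.
- by move=> L' f' e e' ee'; rewrite !ee'.
Qed.

Lemma mterm_const (M : 'M[K]_n) : mterm (fun L (f : {rmorphism K -> L}) _ => map_mx f M).
Proof.
by move=> i j; apply: sterm_ext (sterm_const _ (M i j)) _ => L' f' e; rewrite mxE.
Qed.

Lemma torus_pos_diag_transfer (u : 'M[K]_n) :
  (forall s, pos K idfun s -> is_diag_mx (u *m s *m u^T)) ->
  forall s, pos L f s -> is_diag_mx (map_mx f u *m s *m (map_mx f u)^T).
Proof.
move=> H; have T := @transfer_forall K n 1 (fun L f r => pos L f (r 0) ->
  
  forall i j : 'I_n, (i == j) = false -> (map_mx f u *m r 0%N *m (map_mx f u)^T) i j = 0%:R).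
have {}T := (T _ _ L f).1 => s ps; apply/is_diag_mxP => i j /negbTE ij.
apply: (T _ _ _ (env [:: s])) => // [||e pe i' j' ij'].
- apply: mdef_impl; first by mdef_auto.
  apply: mdef_forall_fin => i'; apply: mdef_forall_fin => j'.
  apply: mdef_impl; first exact: mdef_const.
  apply: mdef_eq; last by mdef_auto.
  by apply: mterm_mul; [apply: mterm_mul; [exact: mterm_const|mdef_auto]|
    exact: mterm_tr (mterm_const u)].
- by move=> L' f' e e' ee'; rewrite !ee'.
- have ijN : i' != j' by rewrite ij'.
  by rewrite map_mx_id//; move/is_diag_mxP: (H _ pe) => /(_ i' j' ijN).
Qed.

End TorusTransfer.

(** Take a subspace of maximal dimension inside P. *)
Lemma vspace_of_linear (R : fieldType) (W : vectType R) (P : set W) :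
  P 0 -> (forall X Y, P X -> P Y -> P (X + Y)) -> (forall c X, P X -> P (c *: X)) ->
  exists U : {vspace W}, forall X, X \in U <-> P X.
Proof.
move=> P0 PD PZ.
pose D d := `[< exists2 U : {vspace W}, \dim U = d & forall X, X \in U -> P X >].
have D0 : exists d, D d.
  exists 0%N; apply/asboolP; exists 0%VS; first exact: dimv0.
  by move=> X; rewrite memv0 => /eqP ->.
have Dle d : D d -> (d <= \dim {: W})%N.
  by move=> /asboolP[U <- _]; apply/dimvS/subvf.
case: (ex_maxnP D0 Dle) => d /asboolP[U dU UP] dmax; exists U => X; split; first exact: UP.
move=> PX; have : D (\dim (U + <[X]>)%VS).
  apply/asboolP; exists (U + <[X]>)%VS => // Y /memv_addP[Z UZ [T /vlineP[c ->] ->]].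
  by apply: PD; [exact: UP|exact: PZ].
move=> /dmax; rewrite -dU => dim_le.
have /eqP -> : U == (U + <[X]>)%VS by rewrite -(geq_leqif (dimv_leqif_eq _)) ?addvSl.
by apply: (subvP (addvSr U _)); exact: memv_line.
Qed.

Section Spectral.
Variables (R : realType) (n : nat).
Implicit Types (X Y : 'M[R]_n) (u : 'M[R]_n).

Lemma mxexp_dmx u d : u *m u^T = 1%:M -> mxexp (dmx u d) = dmx u (fun i => expR (d i)).
Proof.
move=> uu; rewrite /dmx mxexp_conj// mxexp_diag; congr (_ *m diag_mx _ *m _).
by apply/rowP => i; rewrite !mxE.
Qed.

Lemma scale_dmx u (c : R) d : c *: dmx u d = dmx u (fun i => c * d i).
Proof.
rewrite /dmx scalemxAl scalemxAr; congr (_ *m _ *m _).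
by apply/matrixP => i j; rewrite !mxE mulrnAr.
Qed.

Lemma sym_dmx X : X^T = X -> exists u d, u *m u^T = 1%:M /\ X = dmx u d.
Proof.
move=> Xs; have [u uu du] := @simultaneous_diag R n (eq X)
  (fun Y => fun e : X = Y => etrans (etrans (esym (congr1 _ e)) Xs) e)
  (fun Y Z e e' => etrans (congr2 mulmx (esym e) (esym e')) (congr2 mulmx e' e)).
by exists u, (dco u X); split=> //; rewrite dmx_dco//; exact: du.
Qed.

Variables (K : rcfType) (iR : {rmorphism K -> R}) (P : seq (mpoly.mpoly (n * n) K)).

(** The natural powers form a multiplicative family, and a monomial relation between the exp(d_i) is
    a linear relation between the d_i, which persists for every real multiple t. *)
Lemma points_real_power u d : u *m u^T = 1%:M ->
  (forall m : nat, points iR P (dmx u (fun i => expR (m%:R * d i)))) ->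
  forall t, points iR P (dmx u (fun i => expR (t * d i))).
Proof.
move=> uu Pm t; have := @points_transfer nat addn 0%N K R R iR idfun n u
  (fun m i => expR (m%:R * d i)) (fun i => expR (t * d i)).
move=> /(_ _ _ _ P) H; rewrite /dmx -[u in u^T](map_mx_id (f := idfun))//.
rewrite -[u in _ *m u](map_mx_id (f := idfun))//; apply: H => //.
- by move=> a b i; rewrite natrD mulrDl expRD.
- by move=> i; rewrite mul0r expR0.
move=> m m' /(_ 1%N).
have E s (k : 'I_n -> nat) : \prod_i expR (s * d i) ^+ k i = expR (s * \sum_i d i * (k i)%:R).
  rewrite mulr_sumr expR_sum; apply: eq_bigr => i _.
  by rewrite -expRM_natr -mulrA.
by rewrite !E !mul1r => /expR_inj ->.
Qed.

End Spectral.

(** * The positive torus over the reals *)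

Section RealTorus.
Variables (K : rcfType) (R : realType) (iR : {rmorphism K -> R}) (n r : nat).
Variables (S : seq (mpoly.mpoly (n * n) K)) (h : 'I_r -> mpoly.mpoly (n * n) K).

Local Notation A := (torus_pos S h (L := R) iR).
Local Notation SR := (points iR S).

Hypothesis SRgrp : matrix_group SR.
Hypothesis Agrp : matrix_group A.
Hypothesis Asym : forall s, A s -> s^T = s.
Hypothesis Asqrt : forall s, A s -> exists q, A q /\ s = q *m q.
Hypothesis Asquare : forall s, SR s -> A (s *m s).

Lemma torus_pos_Lie : Lie A = Lie SR.
Proof.
apply/seteqP; split=> X AX t; first by have [] := AX t.
have -> : t *: X = (t / 2) *: X + (t / 2) *: X by rewrite -scalerDl -splitr.
by rewrite -scalerDl mxexp_scaleD; exact: Asquare.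
Qed.

(** Real powers of s lie in S by interpolation from the natural ones; each is the square of another
    one, hence positive. *)
Lemma torus_pos_exp s : A s -> exists u d, [/\ u *m u^T = 1%:M,
  s = dmx u (fun i => expR (d i)) & forall t, A (dmx u (fun i => expR (t * d i)))].
Proof.
move=> As; have [q [Aq sq]] := Asqrt As.
have [u [c [uu qE]]] := sym_dmx (Asym Aq).
have c0 i : c i != 0.
  have uq := matrix_group_unit Agrp Aq.
  move: uq; rewrite qE unitmxE (det_dmx uu) unitfE; apply: contraNneq => ci.
  by rewrite (bigD1 i)//= ci mul0r.
have cc0 i : 0 < c i ^+ 2 by rewrite exprn_even_gt0/=.
pose d i := ln (c i ^+ 2).
have sE : s = dmx u (fun i => expR (d i)).
  by rewrite sq qE (dmxM uu); apply: eq_dmx => i; rewrite /d lnK ?posrE// expr2.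
exists u, d; split=> // t.
have pow : forall m : nat, SR (dmx u (fun i => expR (m%:R * d i))).
  elim=> [|m IH].
    have -> : dmx u (fun i => expR (0%:R * d i)) = 1%:M.
      by rewrite -(dmx1 uu); apply: eq_dmx => i; rewrite mul0r expR0.
    exact: matrix_group1 SRgrp.
  have -> : dmx u (fun i => expR (m.+1%:R * d i)) =
      dmx u (fun i => expR (m%:R * d i)) *m s.
    rewrite sE (dmxM uu); apply: eq_dmx => i.
    by rewrite -natr1 mulrDl mul1r expRD.
  by apply: (matrix_groupM SRgrp) => //; case: As.
have -> : dmx u (fun i => expR (t * d i)) =
    dmx u (fun i => expR (t / 2 * d i)) *m dmx u (fun i => expR (t / 2 * d i)).
  by rewrite (dmxM uu); apply: eq_dmx => i; rewrite -expRD -mulrDl -splitr.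
by apply/Asquare/points_real_power.
Qed.

(** Relative openness in terms of boxes of entries, a first-order form that can be transferred from
    K. *)
Let eps_open (U : set 'M[R]_n) := forall s, U s -> exists E : 'M[R]_n,
  (forall i j, 0 < E i j) /\ forall s', A s' ->
    (forall i j, s' i j < s i j + E i j /\ s i j < s' i j + E i j) -> U s'.

(** Any two points are joined by the path t -> s^t x with s = y x^-1, and the real line is
    connected. *)
Lemma torus_pos_connected (U V : set 'M[R]_n) x y : (forall s, A s -> U s \/ V s) ->
  (forall s, U s -> V s -> False) -> eps_open U -> eps_open V ->
  A x -> A y -> U x -> V y -> False.
Proof.
move=> UV disj Uo Vo Ax Ay Ux Vy; have [ux x'A] := (matrix_group_unit Agrp Ax, matrix_groupV Agrp Ax).
have [u [d [uu yxE path]]] := torus_pos_exp (matrix_groupM Agrp Ay x'A).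
pose g (t : R) := dmx u (fun i => expR (t * d i)) *m x.
have Ag t : A (g t) := matrix_groupM Agrp (path t) Ax.
have g0 : g 0 = x.
  rewrite /g (_ : dmx u _ = 1%:M) ?mul1mx// -(dmx1 uu).
  by apply: eq_dmx => i; rewrite mul0r expR0.
have g1 : g 1 = y.
  rewrite /g (_ : dmx u _ = y *m invmx x) ?mulmxKV// yxE.
  by apply: eq_dmx => i; rewrite mul1r.
have cg i j : continuous (fun t => g t i j).
  apply: continuous_mulmx => {}i {}j; last exact: continuous_cst_fun.
  apply: continuous_mulmx => {}i {}j; last exact: continuous_cst_fun.
  apply: continuous_mulmx => {}i {}j; first exact: continuous_cst_fun.
  under eq_fun do rewrite !mxE.
  case: (i == j); last by under eq_fun do rewrite mulr0n; exact: continuous_cst_fun.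
  under eq_fun do rewrite mulr1n.
  rewrite -[X in continuous X]/(expR \o (fun t => t * d i)) => t.
  by apply: continuous_comp; [exact: mulrr_continuous|exact: continuous_expR].
have og W : eps_open W -> open [set t | W (g t)].
  move=> Wo; rewrite openE => t /= Wt; have [E [E0 EW]] := Wo _ Wt.
  have near_entry (ij : 'I_n * 'I_n) : \forall t' \near t,
      g t' ij.1 ij.2 < g t ij.1 ij.2 + E ij.1 ij.2 /\ g t ij.1 ij.2 < g t' ij.1 ij.2 + E ij.1 ij.2.
    have := cg ij.1 ij.2 t => /cvgrPdist_lt /(_ _ (E0 ij.1 ij.2)).
    apply: filterS => t'; rewrite ltr_norml => /andP[? ?]; split; lra.
  apply: filterS (filter_forall _ near_entry) => t' nt'.
  by apply: EW (Ag t') _ => i j; exact: (nt' (i, j)).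
have UE : [set t | U (g t)] = ~` [set t | V (g t)].
  apply/seteqP; split=> t /=; first by move=> Ut Vt; exact: disj Ut Vt.
  by have [] := UV _ (Ag t).
have : connected [set: R].
  by apply/connected_intervalP => a b _ _ c _.
move=> /(_ [set t | U (g t)]) H.
have : [set t | U (g t)] = setT.
  apply: H; first by exists 0; rewrite /= g0.
    by exists [set t | U (g t)]; [exact: og|rewrite setTI].
  exists [set t | U (g t)]; last by rewrite setTI.
  by rewrite UE; apply/open_closedC/og.
by move=> /seteqP[_ /(_ 1 I)]; rewrite /= g1 => Uy; exact: disj Uy Vy.
Qed.

Lemma Lie_torus_vspace : exists U : {vspace 'M[R]_n}, forall X, X \in U <-> Lie A X.
Proof.
have SRcl : closed SR by exact: closed_evalmx.
rewrite torus_pos_Lie; apply: vspace_of_linear.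
- exact: Lie0.
- exact: LieD.
- by move=> c X; exact: LieZ.
Qed.

End RealTorus.

(** * The semialgebraic identity component of S *)

Section OpenBox.
Variables (K : rcfType) (n : nat).

Lemma open_in_box (C U : set 'M[K]_n) : open_in C U -> forall s, U s ->
  exists E : 'M[K]_n, (forall i j, 0 < E i j) /\ forall s', C s' ->
    (forall i j, s' i j < s i j + E i j /\ s i j < s' i j + E i j) -> U s'.
Proof.
move=> [W oW ->] s [Cs Ws].
have /nbhs_ballP[e /= e0 eW] : nbhs s W by exact: open_nbhs_nbhs.
exists (const_mx e); split=> [i j|s' Cs' close]; first by rewrite mxE.
split=> //; apply: eW; split=> // i j; have [] := close i j; rewrite mxE.
by rewrite /ball/= ltr_norml => ? ?; apply/andP; split; lra.
Qed.

Lemma open_forall_evalmx_gt0 r (h : 'I_r -> mpoly.mpoly (n * n) K) :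
  open [set s : 'M[K]_n | forall k, 0 < evalmx idfun (h k) s].
Proof.
rewrite openE => s /= hs.
have near_k (k : 'I_r) : \forall t \near s, 0 < evalmx idfun (h k) t.
  have cont := @continuous_evalmx K K idfun n (h k) s.
  have : nbhs (evalmx idfun (h k) s) [set x | 0 < x].
    by apply: open_nbhs_nbhs; split; [exact: open_gt|exact: hs].
  by move=> /cont.
exact: filter_forall near_k.
Qed.

Lemma open_exists_evalmx_lt0 r (h : 'I_r -> mpoly.mpoly (n * n) K) :
  open [set s : 'M[K]_n | exists k, evalmx idfun (h k) s < 0].
Proof.
rewrite openE => s /= [k hs].
have near_k : \forall t \near s, evalmx idfun (h k) t < 0.
  have cont := @continuous_evalmx K K idfun n (h k) s.
  have : nbhs (evalmx idfun (h k) s) [set x | x < 0].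
    by apply: open_nbhs_nbhs; split; [exact: open_lt|exact: hs].
  by move=> /cont.
by near=> t; exists k; near: t.
Unshelve. all: by end_near.
Qed.

End OpenBox.

Section PositiveTorus.
Variables (K : rcfType) (n r : nat) (S : seq (mpoly.mpoly (n * n) K)).
Variables (h : 'I_r -> mpoly.mpoly (n * n) K).

Local Notation pos L f := (torus_pos S h (L := L) f).

Definition torus_pos_sa : seq (seq (mpoly.mpoly (n * n) K) * seq (mpoly.mpoly (n * n) K)) :=
  [:: (S, codom h)].

Lemma torus_pos_saE (L : rcfType) (f : K -> L) : pos L f = sa_points f torus_pos_sa.
Proof.
apply/seteqP; split=> s; rewrite /sa_points/= orbF.
  move=> [Ss hs]; apply/andP; split=> //.
  by apply/allP => q /codomP[k ->]; exact: hs.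
move=> /andP[Ss /allP hs]; split=> // k; apply: hs; exact: codom_f.
Qed.

(** Any description of the positive points over K describes a subset of those over L, by transfer;
    the description by the sign conditions gives all of them. *)
Lemma torus_pos_extension (L : rcfType) (f : {rmorphism K -> L}) :
  sa_extension f (pos K idfun) = pos L f.
Proof.
apply/seteqP; split=> s; last first.
  by move=> ps; exists torus_pos_sa; rewrite -torus_pos_saE.
move=> [D DE Ds].
have T := @transfer_forall K n 1 (fun L f r => sa_points f D (r 0%N) -> pos L f (r 0%N)).
have {}T := (T _ _ L f).1.
apply: (T _ _ _ (fun=> s)) => [||e|]; [by mdef_auto| |by rewrite DE|exact: Ds].
by move=> L' f' e e' ee'; rewrite !ee'.
Qed.

Variables (R : realType) (iR : {rmorphism K -> R}).
Hypothesis Sgrp : matrix_group (points idfun S).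
Hypothesis Pgrp : matrix_group (pos K idfun).
Hypothesis Psym : forall s, pos K idfun s -> s^T = s.
Hypothesis Psqrt : forall s, pos K idfun s -> exists2 q, pos K idfun q & s = q *m q.
Hypothesis Psquare : forall s, points idfun S s -> pos K idfun (s *m s).
Hypothesis h_neq0 : forall s, points idfun S s -> forall k, evalmx idfun (h k) s != 0.

Local Notation env s := (fun k => nth 0 s k).

(** Over K there need be no paths, so a separation by semialgebraic sets is carried to R: covering,
    disjointness and relative openness are all first order, and there the path argument applies. *)
Lemma torus_pos_sa_connected : sa_connected (pos K idfun).
Proof.
move=> U V [DU UE] [DV VE] oU oV UV disj.
have [[x Ux]|/set0P/negP/negPn/eqP ->] := pselect (U !=set0); last by left.
have [[y Vy]|/set0P/negP/negPn/eqP ->] := pselect (V !=set0); last by right.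
exfalso.
have box_transfer D : (forall s, sa_points idfun D s -> exists E : 'M[K]_n,
    (forall i j, 0 < E i j) /\ forall s', pos K idfun s' ->
    (forall i j, s' i j < s i j + E i j /\ s i j < s' i j + E i j) -> sa_points idfun D s') ->
    forall s, sa_points iR D s -> exists E : 'M[R]_n,
    (forall i j, 0 < E i j) /\ forall s', pos R iR s' ->
    (forall i j, s' i j < s i j + E i j /\ s i j < s' i j + E i j) -> sa_points iR D s'.
  move=> H; have T := @transfer_forall K n 1
    (fun L f r => sa_points f D (r 0%N) -> exists E : 'M[L]_n,
      (forall i j, 0 < E i j) /\ forall s', pos L f s' ->
      (forall i j, s' i j < (r 0%N) i j + E i j /\ (r 0%N) i j < s' i j + E i j) ->
      sa_points f D s').
  have {}T := (T _ _ R iR).1 => s.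
  apply: (T _ _ _ (env [:: s])) => [||e]; last exact: H.
    apply: mdef_impl; first by mdef_auto.
    apply: (mdef_exists (k := 1) (D := fun L f r E => (forall i j, 0 < E i j) /\
      forall s', pos L f s' -> (forall i j, s' i j < (r 0%N) i j + E i j /\
        (r 0%N) i j < s' i j + E i j) -> sa_points f D s')) => //.
    apply: mdef_and.
      by apply: mdef_forall_fin => i; apply: mdef_forall_fin => j; apply/mdef_gt0/mterm_var.
    apply: (mdef_forall (k := 2) (D := fun L f r s' => pos L f s' ->
      (forall i j, s' i j < (r 0%N) i j + (r 1%N) i j /\
        (r 0%N) i j < s' i j + (r 1%N) i j) -> sa_points f D s')) => //.
    apply: mdef_impl; first by mdef_auto.
    apply: mdef_impl; last by mdef_auto.
    apply: mdef_forall_fin => i; apply: mdef_forall_fin => j.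
    by apply: mdef_and; apply: mdef_lt; rewrite /=; try apply: sterm_add; exact: mterm_var.
  by move=> L' f' e e' ee'; rewrite !ee'.
have boxR W D : W = sa_points idfun D -> open_in (pos K idfun) W ->
    forall s, sa_points iR D s -> exists E : 'M[R]_n,
    (forall i j, 0 < E i j) /\ forall s', pos R iR s' ->
    (forall i j, s' i j < s i j + E i j /\ s i j < s' i j + E i j) -> sa_points iR D s'.
  by move=> WE oW; apply: box_transfer; rewrite -WE; exact: open_in_box.
have WR D s : sa_points idfun D s -> sa_points iR D (map_mx iR s).
  rewrite /sa_points/=; have E p : evalmx iR p (map_mx iR s) = iR (evalmx idfun p s).
    by rewrite evalmx_morph.
  move=> /hasP[b bD /andP[/allP b1 /allP b2]]; apply/hasP; exists b => //.
  apply/andP; split; apply/allP => p pb; rewrite E.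
    by rewrite fmorph_eq0 b1.
  by rewrite -(rmorph0 iR) rcf_morph_lt b2.
have UK : U `<=` pos K idfun by rewrite -UV; exact: subsetUl.
have VK : V `<=` pos K idfun by rewrite -UV; exact: subsetUr.
apply: (@torus_pos_connected K R iR n r S h _ _ _ _ _ (sa_points iR DU) (sa_points iR DV)
  (map_mx iR x) (map_mx iR y)).
- exact: (matrix_group_transfer (dset_points S) iR Sgrp).
- exact: (matrix_group_transfer (dset_torus_pos S h) iR Pgrp).
- exact: torus_pos_sym_transfer Psym.
- exact: torus_pos_sqrt_transfer Psqrt.
- exact: torus_pos_square_transfer Psquare.
- move=> s ps; have T := @transfer_forall K n 1 (fun L f r => pos L f (r 0%N) ->
    sa_points f DU (r 0%N) \/ sa_points f DV (r 0%N)).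
  have {}T := (T _ _ R iR).1; move: ps.
  apply: (T _ _ _ (env [:: s])) => [||e pe].
  + by apply: mdef_impl; first mdef_auto; apply: mdef_or; mdef_auto.
  + by move=> L' f' e e' ee'; rewrite !ee'.
  + by move: pe; rewrite -UV -UE -VE.
- move=> s; have T := @transfer_forall K n 1 (fun L f r => sa_points f DU (r 0%N) ->
    sa_points f DV (r 0%N) -> False).
  have {}T := (T _ _ R iR).1.
  apply: (T _ _ _ (env [:: s])) => [||e].
  + by mdef_auto; exact: mdef_const.
  + by move=> L' f' e e' ee'; rewrite !ee'.
  + rewrite -UE -VE => Ue Ve; have : (U `&` V) (e 0%N) by [].
    by rewrite disj.
- exact: boxR UE oU.
- exact: boxR VE oV.
- by rewrite torus_pos_saE; apply/WR; rewrite -torus_pos_saE; exact: UK.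
- by rewrite torus_pos_saE; apply/WR; rewrite -torus_pos_saE; exact: VK.
- by apply: WR; rewrite -UE.
- by apply: WR; rewrite -VE.
Qed.

(** The functions [h k] have no zero on S, so their signs split a connected C into two relatively
    open pieces; C contains the identity, where all are positive. *)
Lemma sa_component_torus : sa_component (points idfun S) 1%:M = pos K idfun.
Proof.
have P1 : pos K idfun 1%:M by case: Pgrp.
apply/seteqP; split=> s; last first.
  move=> ps; exists (pos K idfun) => //; split.
  - by exists torus_pos_sa; exact: torus_pos_saE.
  - exact: torus_pos_sa_connected.
  - by move=> t [].
  - exact: P1.
move=> [C [[DC CE] Cconn CS C1] Cs].
pose W1 := [set t : 'M[K]_n | forall k, 0 < evalmx idfun (h k) t].
pose W2 := [set t : 'M[K]_n | exists k, evalmx idfun (h k) t < 0].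
have sa1 : semialgebraic (C `&` W1).
  exists [seq (b.1, b.2 ++ codom h) | b <- DC]; rewrite CE; apply/seteqP; split=> t.
    move=> [/hasP[b bD /andP[b1 b2]] W1t]; apply/hasP; exists (b.1, b.2 ++ codom h).
      exact: map_f.
    rewrite /= b1 all_cat b2/=; apply/allP => q /codomP[k ->]; exact: W1t.
  move=> /hasP[_ /mapP[b bD ->]] /=; rewrite all_cat => /and3P[b1 b2 /allP W1t].
  by split; [apply/hasP; exists b => //; apply/andP|move=> k; apply/W1t/codom_f].
have sa2 : semialgebraic (C `&` W2).
  exists [seq (b.1, rcons b.2 (- h k)) | b <- DC, k <- enum 'I_r]; rewrite CE.
  have evN k t : evalmx idfun (- h k) t = - evalmx idfun (h k) t by exact: mpoly.mmapN.
  apply/seteqP; split=> t.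
    move=> [/hasP[b bD /andP[b1 b2]] [k hk]]; apply/hasP; exists (b.1, rcons b.2 (- h k)).
      by apply/allpairsP; exists (b, k); rewrite mem_enum.
    by rewrite /= b1 all_rcons b2/= evN oppr_gt0 hk.
  move=> /hasP[_ /allpairsP[[b k] /= [bD _ ->]]] /=; rewrite all_rcons evN oppr_gt0.
  move=> /and3P[b1 hk b2]; split; last by exists k.
  by apply/hasP; exists b => //; apply/andP.
have W11 : W1 1%:M by case: P1.
have := Cconn _ _ sa1 sa2; case.
- by exists W1 => //; exact: open_forall_evalmx_gt0.
- by exists W2 => //; exact: open_exists_evalmx_lt0.
- rewrite -setIUr; apply/setIidPl => t /CS St.
  have [[k hk]|nW2] := pselect (W2 t); first by right; exists k.
  left=> k; rewrite ltNge le_eqVlt (negbTE (h_neq0 St k))/=; apply/negP => hk.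
  by apply: nW2; exists k.
- rewrite setIACA setIid (_ : W1 `&` W2 = set0) ?setI0// -subset0.
  by move=> t [W1t [k]]; rewrite ltNge ltW.
- by move=> /seteqP[/(_ 1%:M) + _] => /(_ (conj C1 W11)).
move=> V0; split; first exact: CS.
move=> k; rewrite ltNge le_eqVlt (negbTE (h_neq0 (CS _ Cs) k))/=; apply/negP => hk.
have : (C `&` W2) s by split=> //; exists k.
by rewrite V0.
Qed.

End PositiveTorus.

(** * Roots *)

Lemma hom_of_linear (F : fieldType) (U W : vectType F) (f : U -> W) :
  linear f -> exists phi : 'Hom(U, W), forall x, phi x = f x.
Proof.
move=> lf; pose b := GRing.isLinear.Build F U W *:%R f lf.
pose g : {linear U -> W} := HB.pack f b.
by exists (linfun g) => x; rewrite lfunE.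
Qed.

Section TracePairing.
Variables (R : realType) (n : nat) (a : {vspace 'M[R]_n}).
Hypothesis a_sym : forall X, X \in a -> X^T = X.

Lemma sym_trace_eq0 (X : 'M[R]_n) : X^T = X -> \tr (X *m X) = 0 -> X = 0.
Proof.
move=> Xs; rewrite -{2}Xs => /eqP.
have -> : \tr (X *m X^T) = \sum_i \sum_j X i j ^+ 2.
  by apply: eq_bigr => i _; rewrite mxE; apply: eq_bigr => j _; rewrite mxE expr2.
rewrite psumr_eq0; last by move=> i _; apply: sumr_ge0 => j _; exact: sqr_ge0.
move=> /allP X0; apply/matrixP => i j; rewrite mxE; have := X0 i (mem_index_enum i).
rewrite /= psumr_eq0; last by move=> k _; exact: sqr_ge0.
by move=> /allP/(_ j (mem_index_enum j)); rewrite /= sqrf_eq0 => /eqP.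
Qed.

(** The trace form is positive definite on symmetric matrices, so it identifies [a] with its
    dual. *)
Lemma trace_iso : exists2 Phi : 'Hom(subvs_of a, 'Hom(subvs_of a, R^o)),
  forall L H, Phi L H = \tr (vsval L *m vsval H) & forall alpha, exists L, alpha = Phi L.
Proof.
have valP' c (X Y : subvs_of a) : vsval (c *: X + Y) = c *: vsval X + vsval Y.
  by rewrite linearP.
have row_lin (L : subvs_of a) : linear (fun H : subvs_of a => \tr (vsval L *m vsval H) : R^o).
  by move=> c X Y; rewrite valP' mulmxDr -scalemxAr mxtraceD mxtraceZ.
pose Phi0 L := sval (cid (hom_of_linear (row_lin L))).
have Phi0E L H : Phi0 L H = \tr (vsval L *m vsval H).
  exact: (svalP (cid (hom_of_linear (row_lin L)))).
have Phi_lin : linear Phi0.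
  move=> c X Y; apply/lfunP => H; rewrite add_lfunE scale_lfunE !Phi0E valP'.
  by rewrite mulmxDl -scalemxAl mxtraceD mxtraceZ.
have [Phi PhiE] := hom_of_linear Phi_lin.
have Phi_inj : lker Phi == 0%VS.
  apply/lker0P => X Y /(congr1 (fun g : 'Hom(subvs_of a, R^o) => g (X - Y))).
  rewrite !PhiE !Phi0E => XY.
  have XY0 : vsval (X - Y) = 0.
    apply: sym_trace_eq0; first exact: (a_sym (subvsP (X - Y))).
    have E : vsval (X - Y) = vsval X - vsval Y by rewrite raddfB.
    by rewrite {1}E mulmxBl raddfB/= XY subrr.
  apply/eqP; rewrite -subr_eq0; apply/eqP/val_inj; apply: etrans XY0 _.
  by rewrite linear0.
have limgE : limg Phi = fullv.
  apply/eqP; rewrite eqEdim subvf/= limg_dim_eq ?(eqP Phi_inj) ?capv0// !dimvf.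
exact: eq_leq (muln1 (\dim a)).
exists Phi => [L H|alpha]; first by rewrite PhiE.
have /memv_imgP[L _ ->] : alpha \in limg Phi by rewrite limgE memvf.
by exists L.
Qed.

Lemma trace_riesz (alpha : 'Hom(subvs_of a, R^o)) :
  exists L : subvs_of a, forall H, alpha H = \tr (vsval L *m vsval H).
Proof. by have [Phi PhiE /(_ alpha)[L ->]] := trace_iso; exists L. Qed.

Lemma hom_dual (l : 'Hom('Hom(subvs_of a, R^o), R^o)) :
  exists P : subvs_of a, forall alpha : 'Hom(subvs_of a, R^o), alpha P = l alpha.
Proof.
have [Phi PhiE Phi_onto] := trace_iso; have [P PE] := Phi_onto (l \o Phi)%VF.
exists P => alpha; have [L ->] := Phi_onto alpha.
have := congr1 (fun g : 'Hom(subvs_of a, R^o) => g L) PE.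
by rewrite comp_lfunE !PhiE mxtrace_mulC.
Qed.

(** The functional that is 1 on each element of Delta is evaluation at a point of [a]; this point
    lies in the open chamber. *)
Lemma basis_dual (Delta : seq 'Hom(subvs_of a, R^o)) : basis_of fullv Delta ->
  exists P : subvs_of a, forall i, (i < size Delta)%N -> Delta`_i P = 1.
Proof.
move=> /basis_free frD.
pose l0 (alpha : 'Hom(subvs_of a, R^o)) : R^o := \sum_i coord (in_tuple Delta) i alpha.
have l0_lin : linear l0.
  move=> c X Y; rewrite /l0 scaler_sumr -big_split; apply: eq_bigr => i _.
  by rewrite linearP.
have [l lE] := hom_of_linear l0_lin; have [P PE] := hom_dual l.
exists P => i iD; rewrite PE lE /l0 (bigD1 (Ordinal iD))//= big1 ?addr0.
  by rewrite (coord_free (X := in_tuple Delta) (Ordinal iD) (Ordinal iD) frD) eqxx.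
move=> j ji; rewrite (coord_free (X := in_tuple Delta) (Ordinal iD) j frD).
by move: ji; rewrite -!val_eqE/= eq_sym => /negbTE ->.
Qed.

End TracePairing.

(** A set whose elements are each determined by a label from a finite type can be listed, with one
    label kept for each element. *)
Lemma enum_subset (T : eqType) (I : finType) (D : set T) (c : I -> T -> Prop) :
  (forall i x y, c i x -> c i y -> D x -> D y -> x = y) ->
  (forall x, D x -> exists i, c i x) ->
  exists s : seq (T * I), [/\ uniq (unzip1 s), forall x, D x <-> x \in unzip1 s &
    forall x, x \in s -> c x.2 x.1].
Proof.
move=> cinj cD.
suff [s [us sD cs]] : exists s : seq (T * I), [/\ uniq (unzip1 s),
    forall x, x \in unzip1 s <-> D x /\ (exists2 i, i \in enum I & c i x) &
    forall x, x \in s -> c x.2 x.1].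
  exists s; split=> // x; rewrite sD; split=> [Dx|[]//]; split=> //.
  by have [i ci] := cD x Dx; exists i; rewrite ?mem_enum.
elim: (enum I) => [|i e [s [us sD cs]]].
  by exists [::]; split=> // x; split=> // -[_ []].
have [[x [Dx cx]]|nx] := pselect (exists x, D x /\ c i x); last first.
  exists s; split=> // x; rewrite sD; split=> -[Dx [j je cj]]; split=> //.
    by exists j; rewrite // inE je orbT.
  move: je; rewrite inE => /orP[/eqP ji|je]; last by exists j.
  by exfalso; apply: nx; exists x; rewrite -ji.
have iff_x y : D y -> c i y -> y = x by move=> Dy cy; exact: (cinj i).
have [xs|xs] := boolP (x \in unzip1 s).
  exists s; split=> // y; rewrite sD; split=> -[Dy [j je cj]]; split=> //.
    by exists j; rewrite // inE je orbT.
  move: je; rewrite inE => /orP[/eqP ji|je]; last by exists j.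
  by rewrite ji in cj; rewrite (iff_x _ Dy cj); have [] := (sD x).1 xs.
exists ((x, i) :: s); split=> [|y|y]; first by rewrite /= xs.
  rewrite /= inE; split=> [/orP[/eqP ->|/sD[Dy [j je cj]]]|[Dy [j]]].
  - by split=> //; exists i; rewrite // inE eqxx.
  - by split=> //; exists j; rewrite // inE je orbT.
  - rewrite inE => /orP[/eqP -> /(iff_x _ Dy) ->|je cj]; first by rewrite eqxx.
    by apply/orP; right; apply/sD; split=> //; exists j.
by rewrite inE => /orP[/eqP -> //|/cs].
Qed.

(** * Finiteness, Weyl invariance and chambers of the roots *)

Section RootSystem.
Variables (R : realType) (n : nat) (G A : set 'M[R]_n) (a : {vspace 'M[R]_n}).
Hypothesis Gcl : closed G.
Hypothesis Ggrp : matrix_group G.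
Hypothesis Gtr : forall g, G g -> G g^T.
Hypothesis Gdet : forall g, G g -> \det g = 1.
Hypothesis Gpow : forall X, X^T = X -> (forall m : nat, G (mxexp (m%:R *: X))) -> Lie G X.
Hypothesis AG : A `<=` G.
Hypothesis Asym : forall x, A x -> x^T = x.
Hypothesis Acomm : forall x y, A x -> A y -> x *m y = y *m x.
Hypothesis aP : forall X, X \in a <-> Lie A X.
Hypothesis Aexp : forall x, A x -> exists2 X, X \in a & x = mxexp X.
Hypothesis Amax : forall q, G q -> q^T = q -> (forall x, A x -> q *m x = x *m q) ->
  A (q *m q).
Variable u : 'M[R]_n.
Hypothesis uu : u *m u^T = 1%:M.
Hypothesis udiag : forall X, X \in a -> is_diag_mx (u *m X *m u^T).

Local Notation Sigma := (@Defs.roots R n (Lie G) a).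
Local Notation hom := 'Hom(subvs_of a, R^o).

Let sym_a X : X \in a -> X^T = X := a_sym Asym aP (X := X).

Lemma dgD X Y i : dg u (X + Y) i = dg u X i + dg u Y i.
Proof. by rewrite /dg cjD mxE. Qed.

Lemma dgZ c X i : dg u (c *: X) i = c * dg u X i.
Proof. by rewrite /dg cjZ mxE. Qed.

Definition root_pair (ij : 'I_n * 'I_n) (alpha : hom) :=
  forall H : subvs_of a, alpha H = dg u (vsval H) ij.1 - dg u (vsval H) ij.2.

(** Any nonzero entry of a root vector in the diagonalizing basis shows where to read the root. *)
Lemma root_pairP alpha : Sigma alpha -> exists ij, root_pair ij alpha.
Proof.
move=> [_ [X [GX X0 aX]]].
have cX0 : cj u X != 0.
  apply: contraNneq X0 => cX; apply/eqP/(cj_inj uu); rewrite cX.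
  by rewrite /cj mulmx0 mul0mx.
have /matrix0Pn[i [j cij]] := cX0; exists (i, j) => H /=.
have := bracket_a uu udiag X i j (subvsP H).
by rewrite /bracket aX cjZ mxE => /(mulIf cij).
Qed.

Lemma root_enum : exists s : seq (hom * ('I_n * 'I_n)),
  [/\ uniq (unzip1 s), forall alpha, Sigma alpha <-> alpha \in unzip1 s &
    forall x, x \in s -> root_pair x.2 x.1].
Proof.
apply: enum_subset => [ij al be al_ij be_ij _ _|al]; last exact: root_pairP.
by apply/lfunP => H; rewrite al_ij be_ij.
Qed.

Section WeylInvariance.
Variable s : seq (hom * ('I_n * 'I_n)).
Hypothesis s_uniq : uniq (unzip1 s).
Hypothesis sP : forall alpha, Sigma alpha <-> alpha \in unzip1 s.
Hypothesis s_pair : forall x, x \in s -> root_pair x.2 x.1.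

Definition root_sum (H : 'M[R]_n) := \sum_(x <- s) `|dg u H x.2.1 - dg u H x.2.2|.

Lemma root_sumE (H : subvs_of a) : root_sum (vsval H) = \sum_(al <- unzip1 s) `|al H|.
Proof.
by rewrite big_map; apply: eq_big_seq => x xs; rewrite (s_pair xs).
Qed.

Lemma root_sumD X Y : root_sum (X + Y) <= root_sum X + root_sum Y.
Proof.
rewrite -big_split; apply: ler_sum => x _; rewrite !dgD.
by rewrite opprD addrACA ler_normD.
Qed.

Lemma root_sumZ c X : 0 <= c -> root_sum (c *: X) = c * root_sum X.
Proof.
move=> c0; rewrite mulr_sumr; apply: eq_bigr => x _.
by rewrite !dgZ -mulrBr normrM ger0_norm.
Qed.

(** A subgradient: L represents the sum of the roots, each with the sign it takes at H. *)
Lemma root_sum_dual H : H \in a -> exists2 L, L \in a &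
  \tr (L *m H) = root_sum H /\ forall H', H' \in a -> \tr (L *m H') <= root_sum H'.
Proof.
move=> aH.
pose Lr (al : hom) := sval (cid (trace_riesz sym_a al)).
have LrE (al : hom) (X : subvs_of a) : al X = \tr (vsval (Lr al) *m vsval X).
  exact: (svalP (cid (trace_riesz sym_a al))).
pose H' := vsproj a H; have HE : vsval H' = H by rewrite vsprojK.
pose L := \sum_(al <- unzip1 s) Num.sg (al H') *: vsval (Lr al).
have LE (X : subvs_of a) : \tr (L *m vsval X) = \sum_(al <- unzip1 s) Num.sg (al H') * al X.
  rewrite /L mulmx_suml (big_morph _ (@mxtraceD _ _) (@mxtrace0 _ _)).
  by apply: eq_bigr => al _; rewrite -scalemxAl mxtraceZ -LrE.
exists L; first by apply: rpred_sum => al _; apply: rpredZ; exact: subvsP.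
split; first by rewrite -HE LE root_sumE; apply: eq_bigr => al _; rewrite -normrEsg.
move=> X aX; rewrite -(vsprojK aX) LE root_sumE; apply: ler_sum => al _.
apply: le_trans (ler_norm _) _; rewrite normrM normr_sg.
by case: (al H' != 0); rewrite ?mul1r// mul0r.
Qed.

(** Composition with conjugation by w maps the finite list of roots injectively into itself, hence
    permutes it. *)
Lemma root_sum_conj w H : KG G w -> (forall X, X \in a -> w *m X *m w^T \in a) ->
  H \in a -> root_sum (w *m H *m w^T) <= root_sum H.
Proof.
move=> Kw wa aH; have ww := KG_orth Kw; have w'w := KG_orth' Kw.
have [ad adE] : exists ad : 'End(subvs_of a), forall X, vsval (ad X) = w *m vsval X *m w^T.
  pose ad0 (X : subvs_of a) : subvs_of a := vsproj a (w *m vsval X *m w^T).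
  have ad0E X : vsval (ad0 X) = w *m vsval X *m w^T by rewrite vsprojK// wa// subvsP.
  have lin_ad : linear ad0.
    move=> c X Y; apply: val_inj; rewrite [LHS]ad0E.
    have -> : val (c *: ad0 X + ad0 Y) = c *: vsval (ad0 X) + vsval (ad0 Y) by rewrite linearP.
    have -> : vsval (c *: X + Y) = c *: vsval X + vsval Y by rewrite linearP.
    by rewrite !ad0E mulmxDr mulmxDl -scalemxAr -scalemxAl.
  by have [ad adE] := hom_of_linear lin_ad; exists ad => X; rewrite adE.
have ad_ker : lker ad == 0%VS.
  apply/lker0P => X Y /(congr1 vsval); rewrite !adE => XY; apply: val_inj.
  have := congr1 (fun Z => w^T *m Z *m w) XY.
  by rewrite !mulmxA w'w !mul1mx -!mulmxA w'w !mulmx1.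
have Sad (al : hom) : Sigma al -> Sigma (al \o ad)%VF.
  move=> [al0 [X [GX X0 aX]]]; split.
    apply: contraNneq al0 => al_ad; apply/eqP.
    by apply/funext => Z; rewrite -[Z](lker0_lfunVK ad_ker) -comp_lfunE al_ad.
  exists (w^T *m X *m w); split.
  - have := Lie_conj Ggrp (KGT Gtr Kw).1 GX.
    by rewrite (KG_inv Ggrp (KGT Gtr Kw)) trmxK.
  - apply: contraNneq X0 => wX; have := congr1 (fun Z => w *m Z *m w^T) wX.
    by rewrite !mulmxA ww mul1mx -mulmxA ww mulmx1 mulmx0 mul0mx => ->.
  - move=> X'; rewrite comp_lfunE.
    have /(congr1 (fun Z => w^T *m Z *m w)) := aX (ad X').
    rewrite adE -scalemxAr -scalemxAl => <-.
    rewrite mulmxBr mulmxBl !mulmxA w'w mul1mx -!mulmxA w'w mulmx1.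
    by rewrite !mulmxA.
pose H' := vsproj a H; have HE : vsval H' = H by rewrite vsprojK.
rewrite -HE -adE !root_sumE.
rewrite (eq_bigr (fun al : hom => `|(al \o ad)%VF H'|)); last by move=> al _; rewrite comp_lfunE.
rewrite -(big_map (fun al : hom => al \o ad)%VF xpredT (fun al : hom => `|al H'|)).
rewrite le_eqVlt; apply/orP; left; apply/eqP; apply: perm_big.
have inj : injective (fun al : hom => (al \o ad)%VF).
  move=> al be /(congr1 (fun g : hom => (g \o ad^-1)%VF)).
  by rewrite -!comp_lfunA (lker0_compfV ad_ker) !comp_lfun1r.
have u2 : uniq (map (fun al : hom => (al \o ad)%VF) (unzip1 s)) by rewrite map_inj_uniq.
apply: uniq_perm => //.
have sub : {subset map (fun al : hom => (al \o ad)%VF) (unzip1 s) <= unzip1 s}.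
  by move=> _ /mapP[al /sP als ->]; apply/sP/Sad.
by have [] := uniq_min_size u2 sub; rewrite ?size_map.
Qed.

End WeylInvariance.

(** On the moment curve P = sum t^k b_k through a basis of [a], each difference of diagonal entries
    is a polynomial in t; t avoids the roots of all the nonzero ones. *)
Lemma regular_exists : exists P, regular a u P.
Proof.
pose b := vbasis a.
pose c (ij : 'I_n * 'I_n) k := dg u b`_k ij.1 - dg u b`_k ij.2.
pose q ij := \poly_(k < \dim a) c ij k.
pose Q := \prod_(ij | q ij != 0) q ij.
have Q0 : Q != 0 by apply/prodf_neq0.
have [t Qt] : exists t, ~~ root Q t.
  apply/not_existsP => rQ; pose rs : seq R := [seq k%:R | k <- iota 0 (size Q)].
  have urs : uniq rs by rewrite map_inj_uniq ?iota_uniq// => i j /eqP; rewrite eqr_nat => /eqP.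
  have allr : all (root Q) rs by apply/allP => x _; apply/negPn/negP/rQ.
  by have := max_poly_roots Q0 allr urs; rewrite size_map size_iota ltnn.
have dg_sum (I : finType) (F : I -> 'M[R]_n) i : dg u (\sum_k F k) i = \sum_k dg u (F k) i.
  by apply: (big_morph (dg u ^~ i)) => [X Y|]; [exact: dgD|rewrite -[0](scale0r 0) dgZ mul0r].
pose P := \sum_(k < \dim a) t ^+ k *: b`_k.
have PE ij : dg u P ij.1 - dg u P ij.2 = (q ij).[t].
  rewrite /P !dg_sum -sumrB horner_poly; apply: eq_bigr => k _.
  by rewrite !dgZ -mulrBr mulrC.
exists P; split.
  apply: rpred_sum => k _; apply: rpredZ; apply: vbasis_mem.
  by rewrite mem_nth// size_tuple.
move=> i j Pij H aH; have qt : (q (i, j)).[t] = 0 by rewrite -PE/= Pij subrr.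
have q0 : q (i, j) = 0.
  apply/eqP/negPn/negP => qij; move: Qt; rewrite /Q /root horner_prod.
  by rewrite (bigD1 (i, j))//= qt mul0r eqxx.
have cij (k : 'I_(\dim a)) : dg u b`_k i = dg u b`_k j.
  apply/eqP; rewrite -subr_eq0; have := congr1 (fun p : {poly R} => p`_k) q0.
  by rewrite coef_poly ltn_ord coef0 /c/= => ->.
rewrite (coord_vbasis aH) !dg_sum; apply: eq_bigr => k _.
by rewrite !dgZ cij.
Qed.

Section Chamber.
Variable Delta : seq hom.
Hypothesis Delta_basis : root_basis Sigma Delta.

(** Start from the point where all simple roots are 1 and move by less than 1/m towards a regular Q,
    where m exceeds every |alpha(Q)|; positivity survives. *)
Lemma regular_positive : exists2 P, regular a u P &
  forall al, al \in Delta -> 0 < al (vsproj a P).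
Proof.
have [basisD _ _] := Delta_basis; have [P0 P0E] := basis_dual sym_a basisD.
have [Q Qreg] := regular_exists; have [aQ _] := Qreg.
pose m := 1 + \sum_(al <- Delta) `|al (vsproj a Q)|.
have m0 : 0 < m by rewrite ltr_pwDl// sumr_ge0.
have [e [e0 ed Preg]] := regular_near Qreg (subvsP P0) (divr_gt0 ltr01 m0).
exists (vsval P0 + e *: Q) => // al alD.
have -> : vsproj a (vsval P0 + e *: Q) = P0 + e *: vsproj a Q.
  by rewrite linearD linearZ/= vsvalK.
have -> : al (P0 + e *: vsproj a Q) = 1 + e * al (vsproj a Q).
  by rewrite linearD linearZ/= -{1}(nth_index 0 alD) P0E ?index_mem.
have le_m : `|al (vsproj a Q)| < m.
  rewrite /m (big_rem al)//= ltr_pwDl// lerDl sumr_ge0//.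
have : `|e * al (vsproj a Q)| < 1.
  rewrite normrM (gtr0_norm e0); apply: le_lt_trans (_ : e * m < 1).
    by rewrite ler_pM2l// ltW.
  by rewrite -ltr_pdivlMr.
rewrite ltr_norml => /andP[+ _].
by rewrite -subr_gt0 opprK addrC.
Qed.

Lemma root_cartan g : G g -> exists k k' H, [/\ KG G k, KG G k', H \in a,
  g = k *m mxexp H *m k' & forall al, al \in Delta -> 0 <= al (vsproj a H)].
Proof.
move=> Gg; have [P Preg Ppos] := regular_positive.
have [aP' _] := Preg.
have [k [k' [H [Kk Kk' aH gE Hpos]]]] :=
  cartan_decomposition Gcl Ggrp Gtr Gpow AG Asym aP Aexp Amax uu udiag Preg Gg.
exists k, k', H; split=> // al alD; have [_ DS _] := Delta_basis.
have [_ [X [GX X0 aX]]] := DS al alD.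
have alP := Ppos al alD.
have := Hpos X (al (vsproj a H)) (al (vsproj a P)) GX X0.
rewrite /bracket -!aX !vsprojK// => /(_ erefl erefl (lt0r_neq0 alP)).
by rewrite pmulr_lge0.
Qed.

End Chamber.

Lemma root_triangle (s : seq (hom * ('I_n * 'I_n))) :
  uniq (unzip1 s) -> (forall alpha, Sigma alpha <-> alpha \in unzip1 s) ->
  (forall x, x \in s -> root_pair x.2 x.1) ->
  forall H1 H2 H3 k k' k'', H1 \in a -> H2 \in a -> H3 \in a ->
  KG G k -> KG G k' -> KG G k'' ->
  mxexp H1 *m k *m mxexp H2 = k' *m mxexp H3 *m k'' ->
  root_sum s H3 <= root_sum s H1 + root_sum s H2.
Proof.
move=> us sP s_pair H1 H2 H3 k k' k''; have [P Preg] := regular_exists.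
apply: (triangle_exp Gcl Ggrp Gtr Gdet Gpow AG Asym Acomm aP Aexp Amax uu udiag Preg).
- by move=> X Y _ _; exact: root_sumD.
- by move=> c X c0 _; exact: root_sumZ.
- by move=> w H Kw wa aH; exact: root_sum_conj.
- exact: root_sum_dual.
Qed.

End RootSystem.

(** * The pseudo-distance *)

Section Characters.
Variables (K : rcfType) (n : nat) (u : 'M[K]_n).

(* On diagonal matrices of determinant 1, y_j^-1 is the product of the y_k, k != j. *)
Definition charp (ij : 'I_n * 'I_n) : mpoly.mpoly (n * n) K :=
  entry u ij.1 ij.1 * \prod_(k | k != ij.2) entry u k k.

Lemma evalmx_charp (L : fieldType) (f : {rmorphism K -> L}) X ij :
  \prod_i dco (map_mx f u) X i = 1 ->
  evalmx f (charp ij) X = dco (map_mx f u) X ij.1 / dco (map_mx f u) X ij.2.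
Proof.
move=> y1; rewrite evalmxM evalmx_prod evalmx_dco.
under eq_bigr do rewrite evalmx_dco.
congr (_ * _); move: y1; rewrite (bigD1 ij.2)//= => y1.
have y0 : dco (map_mx f u) X ij.2 != 0.
  by apply: contra_eq_neq y1 => ->; rewrite mul0r eq_sym oner_neq0.
by rewrite -[LHS](mulKf y0) y1 mulr1.
Qed.

End Characters.

Section MaxProduct.
Variable L : realFieldType.

Lemma prod_choice_le m (x y : 'I_m -> L) (e : {ffun 'I_m -> bool}) :
  (forall l, 0 <= x l) -> (forall l, 0 <= y l) ->
  \prod_l (if e l then x l else y l) <= \prod_l Num.max (x l) (y l).
Proof.
move=> x0 y0; apply: ler_prod => l _; case: (e l); rewrite ?x0 ?y0 le_max lexx ?orbT//.
Qed.

Lemma prod_choice_eq m (x y : 'I_m -> L) : exists e : {ffun 'I_m -> bool},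
  \prod_l (if e l then x l else y l) = \prod_l Num.max (x l) (y l).
Proof.
exists [ffun l => y l <= x l]; apply: eq_bigr => l _; rewrite ffunE.
by case: (leP (y l) (x l)) => [|_].
Qed.

Variables (n : nat) (w : seq ('I_n * 'I_n)).
Implicit Types y : 'I_n -> L.

Definition wprod y := \prod_(ij <- w) Num.max (y ij.1 / y ij.2) (y ij.2 / y ij.1).

Lemma wprod_ge1 y : (forall i, 0 < y i) -> 1 <= wprod y.
Proof.
move=> y0; rewrite /wprod; elim: w => [|ij v IH]; first by rewrite big_nil.
have m1 : 1 <= Num.max (y ij.1 / y ij.2) (y ij.2 / y ij.1).
  by rewrite le_max !ler_pdivlMr// !mul1r; exact: le_total.
by rewrite big_cons -[leLHS]mulr1 ler_pM.
Qed.

Lemma wprod1 : wprod (fun=> 1) = 1.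
Proof. by rewrite /wprod big1// => ij _; rewrite divr1 maxxx. Qed.

Lemma wprodV y : wprod (fun i => (y i)^-1) = wprod y.
Proof. by apply: eq_bigr => ij _; rewrite !invrK maxC ![_^-1 * _]mulrC. Qed.

End MaxProduct.

(** * First-order forms of the two decomposition statements *)

Section Statements.
Variables (K : rcfType) (n r : nat) (G S : seq (mpoly.mpoly (n * n) K)).
Variables (h : 'I_r -> mpoly.mpoly (n * n) K) (u : 'M[K]_n).
Variables (w Dw : seq ('I_n * 'I_n)).

Local Notation pos L f := (torus_pos S h (L := L) f).
Local Notation env s := (fun k => nth 0 s k).

Definition KL (L : rcfType) (f : K -> L) : set 'M[L]_n :=
  [set k | points f G k /\ k *m k^T = 1%:M].

Definition triangle_property (L : rcfType) (f : {rmorphism K -> L}) :=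
  forall a b c k k' k'', pos L f a -> pos L f b -> pos L f c ->
    KL f k -> KL f k' -> KL f k'' -> a *m k *m b = k' *m c *m k'' ->
    wprod w (dco (map_mx f u) c) <=
    wprod w (dco (map_mx f u) a) * wprod w (dco (map_mx f u) b).

Definition cartan_property (L : rcfType) (f : {rmorphism K -> L}) :=
  forall g, points f G g -> exists k k' a, [/\ KL f k, KL f k', pos L f a, g = k *m a *m k' &
    forall ij, ij \in Dw -> 1 <= evalmx f (charp u ij) a].

Hypothesis pos_dco : forall (L : rcfType) (f : {rmorphism K -> L}) s, pos L f s ->
  \prod_i dco (map_mx f u) s i = 1 /\ forall i, 0 < dco (map_mx f u) s i.

Let wt (L : rcfType) (f : {rmorphism K -> L}) (e : {ffun 'I_(size w) -> bool}) (x : 'M[L]_n) :=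
  \prod_l (if e l then evalmx f (charp u (tnth (in_tuple w) l)) x
           else evalmx f (charp u ((tnth (in_tuple w) l).2, (tnth (in_tuple w) l).1)) x).

Let wprod_le (L : rcfType) (f : {rmorphism K -> L}) a b c :
  pos L f a -> pos L f b -> pos L f c ->
  wprod w (dco (map_mx f u) c) <= wprod w (dco (map_mx f u) a) * wprod w (dco (map_mx f u) b)
  <-> forall e, exists e' e'', wt f e c <= wt f e' a * wt f e'' b.
Proof.
move=> pa pb pc; pose X s (l : 'I_(size w)) := evalmx f (charp u (tnth (in_tuple w) l)) s.
pose Y s (l : 'I_(size w)) :=
  evalmx f (charp u ((tnth (in_tuple w) l).2, (tnth (in_tuple w) l).1)) s.
have wE s : pos L f s -> wprod w (dco (map_mx f u) s) = \prod_l Num.max (X s l) (Y s l).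
  move=> /pos_dco[p1 _]; rewrite /wprod [LHS]big_tnth; apply: eq_bigr => l _.
  by rewrite /X /Y !evalmx_charp.
have XY0 s : pos L f s -> (forall l, 0 <= X s l) /\ (forall l, 0 <= Y s l).
  move=> /pos_dco[p1 p0]; split=> l; rewrite /X /Y evalmx_charp//= divr_ge0// ltW//.
have [Xa Ya] := XY0 _ pa; have [Xb Yb] := XY0 _ pb; have [Xc Yc] := XY0 _ pc.
rewrite !wE//; split=> [abc e|abc].
  have [ea eaE] := prod_choice_eq (X a) (Y a); have [eb ebE] := prod_choice_eq (X b) (Y b).
  exists ea, eb; rewrite /wt eaE ebE; apply: le_trans abc.
  exact: (prod_choice_le e Xc Yc).
have [ec ecE] := prod_choice_eq (X c) (Y c); have [ea [eb le_ab]] := abc ec.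
rewrite -ecE; apply: le_trans le_ab _; apply: ler_pM.
- by apply: prodr_ge0 => l _; case: (ea l); [exact: Xa|exact: Ya].
- by apply: prodr_ge0 => l _; case: (eb l); [exact: Xb|exact: Yb].
- exact: (prod_choice_le ea Xa Ya).
- exact: (prod_choice_le eb Xb Yb).
Qed.

Let mdef_KL k : mdef (fun L f e => KL f (e k : 'M[L]_n)).
Proof. by apply: mdef_and; mdef_auto. Qed.

Lemma triangle_transfer (L : rcfType) (f : {rmorphism K -> L}) :
  triangle_property (GRing.RMorphism.clone K K idfun _) <-> triangle_property f.
Proof.
pose D : mx_family K n := fun L f e =>
  pos L f (e 0%N) -> pos L f (e 1%N) -> pos L f (e 2%N) ->
  KL f (e 3%N) -> KL f (e 4%N) -> KL f (e 5%N) ->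
  e 0%N *m e 3%N *m e 1%N = e 4%N *m e 2%N *m e 5%N ->
  forall eps, exists eps' eps'', wt f eps (e 2%N) <= wt f eps' (e 0%N) * wt f eps'' (e 1%N).
have DE (L' : rcfType) (f' : {rmorphism K -> L'}) : triangle_property f' <-> forall e, D L' f' e.
  split=> [T e pa pb pc Kk Kk' Kk'' E|T a b c k k' k'' pa pb pc Kk Kk' Kk'' E].
    by apply/wprod_le => //; exact: (T _ _ _ _ _ _ pa pb pc Kk Kk' Kk'' E).
  apply/wprod_le => //.
  exact: (T (env [:: a; b; c; k; k'; k'']) pa pb pc Kk Kk' Kk'' E).
rewrite !DE; apply: (@transfer_forall K n 6).
  rewrite /D; do 3 (apply: mdef_impl; first by mdef_auto).
  do 3 (apply: mdef_impl; first exact: mdef_KL).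
  apply: mdef_impl; first by mdef_auto.
  apply: mdef_forall_fin => e; apply: mdef_exists_fin => e'; apply: mdef_exists_fin => e''.
  have wtP eps k : sterm (fun L f (e : nat -> 'M[L]_n) => wt f eps (e k)).
    by apply: sterm_prod => l; case: (eps l); apply: sterm_evalmx; exact: mterm_var.
  by apply: mdef_le; [exact: wtP|apply: sterm_mul; exact: wtP].
by move=> L' f' e e' ee'; rewrite /D !ee'.
Qed.

Lemma cartan_transfer (L : rcfType) (f : {rmorphism K -> L}) :
  cartan_property (GRing.RMorphism.clone K K idfun _) <-> cartan_property f.
Proof.
pose C (L : rcfType) (f : {rmorphism K -> L}) (g k k' a : 'M[L]_n) :=
  KL f k /\ (KL f k' /\ (pos L f a /\ (g = k *m a *m k' /\
    forall l : 'I_(size Dw), 1%:R <= evalmx f (charp u (tnth (in_tuple Dw) l)) a))).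
pose D : mx_family K n := fun L f e => points f G (e 0%N) ->
  exists k k' a, C L f (e 0%N) k k' a.
have CE (L' : rcfType) (f' : {rmorphism K -> L'}) : cartan_property f' <-> forall e, D L' f' e.
  split=> [T e /T[k [k' [a [Kk Kk' pa E al]]]]|T g Gg].
    exists k, k', a; do 4 split=> //; move=> l; apply: al; exact: mem_tnth.
  have [k [k' [a [Kk [Kk' [pa [E al]]]]]]] := T (fun=> g) Gg.
  by exists k, k', a; split=> // ij /(tnthP (in_tuple Dw))[l ->].
rewrite !CE; apply: (@transfer_forall K n 1); last first.
  by move=> L' f' e e' ee'; rewrite /D !ee'.
rewrite /D; apply: mdef_impl; first by mdef_auto.
apply: (mdef_exists (k := 1) (D := fun L f e k => exists k' a, C L f (e 0%N) k k' a)) => //.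
apply: (mdef_exists (k := 2) (D := fun L f e k' => exists a, C L f (e 0%N) (e 1%N) k' a)) => //.
apply: (mdef_exists (k := 3) (D := fun L f e a => C L f (e 0%N) (e 1%N) (e 2%N) a)) => //.
apply: mdef_and; first exact: mdef_KL.
apply: mdef_and; first exact: mdef_KL.
apply: mdef_and; first by mdef_auto.
apply: mdef_and; first by mdef_auto.
by apply: mdef_forall_fin => l; mdef_auto.
Qed.

Lemma character_transfer p q (L : rcfType) (f : {rmorphism K -> L}) :
  (forall a, pos K idfun a -> evalmx idfun p a = evalmx idfun q a) <->
  (forall a, pos L f a -> evalmx f p a = evalmx f q a).
Proof.
pose D : mx_family K n := fun L f e => pos L f (e 0%N) -> evalmx f p (e 0%N) = evalmx f q (e 0%N).
have DE (L' : rcfType) (f' : {rmorphism K -> L'}) :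
    (forall a, pos L' f' a -> evalmx f' p a = evalmx f' q a) <-> forall e, D L' f' e.
  by split=> [T e|T a]; [exact: T|exact: (T (fun=> a))].
have := DE K (GRing.RMorphism.clone K K idfun _) => /= ->; rewrite DE.
apply: (@transfer_forall K n 1); first by rewrite /D; mdef_auto.
by move=> L' f' e e' ee'; rewrite /D !ee'.
Qed.

End Statements.

Section OppositeValuation.
Variables (F : rcfType) (O : convexSubring F).

Let piE (a b : nonzero F) :
  (\pi_(valueGroup O)%qT a = \pi_(valueGroup O)%qT b) <-> val_equiv O a b.
Proof. by split=> [/eqP|ab]; [|apply/eqP]; rewrite eqmodE. Qed.

Let pi_add (a b : nonzero F) :
  \pi_(valueGroup O)%qT a + \pi_(valueGroup O)%qT b = \pi_(valueGroup O)%qT (nzM a b).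
Proof.
apply/piE; have [_ _ OM] := convexSubringP O.
have rep (c : nonzero F) : val_equiv O (repr (\pi_(valueGroup O)%qT c)) c.
  by apply/piE; rewrite reprK.
have /andP[aa' a'a] := rep a; have /andP[bb' b'b] := rep b.
by apply/andP; rewrite /= !invfM; split; rewrite mulrACA; apply: OM.
Qed.

Let oppv_pi (x : F) (x0 : x != 0) : oppv O x = - \pi_(valueGroup O)%qT (Sub x x0 : nonzero F).
Proof. by rewrite /oppv /valuation insubT. Qed.

(** This turns the multiplicative triangle inequality for N into the additive one for the
    distance. *)
Lemma oppvM (x y : F) : x != 0 -> y != 0 -> oppv O (x * y) = oppv O x + oppv O y.
Proof.
move=> x0 y0; rewrite (oppv_pi x0) (oppv_pi y0) (oppv_pi (mulf_neq0 x0 y0)).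
rewrite -opprD pi_add; congr (- \pi_(valueGroup O)%qT _).
exact: val_inj.
Qed.

Lemma oppv1 : oppv O 1 = 0.
Proof.
have := oppvM (oner_neq0 F) (oner_neq0 F); rewrite mulr1 => /eqP.
by rewrite -subr_eq0 opprD addNKr oppr_eq0 => /eqP.
Qed.

End OppositeValuation.

(** * From K to R and to F: the pseudo-distance *)

Section Assembly.
Variables (K : rcfType) (R : realType) (F : rcfType).
Variables (iR : {rmorphism K -> R}) (iF : {rmorphism K -> F}) (n r : nat).
Variables (G S : seq (mpoly.mpoly (n * n) K)) (h : 'I_r -> mpoly.mpoly (n * n) K).
Variables (u : 'M[K]_n).

Local Notation pos L f := (torus_pos S h (L := L) f).

Hypothesis Ggrp : matrix_group (points idfun G).
Hypothesis Gtr : forall g, points idfun G g -> points idfun G g^T.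
Hypothesis Gdet : forall g, points idfun G g -> \det g = 1.
Hypothesis Sgeom : algebraic_group S.
Hypothesis Pgrp : matrix_group (pos K idfun).
Hypothesis Psym : forall s, pos K idfun s -> s^T = s.
Hypothesis Pcomm : forall s t, pos K idfun s -> pos K idfun t -> s *m t = t *m s.
Hypothesis Psqrt : forall s, pos K idfun s -> exists2 q, pos K idfun q & s = q *m q.
Hypothesis Psquare : forall s, points idfun S s -> pos K idfun (s *m s).
Hypothesis PG : pos K idfun `<=` points idfun G.
Hypothesis Pmax : forall q, points idfun G q -> q^T = q ->
  (forall s, pos K idfun s -> q *m s = s *m q) -> pos K idfun (q *m q).
Hypothesis A_KE : A_K S = pos K idfun.
Hypothesis uu : u *m u^T = 1%:M.
Hypothesis udiag : forall s, pos K idfun s -> is_diag_mx (u *m s *m u^T).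
Hypothesis dense : forall P, (forall s, pos K idfun s -> points idfun P s) ->
  geom_points S `<=` geom_points P.

Section Extension.
Variables (L : rcfType) (f : {rmorphism K -> L}).
Local Notation U := (map_mx f u).

Lemma ext_orth : U *m U^T = 1%:M.
Proof. by rewrite map_trmx -map_mxM uu map_mx1. Qed.

Lemma ext_group : matrix_group (points f G).
Proof. exact: (matrix_group_transfer (dset_points G) f Ggrp). Qed.

Lemma ext_pos_group : matrix_group (pos L f).
Proof. exact: (matrix_group_transfer (dset_torus_pos S h) f Pgrp). Qed.

Lemma ext_diag s : pos L f s -> is_diag_mx (U *m s *m U^T).
Proof. exact: torus_pos_diag_transfer udiag s. Qed.

Lemma ext_dmx s : pos L f s -> s = dmx U (dco U s).
Proof. by move=> ps; rewrite (dmx_dco ext_orth)//; exact: ext_diag. Qed.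

Lemma ext_dco s : pos L f s -> \prod_i dco U s i = 1 /\ forall i, 0 < dco U s i.
Proof.
move=> ps; split.
  have := points_det_transfer Gdet (torus_pos_points_transfer PG ps).
  by rewrite {1}(ext_dmx ps) (det_dmx ext_orth).
have [q [pq ->]] := torus_pos_sqrt_transfer Psqrt ps => i.
rewrite (ext_dmx pq) (dmxM ext_orth) (dco_dmx ext_orth) -expr2.
rewrite lt_neqAle sqr_ge0 andbT eq_sym sqrf_eq0.
have := points_det_transfer Gdet (torus_pos_points_transfer PG pq).
rewrite {1}(ext_dmx pq) (det_dmx ext_orth) => /eqP; apply: contraTneq => qi.
by rewrite (bigD1 i)//= qi mul0r eq_sym oner_eq0.
Qed.

End Extension.

Local Notation GR := (points iR G).
Local Notation AR := (pos R iR).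
Local Notation a := (Lie_A iR S).
Local Notation uR := (map_mx iR u).
Local Notation uF := (map_mx iF u).
Local Notation Sig := (Sigma iR G S).

Lemma A_RE : A_R iR S = AR.
Proof. by rewrite /A_R A_KE torus_pos_extension. Qed.

Lemma A_FE : A_F iF S = pos F iF.
Proof. by rewrite /A_F A_KE torus_pos_extension. Qed.

Let ARgrp := ext_pos_group iR.
Let ARsym := torus_pos_sym_transfer (f := iR) Psym.
Let ARsqrt := torus_pos_sqrt_transfer (f := iR) Psqrt.
Let ARsquare := torus_pos_square_transfer (f := iR) Psquare.
Let SRgrp : matrix_group (points iR S).
Proof.
exact: (matrix_group_transfer (dset_points S) iR (points_group Sgeom)).
Qed.

(** The default 0 in [Lie_space] is excluded because [Lie AR] is a linear subspace. *)
Lemma Lie_AP X : X \in a <-> Lie AR X.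
Proof.
have := Lie_torus_vspace SRgrp ARsquare; rewrite -A_RE /Lie_A /Lie_space.
by move=> [U UP]; case: xgetP => [V _ ->//|/(_ U)]; case.
Qed.

Let GRcl : closed GR. Proof. exact: closed_evalmx. Qed.
Let GRgrp := ext_group iR.
Let GRtr := points_tr_transfer (f := iR) Gtr.
Let GRdet := points_det_transfer (f := iR) Gdet.

Let GRpow X : X^T = X -> (forall m : nat, GR (mxexp (m%:R *: X))) -> Lie GR X.
Proof.
move=> /sym_dmx[v [d [vv ->]]] Gm t; rewrite scale_dmx mxexp_dmx//.
apply: points_real_power => // m; have := Gm m.
by rewrite scale_dmx mxexp_dmx.
Qed.

Let ARG : AR `<=` GR. Proof. exact: torus_pos_points_transfer PG. Qed.

Let ARexp x : AR x -> exists2 X, X \in a & x = mxexp X.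
Proof.
move=> /(torus_pos_exp SRgrp ARgrp ARsym ARsqrt ARsquare)[v [d [vv -> vt]]].
exists (dmx v d); last by rewrite mxexp_dmx.
by apply/Lie_AP => t; rewrite scale_dmx mxexp_dmx.
Qed.

Let ARmax := torus_maximal_transfer (f := iR) Pmax.
Let ARcomm := torus_pos_comm_transfer (f := iR) Pcomm.
Let uuR := ext_orth iR.

Let exp_a H : H \in a -> AR (mxexp H).
Proof. by move=> /Lie_AP/(_ 1); rewrite scale1r. Qed.

Let udiagR X : X \in a -> is_diag_mx (uR *m X *m uR^T).
Proof.
move=> /Lie_AP LX; apply/is_diag_mxP => i j ij.
pose f (Y : 'M[R]_n) : 'M[R]_n := ((uR *m Y *m uR^T) i j)%:M.
have : f X = 0.
  apply: (@mxexp_linear_vanish _ _ f (nrm (1%:M : 'M[R]_n) * (nrm uR * nrm uR))).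
  - by move=> Y Z; rewrite /f mulmxDr mulmxDl mxE raddfD.
  - by move=> c Y; rewrite /f -scalemxAr -scalemxAl mxE -scale_scalar_mx.
  - by rewrite !mulr_ge0 ?nrm_ge0.
  - move=> Y; rewrite /f -scalemx1 nrmZ mulrC -mulrA ler_wpM2l ?nrm_ge0//.
    apply: le_trans (nrm_entry _ i j) _; apply: le_trans (nrmM _ _) _.
    rewrite nrm_trmx [X in _ <= X]mulrAC ler_wpM2r ?nrm_ge0//; exact: nrmM.
  - rewrite /f mulmx1 uuR mxE; have -> : (i == j) = false by apply/negbTE.
    by rewrite raddf0.
  - move=> t; have /is_diag_mxP/(_ i j ij) := ext_diag (LX t).
    by rewrite /f => ->; rewrite raddf0.
by move=> /matrixP/(_ i i); rewrite !mxE eqxx mulr1n.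
Qed.

Let mxexp_dco H i : H \in a -> dco uR (mxexp H) i = expR (dg uR H i).
Proof.
move=> aH; rewrite -{1}(dmx_dco uuR (udiagR aH)) mxexp_dmx//.
by rewrite dco_dmx.
Qed.

Lemma Sigma_enum : exists s : seq ('Hom(subvs_of a, R^o) * ('I_n * 'I_n)),
  [/\ uniq (unzip1 s), forall alpha, Sig alpha <-> alpha \in unzip1 s &
    forall x, x \in s -> root_pair uR x.2 x.1].
Proof. exact: (root_enum GR uuR udiagR). Qed.

Section WithRoots.
Variable Delta : seq 'Hom(subvs_of a, R^o).
Hypothesis Delta_basis : root_basis Sig Delta.
Variable s : seq ('Hom(subvs_of a, R^o) * ('I_n * 'I_n)).
Hypothesis s_uniq : uniq (unzip1 s).
Hypothesis sP : forall alpha, Sig alpha <-> alpha \in unzip1 s.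
Hypothesis s_pair : forall x, x \in s -> root_pair uR x.2 x.1.

Local Notation w := (unzip2 s).
Local Notation Dw := [seq x.2 | x <- s & x.1 \in Delta].

Let wprod_mxexp H : H \in a -> wprod w (dco uR (mxexp H)) = expR (root_sum uR s H).
Proof.
move=> aH; rewrite /wprod big_map expR_sum; apply: eq_bigr => x _.
rewrite !mxexp_dco// -!expRN -!expRD; move: (dg uR H x.2.1) (dg uR H x.2.2) => p q.
have [pq|qp] := leP p q; last by rewrite ger0_norm ?subr_ge0 ?ltW// max_l// ler_expR; lra.
by rewrite ler0_norm ?subr_le0// opprB max_r// ler_expR; lra.
Qed.

Lemma triangle_R : triangle_property G S h u w iR.
Proof.
move=> x y z k k' k'' Ax Ay Az Kk Kk' Kk''.
have [H1 aH1 ->] := ARexp Ax; have [H2 aH2 ->] := ARexp Ay; have [H3 aH3 ->] := ARexp Az.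
move=> E; apply: (eq_ind_r is_true _ (congr2 (fun p q : R => p <= q) (wprod_mxexp aH3)
  (congr2 (fun p q : R => p * q) (wprod_mxexp aH1) (wprod_mxexp aH2)))).
rewrite -expRD ler_expR.
exact: (root_triangle GRcl GRgrp GRtr GRdet GRpow ARG ARsym ARcomm Lie_AP ARexp ARmax
  uuR udiagR s_uniq sP s_pair aH1 aH2 aH3 Kk Kk' Kk'' E).
Qed.

Let charp_mxexp ij H : H \in a ->
  evalmx iR (charp u ij) (mxexp H) = expR (dg uR H ij.1 - dg uR H ij.2).
Proof.
move=> aH; have [p1 _] := ext_dco (exp_a aH).
by rewrite (evalmx_charp _ p1) !mxexp_dco// expRD expRN.
Qed.

Lemma cartan_R : cartan_property G S h u Dw iR.
Proof.
move=> g Gg; have [k [k' [H [Kk Kk' aH gE Hpos]]]] :=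
  root_cartan GRcl GRgrp GRtr GRpow ARG ARsym Lie_AP ARexp ARmax uuR udiagR Delta_basis Gg.
exists k, k', (mxexp H); split=> //; first exact: exp_a.
move=> ij /mapP[x]; rewrite mem_filter => /andP[xD xs] ->.
rewrite charp_mxexp// -expR0 ler_expR -{1 2}(vsprojK aH) -(s_pair xs).
exact: Hpos.
Qed.

(** All complex points of S are diagonal in the basis u with determinant 1, since the positive ones
    are and they are dense; there [charp] is a quotient of two eigenvalues. *)
Lemma charp_represents x : x \in s -> represents_char x.1 (charp u x.2).
Proof.
move=> xs; split; last first.
  move=> H; rewrite charp_mxexp; last exact: subvsP.
  by rewrite (s_pair xs).
pose rc := real_complex K; pose v := map_mx rc u.
have vv : v *m v^T = 1%:M by rewrite /v map_trmx -map_mxM uu map_mx1.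
have S_diag z : geom_points S z -> is_diag_mx (v *m z *m v^T) /\ \prod_i dco v z i = 1.
  move=> Sz; have : geom_points (diag_torus u 1%:M pred0) z.
    apply: dense Sz => y py; have := ext_diag (f := idfun) py; have := ext_dco (f := idfun) py.
    move=> [p1 _] dy; apply: (diag_torusP u 1%:M pred0 (GRing.RMorphism.clone K K idfun _) y).2.
    by split.
  by move=> /(diag_torusP u 1%:M pred0 rc z).1[].
have dco_neq0 z i : geom_points S z -> dco v z i != 0.
  move=> /S_diag[_ z1]; apply: contra_eq_neq z1 => zi.
  by rewrite (bigD1 i)//= zi mul0r eq_sym oner_neq0.
split=> [z Sz|z t Sz St]; have [dz z1] := S_diag z Sz.
  by rewrite evalmx_charp// mulf_neq0 ?invr_eq0// dco_neq0.
have [dt t1] := S_diag t St.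
have ztE i : dco v (z *m t) i = dco v z i * dco v t i.
  by rewrite -{1}(dmx_dco vv dz) -{1}(dmx_dco vv dt) (dmxM vv) (dco_dmx vv).
rewrite !evalmx_charp//; last first.
  by under eq_bigr do rewrite ztE; rewrite big_split/= z1 t1 mulr1.
by rewrite !ztE invfM mulrACA.
Qed.

(** Any polynomial representing the root agrees with [charp] on A over R, where both are the
    exponential of the root; the equality descends to K and ascends to F, so the choice made by
    [xget] is immaterial. *)
Lemma chi_charp x c : x \in s -> pos F iF c -> chi iR iF S x.1 c = evalmx iF (charp u x.2) c.
Proof.
move=> xs Fc; rewrite /chi; case: xgetP => [_ -> [p [_ pE] ->]|].
  have := (character_transfer S h p (charp u x.2) iF).1; apply=> //.
  apply/(character_transfer S h p (charp u x.2) iR).2 => t /ARexp[H aH ->].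
  rewrite -[H](vsprojK aH) pE; have [_ ->] := charp_represents xs.
  by [].
move=> /(_ (evalmx iF (charp u x.2) c)); case.
by exists (charp u x.2) => //; exact: charp_represents.
Qed.

Lemma N_FE c : pos F iF c -> N_F iR iF G S c = wprod w (dco uF c).
Proof.
move=> Fc; rewrite /N_F (_ : Sig = [set` unzip1 s]); last first.
  by apply/seteqP; split=> al /sP.
rewrite -fsbig_seq// /wprod !big_map; apply: eq_big_seq => x xs.
have [p1 _] := ext_dco Fc.
by rewrite (chi_charp xs Fc) (evalmx_charp _ p1) invf_div.
Qed.

Let A_F_plusP c : A_F_plus iR iF S Delta c <->
  pos F iF c /\ forall ij, ij \in Dw -> 1 <= evalmx iF (charp u ij) c.
Proof.
have [_ DS _] := Delta_basis.
rewrite /A_F_plus A_FE; split=> -[Fc Hc]; split=> //.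
  move=> ij /mapP[x]; rewrite mem_filter => /andP[xD xs] ->.
  by rewrite -chi_charp//; exact: Hc.
move=> al alD /=; have /sP/mapP[x xs alE] := DS al alD.
rewrite alE chi_charp//; apply: Hc; apply/mapP; exists x => //.
by rewrite mem_filter -alE alD.
Qed.

Let GF := points iF G.
Let GFgrp : matrix_group GF := ext_group iF.
Let GFdet := points_det_transfer (f := iF) Gdet.
Let GFtr := points_tr_transfer (f := iF) Gtr.

Let K_FP k : K_F iF G k <-> KL G iF k.
Proof.
split=> [[Gk [kk _]]|[Gk kk]]; first by [].
by split=> //; split=> //; exact: GFdet.
Qed.

Let GFu g : GF g -> g \in unitmx. Proof. by move=> Gg; case: GFgrp => _ _ /(_ g Gg)[]. Qed.
Let GFV g : GF g -> GF (invmx g). Proof. by move=> Gg; case: GFgrp => _ _ /(_ g Gg)[]. Qed.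
Let GFM g g' : GF g -> GF g' -> GF (g *m g'). Proof. by case: GFgrp => _ + _; exact. Qed.

Let KFM k k' : KL G iF k -> KL G iF k' -> KL G iF (k *m k').
Proof.
move=> [Gk kk] [Gk' kk']; split; first exact: GFM.
by rewrite trmx_mul mulmxA -(mulmxA k) kk' mulmx1.
Qed.

Let KFT k : KL G iF k -> KL G iF k^T.
Proof.
by move=> [Gk kk]; split; [exact: GFtr|rewrite trmxK; exact: mulmx1C].
Qed.

Let KF1 : KL G iF 1%:M.
Proof. by split; [case: GFgrp|rewrite trmx1 mulmx1]. Qed.

(** The representatives hidden in two values of [delta] at a common point differ by an element of K;
    this lets the Cartan decompositions be glued. *)
Let stab g g' : GF g -> GF g' -> act g 1%:M = act g' 1%:M -> KL G iF (invmx g *m g').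
Proof.
move=> Gg Gg'; rewrite /act !mulmx1 => E; split; first by apply: GFM => //; exact: GFV.
rewrite trmx_mul mulmxA -(mulmxA (invmx g)) -E trmx_inv mulmxA mulVmx ?GFu// mul1mx.
by rewrite mulmxV// unitmx_tr GFu.
Qed.

(** The Cartan decomposition over F rules out the default value of [delta]. *)
Let deltaP x y : X_F iF G x -> X_F iF G y -> let c := delta iR iF G S Delta x y in
  pos F iF c /\ exists g g', [/\ GF g, GF g', x = act g 1%:M, y = act g' 1%:M &
    exists k k', [/\ KL G iF k, KL G iF k' & invmx g *m g' = k *m c *m k']].
Proof.
move=> [g Gg xE] [g' Gg' yE] c; rewrite /c /delta; case: xgetP => [c' _|/(_ _)].
  move=> [/A_F_plusP[Fc _] [g1 [g2 [Gg1 Gg2 xE' yE' [k [k' [/K_FP Kk /K_FP Kk' E]]]]]]].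
  by split=> //; exists g1, g2; split=> //; exists k, k'.
have : cartan_property G S h u Dw iF.
  by apply/(cartan_transfer G S h u Dw iF).1/(cartan_transfer G S h u Dw iR).2; exact: cartan_R.
move=> /(_ _ (GFM (GFV Gg) Gg'))[k [k' [c' [Kk Kk' Fc E Hc]]]] /(_ c'); case; split.
  exact/A_F_plusP.
exists g, g'; split=> //; exists k, k'; split=> //; exact/K_FP.
Qed.

Let triangle_F x y z k k' k'' : pos F iF x -> pos F iF y -> pos F iF z ->
  KL G iF k -> KL G iF k' -> KL G iF k'' -> x *m k *m y = k' *m z *m k'' ->
  wprod w (dco uF z) <= wprod w (dco uF x) * wprod w (dco uF y).
Proof.
have T L f := @triangle_transfer K n r G S h u w (@ext_dco) L f.
by apply: (T F iF).1; apply: (T R iR).2; exact: triangle_R.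
Qed.

Let KF_move (A B k k' c M : 'M[F]_n) : KL G iF A -> KL G iF B -> k *m c *m k' = A *m M *m B ->
  M = (A^T *m k) *m c *m (k' *m B^T).
Proof.
move=> [_ /mulmx1C AA] [_ BB] E.
have -> : (A^T *m k) *m c *m (k' *m B^T) = A^T *m (k *m c *m k') *m B^T.
  by rewrite !mulmxA.
by rewrite E !mulmxA AA mul1mx -mulmxA BB mulmx1.
Qed.

Let FP : matrix_group (pos F iF) := ext_pos_group iF.
Let F1 : pos F iF 1%:M. Proof. by case: FP. Qed.
Let FV c : pos F iF c -> pos F iF (invmx c).
Proof. by move=> Fc; case: FP => _ _ /(_ c Fc)[]. Qed.

Let wprod_1 : wprod w (dco uF 1%:M) = 1.
Proof.
rewrite -[RHS](wprod1 _ w); congr wprod; apply/funext => i.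
by rewrite /dco mulmx1 (ext_orth iF) mxE eqxx.
Qed.

Let wprod_V c : pos F iF c -> wprod w (dco uF (invmx c)) = wprod w (dco uF c).
Proof.
move=> Fc; have [_ c0] := ext_dco Fc; rewrite -[RHS]wprodV; congr wprod.
apply/funext => i; rewrite {1}(ext_dmx Fc) dmxV ?(ext_orth iF)//; last first.
  by move=> j; exact: lt0r_neq0.
by rewrite (dco_dmx (ext_orth iF)).
Qed.

Local Notation N x y := (wprod w (dco uF (delta iR iF G S Delta x y))).

Let N_ge1 x y : X_F iF G x -> X_F iF G y -> 1 <= N x y.
Proof.
by move=> Xx Xy; have [/ext_dco[_ c0] _] := deltaP Xx Xy; exact: wprod_ge1.
Qed.

(** The triangle inequality with a = b = 1 gives N <= 1, as two representatives of x differ by an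
    element of K. *)
Let N_refl x : X_F iF G x -> N x x = 1.
Proof.
move=> Xx; apply/eqP; rewrite eq_le N_ge1// andbT.
have [Fc [g [g' [Gg Gg' xE xE' [k [k' [Kk Kk' E]]]]]]] := deltaP Xx Xx.
have Kg : KL G iF (invmx g *m g') by apply: stab; rewrite -?xE.
rewrite -[1]mulr1 -{1 2}wprod_1; apply: (triangle_F F1 F1 Fc Kg Kk Kk').
by rewrite mul1mx mulmx1.
Qed.

(** If e is the projection for (y, x), then the one for (x, y) lies in the double coset K e^-1 K;
    the triangle inequality with factors e^-1 and 1 applies, and N(e^-1) = N(e). *)
Let N_sym_le x y : X_F iF G x -> X_F iF G y -> N x y <= N y x.
Proof.
move=> Xx Xy.
have [Fc [g [g' [Gg Gg' xE yE [k [k' [Kk Kk' E]]]]]]] := deltaP Xx Xy.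
have [Fe [l [l' [Gl Gl' yE' xE' [m [m' [Km Km' E']]]]]]] := deltaP Xy Xx.
set c := delta _ _ _ _ _ x y in Fc E *; set e := delta _ _ _ _ _ y x in Fe E' *.
have K1 : KL G iF (invmx g *m l') by apply: stab; rewrite -?xE.
have K2 : KL G iF (invmx l *m g') by apply: stab; rewrite -?yE'.
have ue : e \in unitmx by case: FP => _ _ /(_ e Fe)[].
have Einv : invmx l' *m l = m'^T *m invmx e *m m^T.
  have [[_ mm] [_ mm']] := (Km, Km').
  have prod1 : (invmx l *m l') *m (m'^T *m invmx e *m m^T) = 1%:M.
    by rewrite E' !mulmxA -(mulmxA _ m') mm' mulmx1 mulmxK.
  have ull : invmx l *m l' \in unitmx by rewrite unitmx_mul unitmx_inv !GFu.
  rewrite -[RHS](mulKmx ull) prod1 mulmx1.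
  apply: (can_inj (mulKmx ull)); rewrite mulmxV// !mulmxA.
  by rewrite -(mulmxA _ l') mulmxV ?GFu// mulmx1 mulVmx ?GFu.
have EE : k *m c *m k' = (invmx g *m l' *m m'^T) *m invmx e *m (m^T *m (invmx l *m g')).
  rewrite -E; have -> : (invmx g *m l' *m m'^T) *m invmx e *m (m^T *m (invmx l *m g')) =
      invmx g *m l' *m (m'^T *m invmx e *m m^T) *m (invmx l *m g') by rewrite !mulmxA.
  by rewrite -Einv !mulmxA mulmxK ?GFu// mulmxK ?GFu.
have KA := KFM K1 (KFT Km'); have KB := KFM (KFT Km) K2.
have := triangle_F (FV Fe) F1 Fc KF1 (KFM (KFT KA) Kk) (KFM Kk' (KFT KB)).
rewrite wprod_1 mulr1 (wprod_V Fe) !mulmx1; apply.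
exact: KF_move KA KB EE.
Qed.

Let N_triangle x y z : X_F iF G x -> X_F iF G y -> X_F iF G z -> N x y <= N x z * N z y.
Proof.
move=> Xx Xy Xz.
have [Fc [g [g' [Gg Gg' xE yE [k [k' [Kk Kk' E]]]]]]] := deltaP Xx Xy.
have [Fb [g1 [g1' [Gg1 Gg1' xE1 zE1 [l [l' [Kl Kl' E1]]]]]]] := deltaP Xx Xz.
have [Fe [g2 [g2' [Gg2 Gg2' zE2 yE2 [m [m' [Km Km' E2]]]]]]] := deltaP Xz Xy.
set c := delta _ _ _ _ _ x y in Fc E *; set b := delta _ _ _ _ _ x z in Fb E1 *.
set e := delta _ _ _ _ _ z y in Fe E2 *.
have K1 : KL G iF (invmx g *m g1) by apply: stab; rewrite -?xE.
have K2 : KL G iF (invmx g1' *m g2) by apply: stab; rewrite -?zE1.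
have K3 : KL G iF (invmx g2' *m g') by apply: stab; rewrite -?yE2.
have EE : k *m c *m k' = (invmx g *m g1 *m l) *m (b *m (l' *m (invmx g1' *m g2) *m m) *m e) *m
    (m' *m (invmx g2' *m g')).
  rewrite -E; have -> : (invmx g *m g1 *m l) *m (b *m (l' *m (invmx g1' *m g2) *m m) *m e) *m
    (m' *m (invmx g2' *m g')) = invmx g *m g1 *m (l *m b *m l') *m (invmx g1' *m g2) *m
      (m *m e *m m') *m (invmx g2' *m g') by rewrite !mulmxA.
  by rewrite -E1 -E2 !mulmxA !(mulmxK, GFu).
have KA := KFM K1 Kl; have KB := KFM Km' K3.
exact: (triangle_F Fb Fe Fc (KFM (KFM Kl' K2) Km) (KFM (KFT KA) Kk) (KFM Kk' (KFT KB))
  (KF_move KA KB EE)).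
Qed.

Lemma dist_pseudo (O : convexSubring F) :
  let X := X_F iF G in
  let d := dist iR iF G S O Delta in
  (forall x, X x -> d x x = 0) /\
  (forall x y, X x -> X y -> 0 <= d x y) /\
  (forall x y, X x -> X y -> d x y = d y x) /\
  (forall x y z, X x -> X y -> X z -> d x y <= d x z + d z y).
Proof.
move=> X d; have dE x y : X x -> X y -> d x y = oppv O (N x y).
  by move=> Xx Xy; have [Fc _] := deltaP Xx Xy; rewrite /d /dist N_FE.
have N0 x y : X x -> X y -> 0 < N x y by move=> Xx Xy; exact: lt_le_trans (N_ge1 Xx Xy).
split; first by move=> x Xx; rewrite dE// N_refl// oppv1.
split; first by move=> x y Xx Xy; rewrite dE// -(oppv1 O) oppv_le// N_ge1.
split.
  move=> x y Xx Xy; rewrite !dE//; congr oppv; apply/eqP.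
  by rewrite eq_le !N_sym_le.
move=> x y z Xx Xy Xz; rewrite !dE// -oppvM ?lt0r_neq0 ?N0//.
by apply: oppv_le; [exact: N0|exact: N_triangle].
Qed.

End WithRoots.

End Assembly.

Theorem theorem4p5 (K : rcfType) (R : realType) (F : rcfType)
    (iR : {rmorphism K -> R}) (iF : {rmorphism K -> F})
    (O : convexSubring F) (n : nat) (G S : seq (mpoly.mpoly (n * n) K))
    (Delta : seq 'Hom(subvs_of (Lie_A iR S), R^o)) :
  (exists c : F, c \notin O) ->
  algebraic_group G ->
  zariski_connected (geom_points G) ->
  semisimple (geom_points G) ->
  self_adjoint G ->
  maximal_split_torus G S ->
  symmetric_points S ->
  root_basis (Sigma iR G S) Delta ->
  let X := X_F iF G in
  let d := dist iR iF G S O Delta in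
  (forall x, X x -> d x x = 0) /\
  (forall x y, X x -> X y -> 0 <= d x y) /\
  (forall x y, X x -> X y -> d x y = d y x) /\
  (forall x y z, X x -> X y -> X z -> d x y <= d x z + d z y).
Proof.
move=> _ Gg _ _ Gsa Smax Ssym Dbasis.
have [[Sg [r [f [h [phiS psiS phiK psiK phiM]]]]] _ _] := Smax.
pose phi (t : 'rV[K[i]]_r) : 'M[K[i]]_n := \matrix_(i, j) Gm_eval (f i j) t.
pose psi (s : 'M[K[i]]_n) : 'rV[K[i]]_r := \row_k evalmx (real_complex K) (h k) s.
have [phiE psiE] : (forall t, phi t = \matrix_(i, j) Gm_eval (f i j) t) /\
  (forall s, psi s = \row_k evalmx (real_complex K) (h k) s) by [].
change (forall t, Gm t -> geom_points S (phi t)) in phiS.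
change (forall s, geom_points S s -> Gm (psi s)) in psiS.
change (forall t, Gm t -> psi (phi t) = t) in phiK.
change (forall s, geom_points S s -> phi (psi s) = s) in psiK.
change (forall t u, Gm t -> Gm u -> phi (Gm_mul t u) = phi t *m phi u) in phiM.
(* Keeping the two morphisms abstract, known only through [phiE] and [psiE], matches the form in
   which the torus lemmas are stated. *)
clearbody phi psi.
pose pos := torus_pos S h idfun.
have Pgrp : matrix_group pos := torus_pos_group psiE Sg psiS phiK psiK phiM.
have Psym : forall s, pos s -> s^T = s := torus_pos_sym Ssym.
have Pcomm : forall s t, pos s -> pos t -> s *m t = t *m s :=
  torus_pos_comm psiS psiK phiM.
have Psqrt : forall s, pos s -> exists2 q, pos q & s = q *m q :=
  torus_pos_sqrt phiE psiE phiS phiK psiK phiM.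
have Psquare : forall s, points idfun S s -> pos (s *m s) :=
  torus_pos_square psiE Sg psiS phiK psiK phiM.
have PG : forall s, pos s -> points idfun G s := torus_pos_G Smax.
have [u uu udiag] := simultaneous_diag Psym Pcomm.
have hN0 s : points idfun S s -> forall k, evalmx idfun (h k) s != 0.
  move=> /(points_morph (real_complex K) idfun S s).2/psiS Ss k.
  have := Ss k; rewrite psiE mxE; apply: contraNneq => hs.
  have := evalmx_morph (real_complex K) idfun (h k) s; rewrite hs rmorph0 => <-.
  by [].
have A_KE := sa_component_torus iR (points_group Sg) Pgrp Psym Psqrt Psquare hN0.
have Pdense := torus_dense phiE psiE phiS psiS phiK psiK.
have Pmax q (Gq : points idfun G q) (qs : q^T = q) :=
  torus_maximal phiE psiE Sg phiS psiS phiK psiK phiM Gg Smax Ssym Gq qs.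
have Gtr g := @points_tr _ _ G g Gsa.
have [s [us sP s_pair]] := Sigma_enum iR G Sg Psquare A_KE uu udiag.
exact: (dist_pseudo iF (points_group Gg) Gtr (points_det Gg) Sg Pgrp
  Psym Pcomm Psqrt Psquare PG Pmax A_KE uu udiag Pdense Dbasis us sP s_pair O).
Qed.
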